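(* Let $\mu_{\boldsymbol p}$ be a Gatzouras--Lalley measure with separation of principal projections, where $\boldsymbol p\in\mathcal P$ is strictly positive. Then $f_{\boldsymbol p}(\alpha)=\vartheta_{\boldsymbol p}^*(\alpha)$ for all values $\alpha=\vartheta_{\boldsymbol p}'(q)$ where $q\in\mathbb R$ is such that the derivative $\vartheta_{\boldsymbol p}'(q)$ exists.
   Context: **Gatzouras--Lalley IFS.** Let $\mathcal I$ be a finite index set with $\#\mathcal I\ge 2$. For $i\in\mathcal I$, $j\in\{1,2\}$ let $\beta_{i,j}\in(0,1)$ and $d_{i,j}\in\mathbb R$, and set $T_i(x_1,x_2)=(\beta_{i,1}x_1+d_{i,1},\beta_{i,2}x_2+d_{i,2})$ and $S_i(x)=\beta_{i,1}x+d_{i,1}$. Assume $T_i((0,1)^2)\subset(0,1)^2$ for all $i$. Write $i\sim j$ if $S_i=S_j$; let $\eta(\mathcal I)$ be the set of equivalence classes (the ''columns''); $S_\ell$ is well defined for $\ell\in\eta(\mathcal I)$. The IFS is Gatzouras--Lalley if (i) $\beta_{i,1}>\beta_{i,2}$ for all $i$; (ii) $T_i((0,1)^2)\cap T_j((0,1)^2)=\varnothing$ for $i\ne j$ in $\mathcal I$; (iii) $S_\ell((0,1))\cap S_{m}((0,1))=\varnothing$ for $\ell\ne m$ in $\eta(\mathcal I)$. Let $\Lambda$ be the unique non-empty compact set with $\Lambda=\bigcup_iT_i(\Lambda)$ and let $\eta(\Lambda)$ be its projection to the first coordinate. The IFS has *separation of principal projections* if $T_i(\Lambda)\cap T_j(\Lambda)=\varnothing$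 for $i\neq j$ in $\mathcal I$ and $S_\ell(\eta(\Lambda))\cap S_m(\eta(\Lambda))=\varnothing$ for $\ell\ne m$ in $\eta(\mathcal I)$. **Measures.** $\mathcal P$ is the simplex of probability vectors on $\mathcal I$. For $\boldsymbol p\in\mathcal P$, $\mu_{\boldsymbol p}$ is the unique Borel probability measure with $\mu_{\boldsymbol p}=\sum_ip_i\,\mu_{\boldsymbol p}\circ T_i^{-1}$, called a Gatzouras--Lalley measure. **Multifractal spectrum.** $\dim_{\mathrm{loc}}(\mu,x)=\lim_{r\to0}\log\mu(B(x,r))/\log r$ when the limit exists, and $f_{\boldsymbol p}(\alpha)=\dim_{\mathrm H}\{x\in\operatorname{supp}\mu_{\boldsymbol p}:\dim_{\mathrm{loc}}(\mu_{\boldsymbol p},x)\text{ exists and equals }\alpha\}$, with $\dim_{\mathrm H}\varnothing=-\infty$. **Fine $L^q$-spectrum.** For a Borel probability measure $\mu$ and $E\subset\operatorname{supp}\mu$, with $B(x,r)$ the closed ball, let $\overline{\mathcal H}^{q,t}_{\mu,\delta}(E)=\inf\{\sum_i\mu(B(x_i,r_i))^qr_i^t: x_i\in E,\ E\subset\bigcup_iB(x_i,r_i),\ r_i\le\delta\}$ (countable covers), $\mathcal H^{q,t}_\mu(E)=\sup_{F\subset E}\sup_{\delta>0}\overline{\mathcal H}^{q,t}_{\mu,\delta}(F)$, and $b_\mu(E,q)=\inf\{t:\mathcal H^{q,t}_\mu(E)<\infty\}$. Then $\vartheta_\mu(q)=-b_\mu(\operatorname{supp}\mu,q)$ and $\vartheta_{\boldsymbol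 p}=\vartheta_{\mu_{\boldsymbol p}}$. The concave conjugate is $\vartheta_{\boldsymbol p}^*(\alpha)=\inf_{q\in\mathbb R}(q\alpha-\vartheta_{\boldsymbol p}(q))$. *)

(* Defs.v *)
From mathcomp Require Import all_boot all_order all_algebra.
From mathcomp Require Import all_classical all_reals all_analysis.
Set Implicit Arguments.
Unset Strict Implicit.
Unset Printing Implicit Defensive.
Import Order.TTheory GRing.Theory Num.Theory.
Import numFieldNormedType.Exports.
Local Open Scope classical_set_scope.
Local Open Scope ring_scope.

(* The norm of the library on R * R is the sup norm, hence an explicit
   Euclidean metric. *)
Definition edist (R : realType) (x y : R * R) : R :=
  Num.sqrt ((x.1 - y.1) ^+ 2 + (x.2 - y.2) ^+ 2).

Definition cball (R : realType) (x : R * R) (r : R) : set (R * R) :=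
  [set y | edist x y <= r].

Record diag_ifs (R : realType) (I : finType) := DiagIFS {
  contr1 : I -> R;
  contr2 : I -> R;
  trans1 : I -> R;
  trans2 : I -> R }.

Definition ifs_map (R : realType) (I : finType) (T : diag_ifs R I) (i : I)
    (x : R * R) : R * R :=
  (contr1 T i * x.1 + trans1 T i, contr2 T i * x.2 + trans2 T i).

Definition col_map (R : realType) (I : finType) (T : diag_ifs R I) (i : I)
    (x : R) : R :=
  contr1 T i * x + trans1 T i.

Definition unit_interval (R : realType) : set R := [set x | 0 < x < 1].
Arguments unit_interval : clear implicits.
Definition unit_square (R : realType) : set (R * R) :=
  unit_interval R `*` unit_interval R.
Arguments unit_square : clear implicits.

(* The columns are the classes of the relation col_map T i = col_map T j, so
   "distinct columns" is expressed on representatives as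
   col_map T i <> col_map T j. *)
Record gatzouras_lalley (R : realType) (I : finType) (T : diag_ifs R I) : Prop
    := GatzourasLalley {
  gl_card : (2 <= #|I|)%N;
  gl_contr1 : forall i, 0 < contr1 T i < 1;
  gl_contr2 : forall i, 0 < contr2 T i < 1;
  gl_square : forall i, ifs_map T i @` unit_square R `<=` unit_square R;
  gl_dominated : forall i, contr2 T i < contr1 T i;
  gl_rect : forall i j, i <> j ->
    (ifs_map T i @` unit_square R) `&` (ifs_map T j @` unit_square R) = set0;
  gl_col : forall i j, col_map T i <> col_map T j ->
    (col_map T i @` unit_interval R) `&` (col_map T j @` unit_interval R)
      = set0 }.

Definition is_attractor (R : realType) (I : finType) (T : diag_ifs R I)
    (L : set (R * R)) : Prop :=
  [/\ L !=set0, compact L & L = \bigcup_(i in [set: I]) (ifs_map T i @` L)].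

Definition separation_of_principal_projections (R : realType) (I : finType)
    (T : diag_ifs R I) (L : set (R * R)) : Prop :=
  (forall i j, i <> j -> (ifs_map T i @` L) `&` (ifs_map T j @` L) = set0) /\
  (forall i j, col_map T i <> col_map T j ->
    (col_map T i @` (fst @` L)) `&` (col_map T j @` (fst @` L)) = set0).

Definition probability_vector (R : realType) (I : finType) (p : I -> R) : Prop
  := (forall i, 0 <= p i) /\ \sum_(i : I) p i = 1.

(* The product of the Borel sigma-algebras is the Borel sigma-algebra of the
   plane. *)
Definition self_similar (R : realType) (I : finType) (T : diag_ifs R I)
    (p : I -> R)
    (mu : probability (measurableTypeR R * measurableTypeR R)%type R) : Prop :=
  forall A : set (measurableTypeR R * measurableTypeR R), measurable A ->
    mu A = (\sum_(i : I) (p i)%:E * mu (ifs_map T i @^-1` A))%E.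

(* The topological support. *)
Definition supp (R : realType) (mu : set (R * R) -> \bar R) : set (R * R) :=
  [set x | forall r : R, 0 < r -> (0 < mu (cball x r))%E].

Definition has_local_dim (R : realType) (mu : set (R * R) -> \bar R)
    (x : R * R) (alpha : R) : Prop :=
  (fun r : R => ln (fine (mu (cball x r))) / ln r) @ 0^'+ --> alpha.

Definition ediam (R : realType) (A : set (R * R)) : \bar R :=
  ereal_sup [set (edist z.1 z.2)%:E | z in A `*` A].

(* For nonempty A, the s-th power of the diameter, with 0 `^ 0 = 1, so that the
   0-dimensional Hausdorff measure is the counting measure; the empty set
   contributes 0 for every s, so finite covers can be padded to sequences. *)
Definition diam_pow (R : realType) (s : R) (A : set (R * R)) : \bar R :=
  if A == set0 then 0%E else poweR (ediam A) s.

Definition hausdorff_pre (R : realType) (s delta : R) (E : set (R * R)) :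
    \bar R :=
  ereal_inf [set v | exists U : nat -> set (R * R),
    [/\ forall k, (ediam (U k) <= delta%:E)%E,
        E `<=` \bigcup_k U k
      & v = (\sum_(0 <= k <oo) diam_pow s (U k))%E]].

Definition hausdorff_measure (R : realType) (s : R) (E : set (R * R)) : \bar R
  := ereal_sup [set hausdorff_pre s delta E | delta in [set e : R | 0 < e]].

Definition hausdorff_dim (R : realType) (E : set (R * R)) : \bar R :=
  if E == set0 then -oo%E
  else ereal_inf [set s%:E | s in
         [set s : R | 0 <= s /\ hausdorff_measure s E = 0%E]].

Definition multifractal_spectrum (R : realType) (mu : set (R * R) -> \bar R)
    (alpha : R) : \bar R :=
  hausdorff_dim [set x | supp mu x /\ has_local_dim mu x alpha].

(* The index set D ranges over all subsets of nat, so the covers are the finite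
   (possibly empty) and the countably infinite ones. *)
Definition fine_measure_pre (R : realType) (mu : set (R * R) -> \bar R)
    (q t delta : R) (E : set (R * R)) : \bar R :=
  ereal_inf [set v | exists (D : set nat) (x : nat -> R * R) (r : nat -> R),
    [/\ forall k, D k -> E (x k),
        forall k, D k -> 0 < r k <= delta,
        E `<=` \bigcup_(k in D) cball (x k) (r k)
      & v = (\esum_(k in D)
          ((powR (fine (mu (cball (x k) (r k)))) q * powR (r k) t)%:E))%E]].

Definition fine_measure (R : realType) (mu : set (R * R) -> \bar R) (q t : R)
    (E : set (R * R)) : \bar R :=
  ereal_sup [set v | exists (F : set (R * R)) (delta : R),
    [/\ F `<=` E, 0 < delta & v = fine_measure_pre mu q t delta F]].

Definition fine_dim (R : realType) (mu : set (R * R) -> \bar R)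
    (E : set (R * R)) (q : R) : \bar R :=
  ereal_inf [set t%:E | t in [set t : R | (fine_measure mu q t E < +oo)%E]].

Definition fine_Lq_spectrum (R : realType) (mu : set (R * R) -> \bar R)
    (q : R) : \bar R := (- fine_dim mu (supp mu) q)%E.

Definition concave_conjugate (R : realType) (g : R -> \bar R) (alpha : R) :
    \bar R :=
  ereal_inf [set ((q * alpha)%:E - g q)%E | q in [set: R]].

(* Main.v *)
(** For a probability vector w on the alphabet put
      alpha(w) = the local dimension of mu at points whose digits have
                 frequencies w,
      D(w)     = the Ledrappier-Young dimension of the Bernoulli measure w.
    Both are read off from approximate squares: words o' agreeing with o on the
    first n letters and lying in the same columns on the first m letters, where
    n is the first time the height drops below the width at time m.
    - For every alpha and q, f(alpha) <= q alpha - theta(q): on a level set of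
      the local dimension, a ball weighs r^alpha up to r^(+-eps), so sums of
      mu(B)^q r^t control sums of diam^s (Olsen).
    - f(alpha(w)) >= D(w): words whose digit frequencies converge to w at a
      prescribed rate carry at least half of the Bernoulli weight at every
      level, and the weight of an approximate square of width r is at most r^s
      for s < D(w).
    - theta(q) >= min_w (q alpha(w) - D(w)): the cost of all squares with digit
      frequencies w1 up to time n and w2 up to time m is governed by
      U(w1) + V(w2), where U + V = D - q alpha. Every point has infinitely many
      scales m with U(w1) <= U(w2) + eps, for otherwise the bounded quantity U
      would tend to -oo along m -> n(m); covering at these scales costs at most
      max (U + V).
    Hence theta(q) = min_w (q alpha(w) - D(w)). If theta is differentiable at q,
    the line of a minimiser w touches theta from above at q, so
    alpha(w) = theta'(q), and f(theta'(q)) >= D(w) = q alpha(w) - theta(q). *)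

From mathcomp Require Import all_boot all_order all_algebra.
From mathcomp Require Import all_classical all_reals all_analysis.
From mathcomp Require Import measurable_realfun.
From mathcomp Require Import ring lra.
Require Import Defs.
Set Implicit Arguments.
Unset Strict Implicit.
Unset Printing Implicit Defensive.
Import Order.TTheory GRing.Theory Num.Theory.
Import numFieldNormedType.Exports.
Local Open Scope classical_set_scope.
Local Open Scope ring_scope.

(** * Words and weighted sums *)

Section words.
Variables (R : realType) (I : finType) (i0 : I).
Implicit Types (w : I -> R) (o : nat -> I) (phi psi : (nat -> I) -> R).

(** Bernoulli measures enter only through the weighted sums [wsum] over words of fixed length, and
    infinite words come from [konig]. The attractor serves to turn the separation hypothesis into a
    uniform gap between cylinders of bounded depth; the support is described by nested closed
    cylinders, since self-similarity alone forces mu to live on the closed unit square. The obstacle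
    is that a square has two times: its weight depends on the letter frequencies up to n and the
    column frequencies up to m, and these may differ, so bounding each square by max (U + V) fails;
    the covers must use scales depending on the point. There are only polynomially many pairs of
    frequencies, while squares lose an exponential factor once t exceeds the maximum, so the sums
    over all levels converge together. The inequality theta(q) <= q alpha(w) - D(w) comes from
    confronting the first two bounds at alpha(w). A minimiser may lie on the boundary of the
    simplex, so w may vanish at some digits, with ln 0 = 0. *)

Definition wcons (i : I) o : nat -> I :=
  fun k => if k is k'.+1 then o k' else i.

Definition wshift j o : nat -> I := fun k => o (j + k)%N.

(** For a probability vector [w] this is the expectation of [phi] over [J] independent letters, the
    word being continued by [i0]; for [w = 1] it sums over all words of length [J]. *)
Fixpoint wsum w (J : nat) phi : R :=
  if J is J'.+1 then \sum_i w i * wsum w J' (fun o => phi (wcons i o))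
  else phi (fun=> i0).

Lemma eq_wsum w J phi psi : phi =1 psi -> wsum w J phi = wsum w J psi.
Proof. by move=> /funext ->. Qed.

Lemma ler_wsum w J phi psi : (forall i, 0 <= w i) ->
  (forall o, phi o <= psi o) -> wsum w J phi <= wsum w J psi.
Proof.
move=> w0; elim: J phi psi => [|J IH] phi psi le_phi /=; first exact: le_phi.
by apply: ler_sum => i _; apply: ler_wpM2l => //; apply: IH => o.
Qed.

Lemma wsum0 w J : wsum w J (fun=> 0) = 0.
Proof.
elim: J => [//|J IH] /=; rewrite big1// => i _.
by rewrite -[in RHS](mulr0 (w i)) -[in RHS]IH.
Qed.

Lemma wsumD w J phi psi :
  wsum w J (fun o => phi o + psi o) = wsum w J phi + wsum w J psi.
Proof.
elim: J phi psi => [//|J IH] phi psi /=.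
by rewrite -big_split; apply: eq_bigr => i _; rewrite IH mulrDr.
Qed.

Lemma wsumZ w J c phi : wsum w J (fun o => c * phi o) = c * wsum w J phi.
Proof.
elim: J phi => [//|J IH] phi /=.
by rewrite mulr_sumr; apply: eq_bigr => i _; rewrite IH mulrCA.
Qed.

Lemma wsum_sum (T : Type) w J (r : seq T) (P : pred T)
    (F : T -> (nat -> I) -> R) :
  wsum w J (fun o => \sum_(x <- r | P x) F x o) =
  \sum_(x <- r | P x) wsum w J (F x).
Proof.
elim: r => [|a r IH].
  rewrite big_nil; under eq_wsum do rewrite big_nil; exact: wsum0.
rewrite big_cons; under eq_wsum do rewrite big_cons.
by case: (P a); rewrite ?wsumD IH.
Qed.

Lemma wsum_prod w J (g : nat -> I -> R) :
  wsum w J (fun o => \prod_(k < J) g k (o k)) =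
  \prod_(k < J) \sum_i w i * g k i.
Proof.
elim: J g => [|J IH] g /=; first by rewrite !big_ord0.
rewrite big_ord_recl /= mulr_suml; apply: eq_bigr => i _.
under eq_wsum do rewrite big_ord_recl /=.
rewrite wsumZ mulrA; congr (_ * _).
rewrite -(IH (fun k => g k.+1)); apply: eq_wsum => o.
by apply: eq_bigr.
Qed.

Lemma wsum_const w J c : \sum_i w i = 1 -> wsum w J (fun=> c) = c.
Proof.
move=> w1; elim: J => [//|J IH] /=.
by under eq_bigr do rewrite IH; rewrite -mulr_suml w1 mul1r.
Qed.

Lemma wsum_tuple J phi :
  wsum (fun=> 1) J phi = \sum_(t : J.-tuple I) phi (nth i0 t).
Proof.
elim: J phi => [|J IH] phi /=.
  rewrite (big_pred1 [tuple]) => [|t]; last by apply/esym/eqP; exact: tuple0.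
  by congr phi; apply/funext => k; rewrite nth_nil.
rewrite (reindex (fun p : I * J.-tuple I => [tuple of p.1 :: p.2])) /=; last first.
  exists (fun t : J.+1.-tuple I => (thead t, [tuple of behead t])).
    by case=> i t _ /=; rewrite theadE; congr pair; exact: val_inj.
  by move=> t _; rewrite [RHS]tuple_eta.
rewrite -(pair_bigA _ (fun i (t : J.-tuple I) => phi (nth i0 (i :: t)))) /=.
apply: eq_bigr => i _; rewrite mul1r IH; apply: eq_bigr => t _.
by congr phi; apply/funext => -[|k].
Qed.

(** Compactness of the space of words, for conditions that read only the first [J] letters and
    strengthen with [J]. The word is built along prefixes that extend to solutions of every
    level. *)
Lemma konig (P : nat -> (nat -> I) -> Prop) :
  (forall J o o', (forall k, (k < J)%N -> o k = o' k) -> P J o -> P J o') ->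
  (forall J o, P J.+1 o -> P J o) ->
  (forall J, exists o, P J o) -> exists o, forall J, P J o.
Proof.
move=> Pext Pdec Pex.
have Pdec' J K o : P (J + K)%N o -> P J o.
  by elim: K => [|K IH]; rewrite ?addn0// addnS => /Pdec.
pose agree (u : seq I) o := forall k, (k < size u)%N -> o k = nth i0 u k.
pose live u := forall J, exists2 o, agree u o & P (size u + J)%N o.
have live0 : live [::].
  by move=> J; have [om Po] := Pex J; exists om.
have liveS u : live u -> exists i, live (rcons u i).
  move=> lu; apply: contrapT => /forallNP nl.
  have /choice[h hP] : forall i, exists J, forall o, agree (rcons u i) o ->
      ~ P (size (rcons u i) + J)%N o.
    move=> i; have /existsNP[J nJ] := nl i; exists J => o ao Po.
    by apply: nJ; exists o.
  (* If each letter [i] killed the prefix at level [h i], a solution beyond the maximum of these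
     finitely many levels could have no next letter. *)
  have [om ao Po] := lu (1 + \max_i h i)%N.
  apply: (hP (om (size u)) om).
    move=> k; rewrite size_rcons nth_rcons ltnS leq_eqVlt => /orP[/eqP ->|ku].
      by rewrite ltnn eqxx.
    by rewrite ku; exact: ao.
  rewrite size_rcons; move: Po; rewrite addnA addn1.
  rewrite -(subnKC (leq_bigmax (om (size u)) : (h _ <= \max_i h i)%N)) addnA.
  exact: Pdec'.
have /choice[g gP] : forall u, exists i, live u -> live (rcons u i).
  move=> u; have [lu|nlu] := pselect (live u); last by exists i0.
  by have [i li] := liveS _ lu; exists i.
pose u k := iter k (fun v => rcons v (g v)) [::].
have lu k : live (u k) by elim: k => [//|k IH] /=; exact: gP.
have su k : size (u k) = k by elim: k => [//|k IH] /=; rewrite size_rcons IH.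
have nu k l : (k < l)%N -> nth i0 (u l) k = g (u k).
  elim: l => [//|l IH]; rewrite ltnS leq_eqVlt /= nth_rcons su => /orP[/eqP ->|kl].
    by rewrite ltnn eqxx.
  by rewrite kl IH.
exists (fun k => g (u k)) => J.
have [om ao Po] := lu J 0%N.
apply: (Pext J om); last by move: Po; rewrite su addn0.
by move=> k kJ; rewrite ao ?su// nu.
Qed.

End words.

(** * Cylinders *)

Section affine.
Variables (R : realType) (I : finType).
Implicit Types (b d g : I -> R) (o : nat -> I) (x y : R).

(** In each coordinate the composition of the first [k] maps along [o] is [x -> offset + bprod * x];
    [incyl] places [x] in the image of the closed unit interval. *)
Definition bprod b o k := \prod_(l < k) b (o l).
Definition offset b d o k := \sum_(l < k) bprod b o l * d (o l).
Definition bsum g o k := \sum_(l < k) g (o l).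
Definition incyl b d o k x := offset b d o k <= x <= offset b d o k + bprod b o k.

Lemma bprod0 b o : bprod b o 0 = 1. Proof. exact: big_ord0. Qed.

Lemma bprodS b o k : bprod b o k.+1 = bprod b o k * b (o k).
Proof. exact: big_ord_recr. Qed.

Lemma offset0 b d o : offset b d o 0 = 0. Proof. exact: big_ord0. Qed.

Lemma offsetS b d o k : offset b d o k.+1 = offset b d o k + bprod b o k * d (o k).
Proof. exact: big_ord_recr. Qed.

Lemma bsumS g o k : bsum g o k.+1 = bsum g o k + g (o k).
Proof. exact: big_ord_recr. Qed.

Lemma eq_bprod b o o' k : (forall l, (l < k)%N -> b (o l) = b (o' l)) ->
  bprod b o k = bprod b o' k.
Proof. by move=> e; apply: eq_bigr => -[l lk] _; exact: e. Qed.

Lemma eq_bsum g o o' k : (forall l, (l < k)%N -> g (o l) = g (o' l)) ->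
  bsum g o k = bsum g o' k.
Proof. by move=> e; apply: eq_bigr => -[l lk] _; exact: e. Qed.

Lemma eq_offset b d o o' k : (forall l, (l < k)%N -> b (o l) = b (o' l)) ->
  (forall l, (l < k)%N -> d (o l) = d (o' l)) ->
  offset b d o k = offset b d o' k.
Proof.
move=> eb ed; apply: eq_bigr => -[l lk] _ /=; rewrite ed//; congr (_ * _).
by apply: eq_bprod => j jl; apply: eb; exact: ltn_trans lk.
Qed.

Lemma bprodD b o j k : bprod b o (j + k) = bprod b o j * bprod b (wshift j o) k.
Proof. by rewrite /bprod big_split_ord. Qed.

Lemma offsetD b d o j k :
  offset b d o (j + k) = offset b d o j + bprod b o j * offset b d (wshift j o) k.
Proof.
rewrite /offset big_split_ord/=; congr (_ + _); rewrite mulr_sumr.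
by apply: eq_bigr => l _; rewrite bprodD mulrA.
Qed.

Section contraction.
Variables (b d : I -> R).
Hypothesis b01 : forall i, 0 < b i < 1.

Let b0 i : 0 < b i. Proof. by have /andP[] := b01 i. Qed.
Let b1 i : b i < 1. Proof. by have /andP[] := b01 i. Qed.

Lemma bprod_gt0 o k : 0 < bprod b o k.
Proof. by apply: prodr_gt0. Qed.

Lemma bprod_dec o j k : (j <= k)%N -> bprod b o k <= bprod b o j.
Proof.
move=> /subnKC <-; rewrite bprodD ler_piMr ?(ltW (bprod_gt0 _ _))//.
by apply: Num.Theory.prodr_ile1 => i _; rewrite !ltW.
Qed.

Lemma bprod_expR o k : bprod b o k = expR (- bsum (fun i => - ln (b i)) o k).
Proof.
rewrite /bsum sumrN opprK expR_sum; apply: eq_bigr => i _.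
by rewrite lnK// posrE.
Qed.

Lemma lnb_gt0 i : 0 < - ln (b i).
Proof. by rewrite oppr_gt0 ln_lt0. Qed.

Lemma bprod_le_expn beta o k : (forall i, b i <= beta) -> bprod b o k <= beta ^+ k.
Proof.
move=> bb; rewrite -[k in beta ^+ k]card_ord -prodr_const.
by apply: ler_prod => i _; rewrite ltW//= bb.
Qed.

Hypothesis d01 : forall i, 0 <= d i /\ d i + b i <= 1.

Lemma incyl_dec o j k x : (j <= k)%N -> incyl b d o k x -> incyl b d o j x.
Proof.
move=> /subnKC <-; elim: (k - j)%N => [|n IH]; first by rewrite addn0.
rewrite addnS => /andP[h1 h2]; apply: IH; move: h1 h2.
rewrite /incyl offsetS bprodS; set A := offset _ _ _ _; set B := bprod _ _ _.
have := d01 (o (j + n)%N); set D := d _; set b' := b _; move=> [D0 D1].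
have := bprod_gt0 o (j + n)%N; rewrite -/B => B0 h1 h2.
by apply/andP; split; nra.
Qed.

Lemma incyl_shift o j k x : incyl b d o (j + k) x ->
  incyl b d (wshift j o) k ((x - offset b d o j) / bprod b o j).
Proof.
rewrite /incyl offsetD bprodD => /andP[h1 h2].
rewrite ler_pdivlMr ?bprod_gt0// ler_pdivrMr ?bprod_gt0//.
by apply/andP; split; rewrite mulrC; nra.
Qed.

Lemma incyl_dist o k x y : incyl b d o k x -> incyl b d o k y ->
  `|x - y| <= bprod b o k.
Proof. by rewrite /incyl ler_norml; lra. Qed.

Lemma incyl_ex o : exists x, forall k, incyl b d o k x.
Proof.
pose A := [set offset b d o k | k in [set: nat]].
have nn k : incyl b d o k (offset b d o k).
  by rewrite /incyl lexx/= lerDl ltW// bprod_gt0.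
have ub k : ubound A (offset b d o k + bprod b o k).
  move=> _ [l _ <-]; have [lk|kl] := leqP l k.
    have /andP[h _] : incyl b d o l (offset b d o k) by exact: incyl_dec (nn k).
    by rewrite (le_trans h)// lerDl ltW// bprod_gt0.
  by have /andP[] : incyl b d o k (offset b d o l) by exact: incyl_dec (ltnW kl) (nn l).
have A0 : A !=set0 by exists (offset b d o 0), 0%N.
exists (sup A) => k; apply/andP; split.
  by apply: ub_le_sup; [exists (offset b d o 0 + bprod b o 0); exact: ub | exists k].
exact: ge_sup.
Qed.

End contraction.

End affine.

Section contraction_bounds.
Variables (R : realType) (I : finType) (b : I -> R).
Hypothesis b01 : forall i, 0 < b i < 1.

Lemma fin_ub (f : I -> R) : exists2 M, 0 < M & forall i, f i <= M.
Proof.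
exists (1 + \sum_i `|f i|) => [|i]; first by rewrite ltr_pwDl// sumr_ge0.
rewrite (le_trans (ler_norm _))// (bigD1 i)//=.
by rewrite addrCA lerDl addr_ge0// sumr_ge0.
Qed.

Lemma fin_pos_lb (f : I -> R) : (forall i, 0 < f i) ->
  exists2 M, 0 < M & forall i, M <= f i.
Proof.
move=> f0; have [M M0 h] := fin_ub (fun i => (f i)^-1).
exists M^-1 => [|i]; first by rewrite invr_gt0.
by rewrite -[f i]invrK lef_pV2 ?posrE ?invr_gt0.
Qed.

Lemma contr_ub : exists2 beta, 0 < beta < 1 & forall i, b i <= beta.
Proof.
have [m m0 hm] := fin_pos_lb (fun i => lnb_gt0 b01 i).
exists (expR (- m)) => [|i]; first by rewrite expR_gt0/= expR_lt1 oppr_lt0.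
have /andP[bi0 _] := b01 i.
by rewrite -[b i]lnK ?posrE// ler_expR lerNr.
Qed.

End contraction_bounds.

(** * Approximate squares and separation *)

Section columns.
Variables (R : realType) (I : finType) (T : diag_ifs R I).

Definition same_col (i j : I) : bool :=
  (contr1 T i == contr1 T j) && (trans1 T i == trans1 T j).

Lemma same_col_refl i : same_col i i.
Proof. by rewrite /same_col !eqxx. Qed.

Lemma same_colC i j : same_col i j = same_col j i.
Proof. by rewrite /same_col eq_sym [trans1 T i == _]eq_sym. Qed.

Lemma same_col_trans : transitive same_col.
Proof. by move=> j i k /andP[/eqP h1 /eqP h2]; rewrite /same_col h1 h2. Qed.

Lemma same_col_left i j : same_col i j -> same_col i =1 same_col j.
Proof.
move=> ij k; apply/idP/idP; last exact: same_col_trans.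
by apply: same_col_trans; rewrite same_colC.
Qed.

Lemma same_colPn i j : ~~ same_col i j -> col_map T i <> col_map T j.
Proof.
move=> /negP ij e; apply: ij.
have e0 : trans1 T i = trans1 T j.
  by have := congr1 (fun f => f 0) e; rewrite /col_map !mulr0 !add0r.
have := congr1 (fun f => f 1) e; rewrite /col_map !mulr1 e0 => /addIr e1.
by rewrite /same_col e0 e1 !eqxx.
Qed.

(** The search can stop at [m]: domination makes the height at time [m] at most the width, so [find]
    always succeeds. *)
Definition vlen (o : nat -> I) m : nat :=
  find (fun n => bprod (contr2 T) o n <= bprod (contr1 T) o m) (iota 0 m.+1).

(* The approximate squares: words agreeing with [o] on the first [vlen o m]
   letters and sharing its columns on the first [m] letters. *)
Definition sqcond (o : nat -> I) m k (i : I) : bool :=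
  if (k < vlen o m)%N then i == o k else (k < m)%N ==> same_col (o k) i.

Definition insq o m (o' : nat -> I) := forall k, sqcond o m k (o' k).

Definition coded (o : nat -> I) (x : R * R) := forall k,
  incyl (contr1 T) (trans1 T) o k x.1 /\ incyl (contr2 T) (trans2 T) o k x.2.

End columns.

Section euclid.
Variable (R : realType).
Implicit Types x y z : R * R.

Lemma edist_ge1 x y : `|x.1 - y.1| <= edist x y.
Proof. by rewrite -sqrtr_sqr ler_wsqrtr// lerDl sqr_ge0. Qed.

Lemma edist_ge2 x y : `|x.2 - y.2| <= edist x y.
Proof. by rewrite -sqrtr_sqr ler_wsqrtr// lerDr sqr_ge0. Qed.

Lemma edist_le x y : edist x y <= `|x.1 - y.1| + `|x.2 - y.2|.
Proof.
rewrite -[leRHS]ger0_norm ?addr_ge0// -sqrtr_sqr ler_wsqrtr//.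
set a := x.1 - y.1; set b := x.2 - y.2.
rewrite [(`|a| + _) ^+ 2]sqrrD !real_normK ?num_real// addrAC lerDl.
by rewrite mulrn_wge0 ?mulr_ge0.
Qed.

Lemma edistC x y : edist x y = edist y x.
Proof. by congr Num.sqrt; ring. Qed.

Lemma edistxx x : edist x x = 0.
Proof. by rewrite /edist !subrr expr0n addr0 sqrtr0. Qed.

Lemma edist_triangle x y z : edist x z <= edist x y + edist y z.
Proof.
rewrite /edist; set a := x.1 - y.1; set b := x.2 - y.2.
set c := y.1 - z.1; set d := y.2 - z.2.
have -> : x.1 - z.1 = a + c by rewrite /a /c; ring.
have -> : x.2 - z.2 = b + d by rewrite /b /d; ring.
set p := a ^+ 2 + b ^+ 2; set q := c ^+ 2 + d ^+ 2.
have p0 : 0 <= p by rewrite addr_ge0 ?sqr_ge0.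
have q0 : 0 <= q by rewrite addr_ge0 ?sqr_ge0.
rewrite -[leRHS]ger0_norm ?addr_ge0 ?sqrtr_ge0// -sqrtr_sqr ler_wsqrtr//.
rewrite [(Num.sqrt p + _) ^+ 2]sqrrD !sqr_sqrtr//.
have cs : a * c + b * d <= Num.sqrt p * Num.sqrt q.
  rewrite -sqrtrM// (le_trans (ler_norm _))// -sqrtr_sqr ler_wsqrtr// /p /q.
  by rewrite -subr_ge0 [X in 0 <= X](_ : _ = (a * d - b * c) ^+ 2) ?sqr_ge0//; ring.
have -> : (a + c) ^+ 2 + (b + d) ^+ 2 = p + q + (a * c + b * d) *+ 2.
  by rewrite /p /q; ring.
by rewrite addrAC lerD2r lerD2l lerMn2r cs.
Qed.

End euclid.

Section gl.
Variables (R : realType) (I : finType) (T : diag_ifs R I) (L : set (R * R)).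
Hypothesis hT : gatzouras_lalley T.
Local Notation b1 := (contr1 T).
Local Notation b2 := (contr2 T).
Local Notation d1 := (trans1 T).
Local Notation d2 := (trans2 T).

Let b101 := gl_contr1 hT.
Let b201 := gl_contr2 hT.

(** Letting [x] tend to 0 and to 1 passes from the open to the closed unit interval; the explicit
    points keep [b * x], or [b * (1 - x)] from the other end, within half of the supposed excess. *)
Lemma affine_unit (b d : R) : 0 < b -> (forall x, 0 < x < 1 -> 0 < b * x + d < 1) ->
  0 <= d /\ d + b <= 1.
Proof.
move=> b0 h; split; rewrite leNgt; apply/negP => hd.
  pose x := Num.min (2^-1) (- d / (2 * b)).
  have x0 : 0 < x by rewrite lt_min invr_gt0 ltr0n/= divr_gt0 ?mulr_gt0// oppr_gt0.
  have x1 : x < 1 by rewrite gt_min invf_lt1 ?ltr0n// ltr1n.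
  have : b * x <= - d / 2.
    have : x <= - d / (2 * b) by rewrite ge_min lexx orbT.
    rewrite ler_pdivlMr ?mulr_gt0// ler_pdivlMr//; nra.
  by have := h x; rewrite x0 x1 => /(_ isT) /andP[]; lra.
pose e := d + b - 1; pose x := Num.min (2^-1) (e / (2 * b)).
have e0 : 0 < e by rewrite subr_gt0.
have x0 : 0 < x by rewrite lt_min invr_gt0 ltr0n/= divr_gt0 ?mulr_gt0.
have x1 : x < 1 by rewrite gt_min invf_lt1 ?ltr0n// ltr1n.
have bx : b * x <= e / 2.
  have : x <= e / (2 * b) by rewrite ge_min lexx orbT.
  rewrite ler_pdivlMr ?mulr_gt0// ler_pdivlMr//; nra.
have /h/andP[] : 0 < 1 - x < 1 by lra.
rewrite mulrBr mulr1; rewrite /e in bx; lra.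
Qed.

Lemma gl_unit1 i : 0 <= d1 i /\ d1 i + b1 i <= 1.
Proof.
have /andP[bi0 _] := b101 i; apply: affine_unit => // x x01.
have /(_ (ifs_map T i (x, x)))[|] := @gl_square _ _ _ hT i; last by [].
by exists (x, x).
Qed.

Lemma gl_unit2 i : 0 <= d2 i /\ d2 i + b2 i <= 1.
Proof.
have /andP[bi0 _] := b201 i; apply: affine_unit => // x x01.
have /(_ (ifs_map T i (x, x)))[|] := @gl_square _ _ _ hT i; last by [].
by exists (x, x).
Qed.

Lemma bprod2_le1 o k : bprod b2 o k <= bprod b1 o k.
Proof.
apply: ler_prod => i _; have /andP[/ltW -> _] /= := b201 (o i).
exact/ltW/gl_dominated.
Qed.

Lemma vlenP o m : [/\ (vlen T o m <= m)%N,
  bprod b2 o (vlen T o m) <= bprod b1 o m &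
  forall k, (k < vlen T o m)%N -> bprod b1 o m < bprod b2 o k].
Proof.
rewrite /vlen; set P := (fun n => _ <= _); set s := iota 0 m.+1.
have hP : has P s.
  by apply/hasP; exists m; [rewrite mem_iota add0n ltnSn | exact: bprod2_le1].
have sz : (find P s < m.+1)%N by rewrite -[m.+1](size_iota 0) -has_find.
split; first by rewrite -ltnS.
  by have := nth_find 0%N hP; rewrite nth_iota.
move=> k kf; have := before_find 0%N kf.
by rewrite nth_iota ?(ltn_trans kf)// add0n /P => /negbT; rewrite -ltNge.
Qed.

Lemma vlen_le o m : (vlen T o m <= m)%N. Proof. by have [] := vlenP o m. Qed.

(** The width reads only columns and the heights up to [n] only the first [n] letters, so [vlen] is
    constant on an approximate square. *)
Lemma eq_vlen o o' m n : (n <= m)%N ->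
  (forall k, (k < n)%N -> o k = o' k) ->
  (forall k, (k < m)%N -> same_col T (o k) (o' k)) ->
  n = vlen T o m -> vlen T o' m = n.
Proof.
move=> nm on om nE.
have e1 : bprod b1 o m = bprod b1 o' m.
  by apply: eq_bprod => l /om /andP[/eqP].
have e2 k : (k <= n)%N -> bprod b2 o k = bprod b2 o' k.
  by move=> kn; apply: eq_bprod => l lk; rewrite on// (leq_trans lk).
have [_ h1 h2] := vlenP o m; have [_ h1' h2'] := vlenP o' m.
apply/eqP; rewrite eqn_leq; apply/andP; split; rewrite leqNgt; apply/negP => lt.
  by have := h2' _ lt; rewrite -e1 -e2// nE ltNge h1.
by have := h2 (vlen T o' m); rewrite -nE => /(_ lt); rewrite e1 (e2 _ (ltnW lt)) ltNge h1'.
Qed.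

Lemma insqP o m o' : insq T o m o' <->
  (forall k, (k < vlen T o m)%N -> o k = o' k) /\
  (forall k, (k < m)%N -> same_col T (o k) (o' k)).
Proof.
split=> [h|[h1 h2] k].
  have h1 k : (k < vlen T o m)%N -> o k = o' k.
    by move=> kn; have := h k; rewrite /sqcond kn => /eqP.
  split=> // k km; have := h k; rewrite /sqcond km; case: ifP => // _ /eqP ->.
  exact: same_col_refl.
rewrite /sqcond; case: ifPn => [/h1 ->//|_]; apply/implyP; exact: h2.
Qed.

Lemma insq_vlen o m o' : insq T o m o' -> vlen T o' m = vlen T o m.
Proof. by move=> /insqP[h1 h2]; apply: eq_vlen h1 h2 _ => //; exact: vlen_le. Qed.

Lemma insq_bprod o m o' : insq T o m o' -> bprod b1 o' m = bprod b1 o m.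
Proof. by move=> /insqP[_ h]; apply: eq_bprod => l /h/andP[/eqP]. Qed.

(** Common columns up to [m] bound the horizontal distance by the width; common letters up to
    [vlen o m] bound the vertical one by a height not exceeding that width. *)
Lemma insq_dist o m o' x y : coded T o x -> insq T o m o' ->
  incyl b1 d1 o' m y.1 -> incyl b2 d2 o' m y.2 ->
  edist x y <= 2 * bprod b1 o m.
Proof.
move=> ox /insqP[h1 h2] y1 y2; rewrite (le_trans (edist_le _ _))//.
rewrite mulr2n mulrDl mul1r lerD//.
  have [x1 _] := ox m; apply: incyl_dist x1 _; move: y1; rewrite /incyl.
  rewrite (@eq_offset _ _ b1 d1 o o')// 1?(@eq_bprod _ _ b1 o o')//.
  - by move=> l /h2/andP[/eqP].
  - by move=> l /h2/andP[/eqP].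
  - by move=> l /h2/andP[_ /eqP].
have [nm hn _] := vlenP o m; rewrite (le_trans _ hn)//.
have [_ x2] := ox (vlen T o m); apply: incyl_dist x2 _.
have := incyl_dec b201 gl_unit2 nm y2; rewrite /incyl.
rewrite (@eq_offset _ _ b2 d2 o o')// 1?(@eq_bprod _ _ b2 o o')//.
- by move=> l /h1 ->.
- by move=> l /h1 ->.
- by move=> l /h1 ->.
Qed.

Lemma coded_ex o : exists x, coded T o x.
Proof.
have [x hx] := incyl_ex b101 gl_unit1 o.
have [y hy] := incyl_ex b201 gl_unit2 o.
by exists (x, y) => k; split.
Qed.

Hypothesis hL : is_attractor T L.
Hypothesis hsep : separation_of_principal_projections T L.

Lemma compact_pair_lb (J : finType) (P : pred J)
    (f : J -> (R * R) * (R * R) -> R) :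
  (forall j, continuous (f j)) ->
  (forall j x y, P j -> L x -> L y -> 0 < f j (x, y)) ->
  exists2 c : R, 0 < c & forall j x y, P j -> L x -> L y -> c <= f j (x, y).
Proof.
move=> cf f0; have [L0 Lc _] := hL.
have LL0 : (L `*` L) !=set0 by have [l Ll] := L0; exists (l, l).
have /choice[c hc] : forall j, exists c, 0 < c /\
    (P j -> forall x y, L x -> L y -> c <= f j (x, y)).
  move=> j; have [Pj|_] := boolP (P j); last by exists 1.
  have [[x y] xy h] := @compact_EVT_min _ _ _ _ LL0 (compact_setX Lc Lc)
    (continuous_subspaceT (cf j)).
  move: xy; rewrite inE => -[/= Lx Ly].
  exists (f j (x, y)); split; first exact: f0.
  by move=> _ a b La Lb; apply: h; rewrite inE; split.
have [m m0 hm] := fin_pos_lb (fun j => (hc j).1).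
by exists m => // j x y Pj Lx Ly; exact: le_trans (hm j) ((hc j).2 Pj _ _ Lx Ly).
Qed.

(** Compactness of [L] turns both disjointness hypotheses into gaps, uniform because there are
    finitely many pairs of digits. *)
Lemma attractor_sep : exists2 c : R, 0 < c & forall i j x y, L x -> L y ->
  (i != j -> c <= `|(ifs_map T i x).1 - (ifs_map T j y).1| \/
             c <= `|(ifs_map T i x).2 - (ifs_map T j y).2|) /\
  (~~ same_col T i j -> c <= `|(ifs_map T i x).1 - (ifs_map T j y).1|).
Proof.
have [hs1 hs2] := hsep.
pose f1 (p : I * I) (z : (R * R) * (R * R)) :=
  `|b1 p.1 * z.1.1 + d1 p.1 - (b1 p.2 * z.2.1 + d1 p.2)|.
pose f2 (p : I * I) (z : (R * R) * (R * R)) :=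
  `|b2 p.1 * z.1.2 + d2 p.1 - (b2 p.2 * z.2.2 + d2 p.2)|.
have cf1 p : continuous (f1 p).
  move=> z; apply: cvg_norm; apply: cvgB; (apply: cvgD; last exact: cvg_cst);
    (apply: cvgM; first exact: cvg_cst).
  - exact: (cvg_comp _ _ (@cvg_fst _ _ _ _ _) (@cvg_fst _ _ _ _ _)).
  - exact: (cvg_comp _ _ (@cvg_snd _ _ _ _ _) (@cvg_fst _ _ _ _ _)).
have cf2 p : continuous (f2 p).
  move=> z; apply: cvg_norm; apply: cvgB; (apply: cvgD; last exact: cvg_cst);
    (apply: cvgM; first exact: cvg_cst).
  - exact: (cvg_comp _ _ (@cvg_fst _ _ _ _ _) (@cvg_snd _ _ _ _ _)).
  - exact: (cvg_comp _ _ (@cvg_snd _ _ _ _ _) (@cvg_snd _ _ _ _ _)).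
have [p x y ncol Lx Ly|c1 c10 hc1] := @compact_pair_lb _
    (fun p : I * I => ~~ same_col T p.1 p.2) f1 cf1.
  rewrite normr_gt0 subr_eq0; apply/eqP => /= e.
  suff : (set0 : set R) (col_map T p.1 x.1) by [].
  rewrite -(hs2 _ _ (same_colPn ncol)); split; first by exists x.1 => //; exists x.
  by exists y.1; [exists y | exact/esym].
have cf12 (p : I * I) : continuous (fun z => f1 p z + f2 p z).
  by move=> z; apply: cvgD; [exact: cf1 | exact: cf2].
have [p x y np Lx Ly|c2 c20 hc2] := @compact_pair_lb _
    (fun p : I * I => p.1 != p.2) (fun p z => f1 p z + f2 p z) cf12.
  rewrite lt_neqAle addr_ge0 ?normr_ge0// andbT eq_sym paddr_eq0 ?normr_ge0//.
  apply/negP => /andP[]; rewrite !normr_eq0 !subr_eq0 => /eqP/= e1 /eqP/= e2.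
  suff : (set0 : set (R * R)) (ifs_map T p.1 x) by [].
  rewrite -(hs1 _ _ (elimN eqP np)); split; first by exists x.
  by exists y => //; rewrite /ifs_map e1 e2.
(* [c2] bounds the sum of the two coordinate distances, so one of them is at least half of it. *)
exists (Num.min c1 (c2 / 2)).
  by rewrite lt_min c10 divr_gt0.
move=> i j x y Lx Ly; split => [ij|ij]; last first.
  by rewrite ge_min (hc1 (i, j)).
have /= := hc2 (i, j) x y ij Lx Ly; rewrite /f1 /f2 /= => h.
rewrite !ge_min; have [h1|h1] := lerP (c2 / 2) `|b1 i * x.1 + d1 i - (b1 j * y.1 + d1 j)|.
  by left; rewrite orbT.
by right; apply/orP; right; lra.
Qed.

(** The anchor [l] will be a coordinate of a point of the attractor, not yet located in the unit
    square; hence the factor 1 + |l|. *)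
Lemma incyl_close (b d : I -> R) o k x l : (forall i, 0 < b i < 1) ->
  incyl b d o k x -> `|x - (offset b d o k + bprod b o k * l)| <= bprod b o k * (1 + `|l|).
Proof.
move=> b01 /andP[h1 h2]; rewrite opprD addrA (le_trans (ler_normB _ _))//.
rewrite normrM (gtr0_norm (bprod_gt0 b01 _ _)) mulrDr mulr1 lerD2r.
by rewrite ger0_norm; lra.
Qed.

(* The attractor is replaced by cylinders of a fixed depth over the unit square,
   so that no coding of the attractor is needed. *)
Lemma cylinder_sep : exists c, exists2 J, 0 < c & forall o o' x y,
  incyl b1 d1 o J.+1 x.1 -> incyl b2 d2 o J.+1 x.2 ->
  incyl b1 d1 o' J.+1 y.1 -> incyl b2 d2 o' J.+1 y.2 ->
  (o 0%N != o' 0%N -> c <= `|x.1 - y.1| \/ c <= `|x.2 - y.2|) /\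
  (~~ same_col T (o 0%N) (o' 0%N) -> c <= `|x.1 - y.1|).
Proof.
have [c c0 hc] := attractor_sep.
have [[l Ll] _ Leq] := hL.
pose M := 1 + `|l.1| + `|l.2|.
have M0 : 0 < M by rewrite /M -addrA ltr_pwDl// addr_ge0.
have [beta /andP[bt0 bt1] hb] := contr_ub b101.
(* Both points move by at most c / 4 in each coordinate to attractor points in the same first-level
   pieces, so c / 2 of the gap survives. *)
have [J hJ] : exists J, beta ^+ J.+1 * M < c / 4.
  have /cvgrPdist_lt/(_ (c / 4 / M)) : beta ^+ n @[n --> \oo] --> (0 : R).
    by apply: cvg_expr; rewrite gtr0_norm.
  case; first by rewrite !divr_gt0.
  move=> N _ /(_ N.+1 (leqnSn N)) /=; rewrite sub0r normrN ger0_norm; last first.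
    by rewrite exprn_ge0 ?ltW.
  by rewrite ltr_pdivlMr// => h; exists N.
have T_L o k : exists2 z, L z & (offset b1 d1 o k.+1 + bprod b1 o k.+1 * l.1,
    offset b2 d2 o k.+1 + bprod b2 o k.+1 * l.2) = ifs_map T (o 0%N) z.
  have mapL i z : L z -> L (ifs_map T i z).
    by move=> Lz; rewrite Leq; exists i => //; exists z.
  have cylL o' : L (offset b1 d1 o' k + bprod b1 o' k * l.1,
    offset b2 d2 o' k + bprod b2 o' k * l.2).
    elim: k {o} o' => [|k IH] o.
      by rewrite !offset0 !bprod0 !mul1r !add0r -surjective_pairing.
    rewrite -add1n !offsetD !bprodD /bprod /offset !big_ord_recl !big_ord0 /=.
    have := mapL (o 0%N) _ (IH (wshift 1 o)); rewrite /ifs_map /=.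
    by congr (L (_, _)); rewrite /bprod/offset ?big_ord0; ring.
  exists (offset b1 d1 (wshift 1 o) k + bprod b1 (wshift 1 o) k * l.1,
    offset b2 d2 (wshift 1 o) k + bprod b2 (wshift 1 o) k * l.2) => //.
  rewrite -add1n !offsetD !bprodD /ifs_map /=.
  congr (_, _); rewrite offsetS bprodS offset0 bprod0 ; ring.
exists (c / 2), J; first by rewrite divr_gt0.
move=> o o' x y x1 x2 y1 y2.
have [z Lz ez] := T_L o J; have [z' Lz' ez'] := T_L o' J.
have [hc1 hc2] := hc (o 0%N) (o' 0%N) z z' Lz Lz'.
move: hc1 hc2; rewrite -ez -ez' /=.
have b1J w : bprod b1 w J.+1 * (1 + `|l.1|) <= c / 4.
  rewrite (le_trans _ (ltW hJ))//; apply: ler_pM.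
  - exact/ltW/bprod_gt0.
  - exact: addr_ge0.
  - exact: bprod_le_expn.
  - by rewrite /M lerDl.
have b2J w : bprod b2 w J.+1 * (1 + `|l.2|) <= c / 4.
  rewrite (le_trans _ (ltW hJ))//; apply: ler_pM.
  - exact/ltW/bprod_gt0.
  - exact: addr_ge0.
  - exact: le_trans (bprod2_le1 _ _) (bprod_le_expn b101 _ _ hb).
  - by rewrite /M addrAC lerDl.
have := le_trans (incyl_close l.1 b101 x1) (b1J _).
have := le_trans (incyl_close l.2 b201 x2) (b2J _).
have := le_trans (incyl_close l.1 b101 y1) (b1J _).
have := le_trans (incyl_close l.2 b201 y2) (b2J _).
set u1 := offset b1 d1 o _ + _; set u2 := offset b2 d2 o _ + _.
set v1 := offset b1 d1 o' _ + _; set v2 := offset b2 d2 o' _ + _.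
have tri (a b a' b' : R) : `|b - b'| <= c / 4 -> `|a - a'| <= c / 4 ->
    c <= `|a' - b'| -> c / 2 <= `|a - b|.
  move=> h1 h2 h3; have e : a' - b' = (b - b') - (a - a') + (a - b) by ring.
  have := ler_normD ((b - b') - (a - a')) (a - b); rewrite -e => h4.
  have := ler_normB (b - b') (a - a'); lra.
move=> hy2 hy1 hx2 hx1 hc1 hc2; split=> [/hc1[]|/hc2] h.
- by left; exact: tri hy1 hx1 h.
- by right; exact: tri hy2 hx2 h.
- exact: tri hy1 hx1 h.
Qed.

(** At the first wrong column or letter [k], rescaling by the common cylinder of level [k] exposes
    the gap of [cylinder_sep], which scaled back exceeds the distance. The [J] extra letters give
    the rescaled [y] its required depth. *)
Lemma square_sep : exists c, exists2 J, 0 < c & forall o o' x y m,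
  coded T o x ->
  incyl b1 d1 o' (m + J) y.1 -> incyl b2 d2 o' (m + J) y.2 ->
  edist x y <= c * bprod b1 o m -> insq T o m o'.
Proof.
have [c [J c0 hc]] := cylinder_sep.
(* Halving [c] makes the distance bound strict, as [bprod_dec] gives only a weak inequality between
   the widths at [k] and [m]. *)
exists (c / 2), J.+1; first by rewrite divr_gt0.
move=> o o' x y m ox y1 y2 xy.
have B0 := bprod_gt0 b101 o m.
have xyB : edist x y < c * bprod b1 o m.
  by rewrite (le_lt_trans xy)// ltr_pM2r// ltr_pdivrMr// mulrDr mulr1 ltrDl.
have rescale (b d : I -> R) z z' k : (forall i, 0 < b i < 1) -> incyl b d o k z ->
    offset b d o k = offset b d o' k -> bprod b o k = bprod b o' k ->
    c <= `|(z - offset b d o k) / bprod b o k - (z' - offset b d o' k) / bprod b o' k| ->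
    c * bprod b o k <= `|z - z'|.
  move=> b01 _ <- <-; rewrite -mulrBl normrM normfV.
  rewrite (gtr0_norm (bprod_gt0 b01 _ _)) ler_pdivlMr ?bprod_gt0//.
  by congr (_ <= `|_|); ring.
have key k : (k < m)%N -> (forall l, (l < k)%N -> same_col T (o l) (o' l)) ->
    let sh b d (w : nat -> I) z := (z - offset b d w k) / bprod b w k in
    let x' := (sh b1 d1 o x.1, sh b2 d2 o x.2) in
    let y' := (sh b1 d1 o' y.1, sh b2 d2 o' y.2) in
    (o k != o' k -> c <= `|x'.1 - y'.1| \/ c <= `|x'.2 - y'.2|) /\
    (~~ same_col T (o k) (o' k) -> c <= `|x'.1 - y'.1|).
  move=> km _ sh x' y'.
  have := hc (wshift k o) (wshift k o') x' y'.
  rewrite /wshift addn0; apply.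
  - by apply: incyl_shift => //; exact: (ox _).1.
  - by apply: incyl_shift => //; exact: (ox _).2.
  - apply: incyl_shift => //; apply: incyl_dec y1 => //; first exact: gl_unit1.
    by rewrite leq_add2r ltnW.
  - apply: incyl_shift => //; apply: incyl_dec y2 => //; first exact: gl_unit2.
    by rewrite leq_add2r ltnW.
have cols k : (k < m)%N -> same_col T (o k) (o' k).
  elim/ltn_ind: k => k IH km; apply: contrapT => /negP ncol.
  have sc l : (l < k)%N -> same_col T (o l) (o' l).
    by move=> lk; apply: IH => //; exact: ltn_trans km.
  have [_ /(_ ncol) h] := key k km sc.
  have : c * bprod b1 o k <= `|x.1 - y.1|.
    apply: (rescale b1 d1) (ox k).1 _ _ h => //.
      by apply: eq_offset => l /sc/andP[/eqP ? /eqP ?].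
    by apply: eq_bprod => l /sc/andP[/eqP->].
  move/le_trans => /(_ _ (edist_ge1 _ _))/le_lt_trans => /(_ _ xyB).
  by rewrite ltr_pM2l// ltNge bprod_dec// ltnW.
apply/insqP; split => // k; elim/ltn_ind: k => k IH kn.
have [nm hn hn'] := vlenP o m.
have km : (k < m)%N := leq_trans kn nm.
apply/eqP; apply: contrapT => /negP neq.
have sc l : (l < k)%N -> same_col T (o l) (o' l).
  by move=> lk; apply: cols; exact: ltn_trans km.
have eqo l : (l < k)%N -> o l = o' l by move=> lk; apply: IH => //; exact: ltn_trans kn.
have [/(_ neq) [] h _] := key k km sc.
  have : c * bprod b1 o k <= `|x.1 - y.1|.
    by apply: (rescale b1 d1) (ox k).1 _ _ h => //;
      [apply: eq_offset => l /eqo -> | apply: eq_bprod => l /eqo ->].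
  move/le_trans => /(_ _ (edist_ge1 _ _))/le_lt_trans => /(_ _ xyB).
  by rewrite ltr_pM2l// ltNge bprod_dec// ltnW.
(* A vertical gap is excluded because, by minimality of [vlen], the cylinder at [k] is still taller
   than the width at [m]. *)
have : c * bprod b2 o k <= `|x.2 - y.2|.
  by apply: (rescale b2 d2) (ox k).2 _ _ h => //;
    [apply: eq_offset => l /eqo -> | apply: eq_bprod => l /eqo ->].
move/le_trans => /(_ _ (edist_ge2 _ _))/le_lt_trans => /(_ _ xyB).
by rewrite ltr_pM2l// ltNge ltW// hn'.
Qed.

End gl.

(** * The measure of approximate squares *)

Section self_similar_measure.
Variables (R : realType) (I : finType) (i0 : I) (T : diag_ifs R I) (p : I -> R).
Variable mu : probability (measurableTypeR R * measurableTypeR R)%type R.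
Hypothesis hT : gatzouras_lalley T.
Hypothesis hp : probability_vector p.
Hypothesis hmu : self_similar T p mu.
Local Notation b1 := (contr1 T).
Local Notation b2 := (contr2 T).
Local Notation d1 := (trans1 T).
Local Notation d2 := (trans2 T).
Local Notation plane := (measurableTypeR R * measurableTypeR R)%type.

Definition mass (A : set (R * R)) : R := fine (mu A).

Lemma massE (A : set plane) : measurable A -> mu A = (mass A)%:E.
Proof. by move=> mA; rewrite /mass fineK// fin_num_measure. Qed.

Lemma mass_ge0 A : 0 <= mass A.
Proof. exact/fine_ge0/measure_ge0. Qed.

Lemma mass_le (A B : set plane) : measurable A -> measurable B -> A `<=` B ->
  mass A <= mass B.
Proof.
by move=> mA mB AB; rewrite -lee_fin -!massE//; apply: le_measure; rewrite ?inE.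
Qed.

Lemma mass_le1 (A : set plane) : measurable A -> mass A <= 1.
Proof. by move=> mA; rewrite -lee_fin -massE// probability_le1. Qed.

Lemma measurable_cball (x : R * R) r : measurable (cball x r : set plane).
Proof.
have m1 : measurable_fun setT (fun y : plane => x.1 - y.1).
  by apply: measurable_funB => //; exact: measurable_fst.
have m2 : measurable_fun setT (fun y : plane => x.2 - y.2).
  by apply: measurable_funB => //; exact: measurable_snd.
have mf : measurable_fun setT (fun y : plane => edist x y).
  apply: (@measurableT_comp _ _ _ _ _ _ (Num.sqrt : R -> R)).
    by apply: continuous_measurable_fun; exact: sqrt_continuous.
  by apply: measurable_funD; apply: measurable_funX.
rewrite (_ : cball x r = setT `&` (fun y : plane => edist x y) @^-1` `]-oo, r]).
  by apply: mf => //; exact: measurable_itv.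
by rewrite setTI; apply/seteqP; split => y; rewrite /cball /= in_itv.
Qed.

Definition tmap (o : nat -> I) J (z : R * R) : R * R :=
  (offset b1 d1 o J + bprod b1 o J * z.1, offset b2 d2 o J + bprod b2 o J * z.2).

Lemma measurable_affine (a b c d : R) (A : set plane) : measurable A ->
  measurable ((fun z : R * R => (a + b * z.1, c + d * z.2)) @^-1` A : set plane).
Proof.
move=> mA; rewrite -[X in measurable X]setTI.
have mf : measurable_fun setT (fun z : plane => (a + b * z.1, c + d * z.2) : plane).
  apply: measurable_fun_pair; apply: measurable_funD => //;
    exact: measurable_funM.
exact: mf.
Qed.

Lemma measurable_tmap o J (A : set plane) : measurable A ->
  measurable (tmap o J @^-1` A : set plane).
Proof. exact: measurable_affine. Qed.

Lemma mass_level J (A : set plane) : measurable A ->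
  mass A = wsum i0 p J (fun o => mass (tmap o J @^-1` A)).
Proof.
elim: J A => [|J IH] A mA /=.
  congr mass; apply/seteqP; split => -[y1 y2] /=;
  by rewrite /tmap !offset0 !bprod0 !add0r !mul1r.
have mT i : measurable (ifs_map T i @^-1` A : set plane).
  rewrite (_ : ifs_map T i = fun z => (d1 i + b1 i * z.1, d2 i + b2 i * z.2)).
    exact: measurable_affine.
  by apply/funext => z; rewrite /ifs_map; congr pair; rewrite addrC.
have : (mass A)%:E = (\sum_i p i * mass (ifs_map T i @^-1` A))%:E.
  rewrite -massE// hmu// -sumEFin; apply: eq_bigr => i _.
  by rewrite EFinM; congr (_ * _)%E; exact: massE.
move=> [->]; apply: eq_bigr => i _; rewrite IH//; congr (_ * _).
apply: eq_wsum => o; congr mass; apply/seteqP; split => -[y1 y2] /=;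
rewrite /tmap /ifs_map -add1n !offsetD !bprodD /bprod /offset !big_ord_recl !big_ord0 /=;
by congr (A (_, _)); rewrite /bprod ?big_ord0; ring.
Qed.

Definition box (rho : R) : set (R * R) :=
  [set z | -rho <= z.1 <= 1 + rho /\ -rho <= z.2 <= 1 + rho].

Lemma measurable_box rho : measurable (box rho : set plane).
Proof.
rewrite (_ : box rho = `[- rho, 1 + rho] `*` `[- rho, 1 + rho]).
  by apply: measurableX; exact: measurable_itv.
by apply/seteqP; split => -[y1 y2]; rewrite /= !in_itv.
Qed.

(** Every map sends the box of margin [r / beta] into that of margin [r], so by self-similarity
    enlarging the margin by powers of [1 / beta] gains no mass; these boxes exhaust the plane. *)
Lemma mass_box_pos rho : 0 < rho -> mass (box rho) = 1.
Proof.
move=> rho0.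
have [beta /andP[bt0 bt1] hb] := contr_ub (gl_contr1 hT).
have hb2 i : b2 i <= beta by apply: le_trans (hb i); exact/ltW/gl_dominated.
have box_mono r : 0 < r -> mass (box (r / beta)) <= mass (box r).
  move=> r0; rewrite [leRHS](mass_level 1 (measurable_box r)) /=.
  rewrite -[leLHS](@wsum_const _ _ i0 p 1)//=; last by case: hp.
  apply: ler_sum => i _; apply: ler_wpM2l; first by case: hp.
  apply: mass_le; first exact: measurable_box.
    apply: measurable_tmap. apply measurable_box.
  move=> z [z1 z2]; rewrite /tmap /box /=.
  rewrite !offsetS !bprodS !offset0 !bprod0 !mul1r !add0r /=.
  have [D10 D11] := gl_unit1 hT i; have [D20 D21] := gl_unit2 hT i.
  have /andP[B10 _] := gl_contr1 hT i; have /andP[B20 _] := gl_contr2 hT i.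
  have e b : b <= beta -> b * (r / beta) <= r.
    by move=> bb; rewrite mulrCA ler_piMr ?(ltW r0)// ler_pdivrMr// mul1r.
  have E1 := e _ (hb i); have E2 := e _ (hb2 i).
  move: E1 E2 z1 z2; set s := r / beta => E1 E2 /andP[h1 h2] /andP[h3 h4].
  by split; apply/andP; split; nra.
have steps k : mass (box (rho / beta ^+ k)) <= mass (box rho).
  elim: k => [|k IH]; first by rewrite expr0 divr1.
  by rewrite (le_trans _ IH)// exprSr invfM mulrA box_mono// divr_gt0// exprn_gt0.
have lim1 : mass (box n%:R) @[n --> \oo] --> (1 : R).
  have : mu (box n%:R) @[n --> \oo] --> mu (\bigcup_n (box n%:R)).
    apply: nondecreasing_cvg_mu.
    - by move=> n; exact: measurable_box.
    - by apply: bigcup_measurable => n _; exact: measurable_box.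
    - move=> m n mn; apply/subsetPset => z [/andP[h1 h2] /andP[h3 h4]].
      have mn' : (m%:R : R) <= n%:R by rewrite ler_nat.
      by split; apply/andP; split; lra.
  rewrite (_ : \bigcup_n _ = setT).
    rewrite probability_setT => /fine_cvg; exact.
  apply/seteqP; split => // z _; exists (Num.truncn (`|z.1| + `|z.2|)).+1 => //.
  have := truncnS_gt (`|z.1| + `|z.2|); set t := _%:R => ht.
  have := ler_norm z.1; have := ler_norm z.2; have := ler_norm (- z.1).
  have := ler_norm (- z.2); rewrite !normrN => h1 h2 h3 h4.
  have := normr_ge0 z.1; have := normr_ge0 z.2 => h5 h6.
  by split; apply/andP; split; lra.
apply/le_anti/andP; split; first exact: (mass_le1 (measurable_box _)).
move/cvgrPdist_lt in lim1.
rewrite leNgt; apply/negP => lt1.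
have /lim1[N _ hN] : 0 < 1 - mass (box rho) by rewrite subr_gt0.
have [k hk] : exists k, N%:R <= rho / beta ^+ k.
  have /cvgrPdist_lt/(_ (rho / N.+1%:R)) : beta ^+ n @[n --> \oo] --> (0 : R).
    by apply: cvg_expr; rewrite gtr0_norm.
  case; first by rewrite divr_gt0.
  move=> k _ /(_ k (leqnn k)) /=; rewrite sub0r normrN ger0_norm; last first.
    by rewrite exprn_ge0 ?ltW.
  rewrite ltr_pdivlMr// => h; exists k; rewrite ler_pdivlMr ?exprn_gt0//.
  rewrite (le_trans _ (ltW h))// mulrC ler_wpM2l ?exprn_ge0 ?ltW// ltr_nat.
  exact: leqnn.
have := hN N (leqnn N); rewrite /= ger0_norm ?subr_ge0; last exact: (mass_le1 (measurable_box _)).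
rewrite ltrD2l ltrN2 ltNge => /negP; apply.
rewrite (le_trans _ (steps k))// mass_le//; try exact: measurable_box.
by move=> z [/andP[h1 h2] /andP[h3 h4]]; split; apply/andP; split; lra.
Qed.

Lemma mass_box : mass (box 0) = 1.
Proof.
pose r n : R := n.+1%:R^-1.
have r0 n : 0 < r n by rewrite invr_gt0.
have : mu (box (r n)) @[n --> \oo] --> mu (\bigcap_n (box (r n))).
  apply: nonincreasing_cvg_mu.
  - by apply: le_lt_trans (probability_le1 mu (measurable_box _)) _; rewrite ltry.
  - by move=> n; exact: measurable_box.
  - by apply: bigcap_measurableType => n _; exact: measurable_box.
  - move=> m n mn; apply/subsetPset => z [/andP[h1 h2] /andP[h3 h4]].
    have mn' : r n <= r m by rewrite lef_pV2 ?posrE// ler_nat ltnS.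
    by split; apply/andP; split; lra.
have m1 n : mu (box (r n)) = 1%E.
  by rewrite (massE (measurable_box _)) mass_box_pos.
rewrite (_ : \bigcap_n _ = box 0); last first.
  apply/seteqP; split => z; last first.
    move=> [/andP[h1 h2] /andP[h3 h4]] n _; have := r0 n.
    by split; apply/andP; split; lra.
  move=> hz.
  have z0 (y : R) : (forall n, - r n <= y) -> 0 <= y.
    move=> h; rewrite leNgt; apply/negP => y0.
    have [n hn] : exists n, r n < - y.
      exists (Num.truncn ((- y)^-1)); rewrite invf_plt ?posrE ?oppr_gt0//.
      exact: truncnS_gt.
    by have := h n; lra.
  split; apply/andP; split; rewrite ?oppr0 ?addr0.
  - by apply: z0 => n; have [/andP[]] := hz n Logic.I.
  - by rewrite -subr_ge0; apply: z0 => n; have [/andP[_ h] _] := hz n Logic.I; lra.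
  - by apply: z0 => n; have [_ /andP[]] := hz n Logic.I.
  - by rewrite -subr_ge0; apply: z0 => n; have [_ /andP[_ h]] := hz n Logic.I; lra.
under eq_cvg do rewrite m1.
move=> h; have := cvg_unique _ h (cvg_cst _) => /(_ (@ereal_hausdorff R)).
by rewrite /mass => ->.
Qed.

Lemma mass_tmap_box J o (A : set plane) : measurable A ->
  (forall z, box 0 z -> ~ A (tmap o J z)) -> mass (tmap o J @^-1` A) = 0.
Proof.
move=> mA hA.
have : mass (tmap o J @^-1` A) + mass (box 0) <= 1.
  rewrite -lee_fin EFinD -!massE; [|exact: measurable_box|exact: measurable_tmap].
  rewrite -measureU; [|exact: measurable_tmap|exact: measurable_box|].
    apply: probability_le1; apply: measurableU; first exact: measurable_tmap.
    exact: measurable_box.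
  by apply/seteqP; split => // z [h1 h2]; exact: hA h1.
by rewrite mass_box gerDr => h; apply/le_anti/andP; split=> //; exact: mass_ge0.
Qed.

Let p_ge0 : forall i, 0 <= p i. Proof. by case: hp. Qed.

(** Passage from mu to words: at level [J] mu is an average of images of itself, each carried by a
    closed cylinder, so only cylinders meeting [A] contribute. *)
Lemma mass_le_wsum J (A : set plane) (phi : (nat -> I) -> R) : measurable A ->
  (forall o, 0 <= phi o) ->
  (forall o z, box 0 z -> A (tmap o J z) -> 1 <= phi o) ->
  mass A <= wsum i0 p J phi.
Proof.
move=> mA phi0 phi1; rewrite (mass_level J mA); apply: ler_wsum => // o.
have [[z [bz Az]]|nz] := pselect (exists z, box 0 z /\ A (tmap o J z)).
  by apply: le_trans (phi1 o z bz Az); exact: (mass_le1 (measurable_tmap _ _ mA)).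
by rewrite mass_tmap_box// => z bz Az; apply: nz; exists z.
Qed.

Lemma wsum_le_mass J (A : set plane) (phi : (nat -> I) -> R) : measurable A ->
  (forall o, phi o <= 1) ->
  (forall o z, 0 < phi o -> box 0 z -> A (tmap o J z)) ->
  wsum i0 p J phi <= mass A.
Proof.
move=> mA phi1 phiA; rewrite (mass_level J mA); apply: ler_wsum => // o.
have [phio|phio] := ltrP 0 (phi o); last exact: le_trans phio (mass_ge0 _).
rewrite (le_trans (phi1 o))// -mass_box; apply: mass_le.
- exact: measurable_box.
- exact: measurable_tmap.
- by move=> z; exact: phiA.
Qed.

End self_similar_measure.

(** * Weights of approximate squares against masses of balls *)

Section squares.
Variables (R : realType) (I : finType) (i0 : I) (T : diag_ifs R I).
Hypothesis hT : gatzouras_lalley T.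
Local Notation b1 := (contr1 T).
Local Notation b2 := (contr2 T).
Local Notation d1 := (trans1 T).
Local Notation d2 := (trans2 T).

Definition colw (w : I -> R) i := \sum_(j | same_col T i j) w j.

Definition sqw (w : I -> R) o m :=
  \prod_(k < m) (if (k < vlen T o m)%N then w (o k) else colw w (o k)).

(** The indicator of the square as a product over letters, so that [wsum_prod] computes its weight
    [sqw] by independence. *)
Definition sqind o m J (o' : nat -> I) : R :=
  \prod_(k < J) (sqcond T o m k (o' k))%:R.

Lemma sqind_ge0 o m J o' : 0 <= sqind o m J o'.
Proof. by apply: prodr_ge0 => k _; rewrite ler0n. Qed.

Lemma sqind_le1 o m J o' : sqind o m J o' <= 1.
Proof. by apply: Num.Theory.prodr_ile1 => k _; rewrite ler0n lern1 leq_b1. Qed.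

Lemma sqind_insq o m J o' : insq T o m o' -> sqind o m J o' = 1.
Proof. by move=> h; rewrite /sqind big1// => k _; rewrite h. Qed.

Lemma insq_sqind o m J o' : (m <= J)%N -> 0 < sqind o m J o' -> insq T o m o'.
Proof.
move=> mJ s0 k; have [kJ|Jk] := ltnP k J; last first.
  have mk := leq_trans mJ Jk.
  by rewrite /sqcond !ltnNge (leq_trans (vlen_le hT o m) mk) mk.
apply: contrapT => /negP/negbTE h; move: s0.
by rewrite /sqind (bigD1 (Ordinal kJ))//= h mul0r ltxx.
Qed.

Lemma wsum_sqind w o m J : (m <= J)%N -> \sum_i w i = 1 ->
  wsum i0 w J (sqind o m J) = sqw w o m.
Proof.
move=> mJ w1; have nm := vlen_le hT o m.
rewrite (wsum_prod i0 w J (fun k i => (sqcond T o m k i)%:R)).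
rewrite -(subnKC mJ) big_split_ord /= [X in _ * X]big1 ?mulr1; last first.
  move=> k _; rewrite -[RHS]w1; apply: eq_bigr => i _.
  by rewrite /sqcond !ltnNge leq_addr (leq_trans nm) ?leq_addr//= mulr1.
apply: eq_bigr => k _; case: ifPn => kn.
  rewrite (bigD1 (o k))//= /sqcond kn eqxx mulr1 big1 ?addr0// => i /negbTE ->.
  by rewrite mulr0.
rewrite /colw [RHS]big_mkcond; apply: eq_bigr => i _.
by rewrite /sqcond (negbTE kn) ltn_ord /=; case: ifP; rewrite ?mulr1 ?mulr0.
Qed.

Lemma sqw_gt0 w o m : (forall i, 0 < w i) -> 0 < sqw w o m.
Proof.
move=> w0; apply: prodr_gt0 => k _; case: ifP => // _.
rewrite /colw (bigD1 (o k)) ?same_col_refl//= ltr_pwDl// sumr_ge0// => i _.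
exact: ltW.
Qed.

Lemma incyl_tmap o J z : box 0 z ->
  incyl b1 d1 o J (tmap T o J z).1 /\ incyl b2 d2 o J (tmap T o J z).2.
Proof.
move=> []; rewrite oppr0 addr0 => /andP[h1 h2] /andP[h3 h4].
have B1 := bprod_gt0 (gl_contr1 hT) o J; have B2 := bprod_gt0 (gl_contr2 hT) o J.
rewrite /incyl /tmap /= !lerDl !lerD2l !pmulr_rge0// h1 h3 /=.
by split; apply: ler_piMr => //; exact: ltW.
Qed.

Lemma tmapS o J z : box 0 z -> exists2 z', box 0 z' & tmap T o J.+1 z = tmap T o J z'.
Proof.
move=> [/andP[h1 h2] /andP[h3 h4]].
rewrite oppr0 addr0 in h1 h2 h3 h4.
have [D10 D11] := gl_unit1 hT (o J); have [D20 D21] := gl_unit2 hT (o J).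
have /andP[B10 _] := gl_contr1 hT (o J); have /andP[B20 _] := gl_contr2 hT (o J).
exists (d1 (o J) + b1 (o J) * z.1, d2 (o J) + b2 (o J) * z.2).
  rewrite /box /= oppr0 addr0; split; apply/andP; split.
  - by rewrite addr_ge0// mulr_ge0// ltW.
  - by apply: le_trans D11; rewrite lerD2l ler_piMr// ltW.
  - by rewrite addr_ge0// mulr_ge0// ltW.
  - by apply: le_trans D21; rewrite lerD2l ler_piMr// ltW.
by rewrite /tmap !offsetS !bprodS /=; congr pair; ring.
Qed.

Variables (p : I -> R) (mu : probability (measurableTypeR R * measurableTypeR R)%type R).
Hypothesis hp : probability_vector p.
Hypothesis hp_pos : forall i, 0 < p i.
Hypothesis hmu : self_similar T p mu.
Local Notation M := (mass mu).

Lemma ball_lower o x m : coded T o x -> sqw p o m <= M (cball x (2 * bprod b1 o m)).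
Proof.
move=> ox; rewrite -(@wsum_sqind p o m m)//; last by case: hp.
apply: (wsum_le_mass i0 hT hp hmu).
- exact: measurable_cball.
- by move=> o'; exact: sqind_le1.
move=> o' z /(insq_sqind (leqnn m)) h bz; have [y1 y2] := incyl_tmap o' m bz.
by apply: (insq_dist hT ox) => //; exact: h.
Qed.

(** By [square_sep], a ball this small meets only cylinders of level m + J that lie in the square of
    its centre. *)
Lemma ball_upper L : is_attractor T L -> separation_of_principal_projections T L ->
  exists2 c, 0 < c & forall o x m, coded T o x ->
    M (cball x (c * bprod b1 o m)) <= sqw p o m.
Proof.
move=> hL hsep; have [c [J c0 hc]] := square_sep hT hL hsep.
exists c => // o x m ox; rewrite -(@wsum_sqind p o m (m + J))//; last 2 first.
- by rewrite leq_addr.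
- by case: hp.
apply: (mass_le_wsum i0 hT hp hmu).
- exact: measurable_cball.
- by move=> o'; exact: sqind_ge0.
move=> o' z bz xz; have [y1 y2] := incyl_tmap o' (m + J) bz.
by rewrite sqind_insq//; apply: hc ox y1 y2 xz.
Qed.

Lemma bprod_small (b : I -> R) r : (forall i, 0 < b i < 1) -> 0 < r ->
  exists m, forall o k, (m <= k)%N -> bprod b o k <= r.
Proof.
move=> b01 r0; have [beta /andP[bt0 bt1] hb] := contr_ub b01.
have /cvgrPdist_lt/(_ _ r0)[m _ hm] : beta ^+ n @[n --> \oo] --> (0 : R).
  by apply: cvg_expr; rewrite gtr0_norm.
exists m => o k mk; rewrite (le_trans (bprod_le_expn b01 _ _ hb))//.
have := hm k mk; rewrite /= sub0r normrN ger0_norm; first exact: ltW.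
by rewrite exprn_ge0 ?ltW.
Qed.

Lemma coded_supp o x : coded T o x -> supp mu x.
Proof.
move=> ox r r0; rewrite massE; last exact: measurable_cball.
rewrite lte_fin.
have r2 : 0 < r / 2 by rewrite divr_gt0.
have [m hm] := bprod_small (gl_contr1 hT) r2.
rewrite (lt_le_trans (sqw_gt0 o m hp_pos))// (le_trans (ball_lower m ox))//.
apply: mass_le; [exact: measurable_cball|exact: measurable_cball|].
move=> y /= /le_trans; apply; rewrite mulrC -ler_pdivlMr//; exact: hm.
Qed.

(** [konig] applies to the words whose cylinder of level [J] comes within 1 / (J + 1) of [x]: if a
    level had none, the ball of that radius would be null. Closedness of the cylinders concludes. *)
Lemma supp_coded x : supp mu x -> exists o, coded T o x.
Proof.
move=> sx.
pose P J o := exists2 z, box 0 z & edist x (tmap T o J z) <= J.+1%:R^-1.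
have [om omP] : exists o, forall J, P J o.
  apply: (konig i0).
  - move=> J o o' oo' [z bz xz]; exists z => //; move: xz; rewrite /tmap.
    rewrite !(@eq_offset _ _ _ _ o o') ?(@eq_bprod _ _ b1 o o') ?(@eq_bprod _ _ b2 o o')//;
    by move=> l /oo' ->.
  - move=> J o [z bz xz]; have [z' bz' e] := tmapS o J bz; exists z' => //.
    by rewrite -e (le_trans xz)// lef_pV2 ?posrE// ler_nat.
  - move=> J; apply: contrapT => /forallNP nP.
    have r0 : 0 < J.+1%:R^-1 :> R by rewrite invr_gt0.
    have := sx _ r0; rewrite massE; last exact: measurable_cball.
    rewrite lte_fin ltNge => /negP; apply; rewrite -(wsum0 i0 p J).
    apply: (mass_le_wsum i0 hT hp hmu) => //; first exact: measurable_cball.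
    by move=> o z bz xz; exfalso; apply: (nP o); exists z.
have lim (b d : I -> R) (xi : R) k : (forall i, 0 < b i < 1) ->
    (forall i, 0 <= d i /\ d i + b i <= 1) ->
    (forall J, exists2 y, incyl b d om J y & `|xi - y| <= J.+1%:R^-1) ->
    incyl b d om k xi.
  move=> b01 bd01 h.
  have key e : 0 < e -> offset b d om k - e <= xi <= offset b d om k + bprod b om k + e.
    move=> e0; pose J := maxn k (Num.truncn e^-1).
    have [y yJ xy] := h J; have := incyl_dec b01 bd01 (leq_maxl k _) yJ.
    have : J.+1%:R^-1 <= e.
      rewrite invf_ple ?posrE//; apply: ltW; apply: lt_le_trans (truncnS_gt _) _.
      by rewrite ler_nat ltnS leq_maxr.
    move=> h1 /andP[h2 h3]; move: xy; rewrite ler_norml => /andP[h4 h5].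
    move: h1 h4 h5; move: (J.+1%:R^-1) => q h1 h4 h5.
    by apply/andP; split; lra.
  apply/andP; split; apply/ler_addgt0Pl => e /key/andP[? ?]; lra.
exists om => k; split.
  apply: lim (gl_contr1 hT) (gl_unit1 hT) _ => J; have [z bz xz] := omP J.
  exists (tmap T om J z).1; first by have [] := incyl_tmap om J bz.
  exact: le_trans (edist_ge1 _ _) xz.
apply: lim (gl_contr2 hT) (gl_unit2 hT) _ => J; have [z bz xz] := omP J.
exists (tmap T om J z).2; first by have [] := incyl_tmap om J bz.
exact: le_trans (edist_ge2 _ _) xz.
Qed.

End squares.

(** * The upper bound on the spectrum *)

Section hausdorff_null.
Variable R : realType.
Implicit Types (s : R) (E : set (R * R)).

Lemma diam_pow_ge0 s (A : set (R * R)) : (0 <= diam_pow s A)%E.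
Proof. by rewrite /diam_pow; case: ifP => // _; exact: poweR_ge0. Qed.

Lemma hausdorff_pre_ge0 s d E : (0 <= hausdorff_pre s d E)%E.
Proof.
apply: le_ereal_inf_tmp => _ [U [_ _ ->]].
by apply: nneseries_ge0 => k _ _; exact: diam_pow_ge0.
Qed.

Lemma hausdorff_measure_eq0 s E : hausdorff_measure s E = 0%E <->
  forall delta eta, 0 < delta -> 0 < eta -> exists U : nat -> set (R * R),
    [/\ forall k, (ediam (U k) <= delta%:E)%E, E `<=` \bigcup_k U k &
        (\sum_(0 <= k <oo) diam_pow s (U k) <= eta%:E)%E].
Proof.
split=> [h delta eta d0 e0|h].
  have : (hausdorff_pre s delta E < eta%:E)%E.
    apply: (@le_lt_trans _ _ 0%E); last by rewrite lte_fin.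
    by rewrite -h; apply: ereal_sup_ubound; exists delta.
  by move=> /ereal_inf_lt[_ [U [U1 U2 ->]] /ltW U3]; exists U.
apply/eqP; rewrite eq_le; apply/andP; split.
  apply: ge_ereal_sup => _ [delta d0 <-]; apply/lee_addgt0Pr => e e0.
  have [U [U1 U2 U3]] := h _ _ d0 e0; rewrite add0e.
  by apply: le_trans U3; apply: ereal_inf_lbound; exists U.
apply: le_trans (hausdorff_pre_ge0 s 1 E) _.
by apply: ereal_sup_ubound; exists 1 => //=.
Qed.

(** The n-th set receives the budget eta / 2^(n+1), and the double sequence of covers is enumerated
    by a bijection with the naturals. *)
Lemma hausdorff_null_bigcup s (E : nat -> set (R * R)) :
  (forall n, hausdorff_measure s (E n) = 0%E) ->
  hausdorff_measure s (\bigcup_n E n) = 0%E.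
Proof.
move=> h; apply/hausdorff_measure_eq0 => delta eta d0 e0.
have /choice[U hU] : forall n, exists U : nat -> set (R * R),
    [/\ forall k, (ediam (U k) <= delta%:E)%E, E n `<=` \bigcup_k U k &
        (\sum_(0 <= k <oo) diam_pow s (U k) <= (eta / (2 ^ n.+1)%:R)%:E)%E].
  move=> n; apply: ((hausdorff_measure_eq0 s (E n)).1 (h n)) => //.
  by rewrite divr_gt0// ltr0n expn_gt0.
have [f fbij] : exists f : nat -> nat * nat, set_bij [set: nat] [set: nat * nat] f.
  by have /card_set_bijP[f fb] := card_esym card_nat2; exists f.
exists (fun k => U (f k).1 (f k).2); split.
- by move=> k; have [] := hU (f k).1.
- move=> x [n _ Ex]; have [_ /(_ x Ex)[k _ Ux] _] := hU n.
  have [_ _ /(_ (n, k) Logic.I)[j _ fj]] := fbij.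
  by exists j => //; rewrite fj.
rewrite nneseries_esumT => [|k]; last exact: diam_pow_ge0.
rewrite -(reindex_esum [set: nat] [set: nat * nat] f
  (fun p => diam_pow s (U p.1 p.2)))//.
rewrite (_ : [set: nat * nat] = [set: nat] `*`` (fun=> [set: nat])); last first.
  by apply/seteqP; split.
rewrite -(@esum_esum _ _ _ [set: nat] (fun=> [set: nat])
  (fun n k => diam_pow s (U n k))); last first.
  by move=> i j _ _; exact: diam_pow_ge0.
apply: le_trans (@epsilon_trick0 R eta xpredT (ltW e0)).
rewrite [leRHS]nneseries_esumT; last first.
  by move=> n; rewrite lee_fin divr_ge0 ?ltW.
apply: le_esum => n _; rewrite -nneseries_esumT => [|k]; last exact: diam_pow_ge0.
by have [] := hU n.
Qed.

Lemma hausdorff_null_sub s E F : E `<=` F -> hausdorff_measure s F = 0%E ->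
  hausdorff_measure s E = 0%E.
Proof.
move=> EF /hausdorff_measure_eq0 h; apply/hausdorff_measure_eq0 => d e d0 e0.
by have [U [U1 U2 U3]] := h d e d0 e0; exists U; split => //; exact: subset_trans U2.
Qed.

Lemma ediam_cball (x : R * R) r : 0 <= r -> (ediam (cball x r) <= (2 * r)%:E)%E.
Proof.
move=> r0; apply: ge_ereal_sup => _ [[y z] [/= xy xz] <-]; rewrite lee_fin.
rewrite (le_trans (edist_triangle y x z))// mulr2n mulrDl mul1r lerD//.
by rewrite edistC.
Qed.

Lemma ediam_ge0 (x : R * R) (A : set (R * R)) : A x -> (0 <= ediam A)%E.
Proof. by move=> Ax; apply: ereal_sup_ubound; exists (x, x) => //=; rewrite edistxx. Qed.

End hausdorff_null.

Section powers.
Variable R : realType.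

Lemma powR_expR (x y : R) : 0 < x -> x `^ y = expR (y * ln x).
Proof. by move=> x0; rewrite /powR gt_eqF. Qed.

Lemma powR_ge_expR (a b x y : R) (q t : R) : 0 < x -> 0 < y ->
  b <= q * ln x + t * ln y -> expR b <= x `^ q * y `^ t.
Proof. by move=> x0 y0 h; rewrite !powR_expR// -expRD ler_expR. Qed.

End powers.

(** * Olsen's inequality between the spectrum and the fine measures *)

Section olsen.
Variables (R : realType) (mu : probability (measurableTypeR R * measurableTypeR R)%type R).
Variable alpha : R.
Local Notation M := (mass mu).

Let X := [set x | supp mu x /\ has_local_dim mu x alpha].

(** The part of the level set where the local dimension is [e]-accurate at every scale below 1 / (N
    + 1); countably many such parts exhaust it. *)
Definition unif_level (e : R) (N : nat) := [set x | X x /\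
  forall r, 0 < r < N.+1%:R^-1 ->
    (alpha + e) * ln r <= ln (M (cball x r)) <= (alpha - e) * ln r].

Lemma unif_level_cover e : 0 < e -> X `<=` \bigcup_N unif_level e N.
Proof.
move=> e0 x [sx lx].
have := lx => /cvgrPdist_lt/(_ _ e0)[d /= d0 hd].
exists (Num.truncn d^-1) => //; split => // r /andP[r0 rN].
have N1 : (Num.truncn d^-1).+1%:R^-1 <= Num.min d 1.
  rewrite le_min; apply/andP; split.
    by rewrite invf_ple ?posrE//; apply: ltW; exact: truncnS_gt.
  by rewrite invf_le1// ler1n.
have [rd r1] : r < d /\ r < 1.
  by have := lt_le_trans rN N1; rewrite lt_min => /andP[].
have := hd r; rewrite /ball_/= sub0r normrN gtr0_norm// => /(_ rd r0).
have lr : ln r < 0 by rewrite ln_lt0// r0.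
rewrite -[fine (mu _)]/(M _); set l := ln (M _).
have -> : alpha - l / ln r = (alpha * ln r - l) / ln r.
  by rewrite mulrBl mulfK// lt_eqF.
rewrite normrM normfV (ltr0_norm lr) ltr_pdivrMr ?oppr_gt0//.
rewrite ltr_norml => /andP[h1 h2]; apply/andP; split; lra.
Qed.

Lemma unif_level_pow e N x r q : 0 < e -> unif_level e N x -> 0 < r < N.+1%:R^-1 ->
  0 < M (cball x r) /\ (q * alpha + `|q| * e) * ln r <= q * ln (M (cball x r)).
Proof.
move=> e0 [[sx _] h] hr; have /andP[r0 rN] := hr; split.
  by have := sx r r0; rewrite massE; [rewrite lte_fin|exact: measurable_cball].
have /andP[h1 h2] := h r hr; have [q0|q0] := lerP 0 q.
  have := ler_wpM2l q0 h1; rewrite ger0_norm//; lra.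
have := ler_wnM2l (ltW q0) h2; rewrite ltr0_norm//; lra.
Qed.

(** The supremum over subsets in the fine measure yields covers centred in [F] itself, where the
    mass of balls is controlled, with one bound [H] for all [F] and all scales. *)
Lemma fine_measure_cover q t : (fine_measure mu q t (supp mu) < +oo)%E ->
  exists H : R, forall (F : set (R * R)) delta, F `<=` supp mu -> 0 < delta ->
    exists (D : set nat) (x : nat -> R * R) (r : nat -> R),
    [/\ forall k, D k -> F (x k), forall k, D k -> 0 < r k <= delta,
        F `<=` \bigcup_(k in D) cball (x k) (r k) &
       (\esum_(k in D) ((M (cball (x k) (r k)) `^ q * r k `^ t)%:E) <= H%:E)%E].
Proof.
move=> fin; exists (fine (fine_measure mu q t (supp mu)) + 1) => F delta Fs d0.
have pre_le : (fine_measure_pre mu q t delta F <= fine_measure mu q t (supp mu))%E.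
  by apply: ereal_sup_ubound; exists F, delta.
have pre_ge0 : (0 <= fine_measure_pre mu q t delta F)%E.
  apply: le_ereal_inf_tmp => _ [D [x [r [_ _ _ ->]]]].
  by apply: esum_ge0 => k _; rewrite lee_fin mulr_ge0 ?powR_ge0.
have fmn : fine_measure mu q t (supp mu) \is a fin_num.
  by rewrite ge0_fin_numE// (le_trans pre_ge0).
have : (fine_measure_pre mu q t delta F <
    (fine (fine_measure mu q t (supp mu)) + 1)%:E)%E.
  by rewrite (le_lt_trans pre_le)// EFinD fineK// lteDl// lte01.
move=> /ereal_inf_lt[_ [D [x [r [h1 h2 h3 ->]]]] /ltW h4].
by exists D, x, r.
Qed.

Lemma olsen_null q t s : (fine_measure mu q t (supp mu) < +oo)%E ->
  q * alpha + t < s -> 0 <= s -> hausdorff_measure s X = 0%E.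
Proof.
move=> /fine_measure_cover[H hH] hs s0.
(* The accuracy [e] spends at most half of the room in the exponent; what remains is [e'], and [d1]
   below is the scale under which r^e' <= kap. *)
pose e := (s - (q * alpha + t)) / (2 * (1 + `|q|)).
pose e' := s - (q * alpha + t) - `|q| * e.
have q1 : 0 < 1 + `|q| by rewrite ltr_pwDl.
have g0 : 0 < s - (q * alpha + t) by rewrite subr_gt0.
have e0 : 0 < e by rewrite divr_gt0// mulr_gt0.
have e'0 : 0 < e'.
  have : `|q| * e <= (s - (q * alpha + t)) / 2.
    rewrite /e mulrA ler_pdivrMr ?mulr_gt0//.
    by move: g0 q1; set g := s - _; set a := `|q| => g0 q1; nra.
  rewrite /e'; lra.
apply: (hausdorff_null_sub (unif_level_cover e0)).
apply: hausdorff_null_bigcup => N; apply/hausdorff_measure_eq0 => delta eta d0 eta0.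
pose K := 2 `^ s * (`|H| + 1).
have K0 : 0 < K by rewrite mulr_gt0 ?powR_gt0// ltr_wpDl.
pose kap := eta / K.
have kap0 : 0 < kap by rewrite divr_gt0.
pose d1 := expR (ln kap / e').
pose dd := Num.min (delta / 2) (Num.min (N.+2%:R^-1) d1).
have dd0 : 0 < dd by rewrite !lt_min divr_gt0// invr_gt0 expR_gt0 ltr0n.
have sub : unif_level e N `<=` supp mu by move=> x [[]].
have [D [x [r [h1 h2 h3 h4]]]] := hH _ _ sub dd0.
exists (fun k => if k \in D then cball (x k) (r k) else set0); split.
- move=> k; case: ifPn => [/set_mem Dk|_].
    have /andP[r0 rd] := h2 k Dk; rewrite (le_trans (ediam_cball _ (ltW r0)))//.
    rewrite lee_fin -ler_pdivlMl// mulrC.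
    by apply: le_trans rd _; rewrite ge_min lexx.
  apply: ge_ereal_sup => _ [[y z] [/= []]].
- by move=> y /h3[k Dk yk]; exists k => //; rewrite mem_set.
pose a k := if k \in D then (M (cball (x k) (r k)) `^ q * r k `^ t)%:E else 0%E.
have a0 k : (0 <= a k)%E.
  by rewrite /a; case: ifP => // _; rewrite lee_fin mulr_ge0 ?powR_ge0.
apply: (@le_trans _ _ (\sum_(0 <= k <oo) (2 `^ s * kap)%:E * a k)%E).
  apply: lee_nneseries => [k _ _|k _]; first exact: diam_pow_ge0.
  rewrite /a; case: ifPn => [/set_mem Dk|_]; last by rewrite /diam_pow eqxx mule0.
  have /andP[r0 rd] := h2 k Dk.
  have rN : 0 < r k < N.+1%:R^-1.
    rewrite r0 (le_lt_trans rd)// !gt_min ltf_pV2 ?posrE ?ltr0n// ltr_nat.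
    by rewrite ltnSn orbT.
  have [M0 hM] := unif_level_pow q e0 (h1 k Dk) rN.
  have lk : e' * ln (r k) <= ln kap.
    rewrite mulrC -ler_pdivlMr// -[leRHS]expRK ler_ln ?posrE ?expR_gt0//.
    by rewrite (le_trans rd)// !ge_min lexx !orbT.
  have xx : cball (x k) (r k) (x k) by rewrite /cball /= edistxx ltW.
  rewrite /diam_pow; case: ifPn => [/eqP e0'|_]; first by rewrite e0' in xx.
  have ed := ediam_cball (x k) (ltW r0); have ed0 := ediam_ge0 xx.
  rewrite -[ediam _]fineK; last by rewrite ge0_fin_numE// (le_lt_trans ed)// ltry.
  rewrite poweR_EFin -EFinM lee_fin.
  apply: (@le_trans _ _ ((2 * r k) `^ s)).
    apply: ge0_ler_powR => //; rewrite ?nnegrE ?fine_ge0 ?mulr_ge0 ?(ltW r0)//.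
    by rewrite -lee_fin fineK// ge0_fin_numE// (le_lt_trans ed)// ltry.
  rewrite powRM ?(ltW r0)// -mulrA ler_wpM2l ?powR_ge0//.
  rewrite !powR_expR// -expRD -[X in X * expR _]lnK ?posrE// -expRD ler_expR.
  by move: hM lk; rewrite /e' => hM lk; lra.
rewrite nneseriesZl => [|k _]; last exact: a0.
rewrite nneseries_esumT// -esum_mkcond.
have c0 : 0 <= 2 `^ s * kap by rewrite mulr_ge0 ?powR_ge0// ltW.
apply: (@le_trans _ _ ((2 `^ s * kap)%:E * H%:E)%E); first exact: lee_wpmul2l.
rewrite -EFinM lee_fin /kap /K invfM mulrCA [2 `^ s * _]mulrA mulfV ?mul1r; last first.
  by rewrite gt_eqF// powR_gt0.
rewrite -mulrA ler_piMr ?(ltW eta0)// mulrC ler_pdivrMr ?mul1r ?ltr_wpDl//.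
by rewrite (le_trans (ler_norm _))// lerDl.
Qed.

(** Hausdorff dimensions range over s >= 0, so a negative exponent must be excluded for a nonempty
    level set: then a single small ball would already cost more than [H]. *)
Lemma olsen_exponent_ge0 q t x : (fine_measure mu q t (supp mu) < +oo)%E -> X x ->
  0 <= q * alpha + t.
Proof.
move=> /fine_measure_cover[H hH] Xx; rewrite leNgt; apply/negP => neg.
pose g := - (q * alpha + t).
have g0 : 0 < g by rewrite oppr_gt0.
have q1 : 0 < 1 + `|q| by rewrite ltr_pwDl.
pose e := g / (2 * (1 + `|q|)).
have e0 : 0 < e by rewrite divr_gt0// mulr_gt0.
have he : `|q| * e <= g / 2.
  rewrite /e mulrA ler_pdivrMr ?mulr_gt0//.
  by move: g0 q1; set a := `|q| => g0' q1; nra.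
have [N _ xN] := unif_level_cover e0 Xx.
pose d1 := expR (- (2 / g * (`|H| + 1))).
pose dd := Num.min (N.+2%:R^-1) d1.
have dd0 : 0 < dd by rewrite !lt_min invr_gt0 expR_gt0 ltr0n.
have sub : unif_level e N `<=` supp mu by move=> y [[]].
have [D [y [r [h1 h2 h3 h4]]]] := hH _ _ sub dd0.
have [k Dk _] := h3 x xN.
have /andP[r0 rd] := h2 k Dk.
have rN : 0 < r k < N.+1%:R^-1.
  rewrite r0 (le_lt_trans rd)// !gt_min ltf_pV2 ?posrE ?ltr0n// ltr_nat.
  by rewrite ltnSn.
have [M0 hM] := unif_level_pow q e0 (h1 k Dk) rN.
have lk : ln (r k) <= - (2 / g * (`|H| + 1)).
  rewrite -[leRHS]expRK ler_ln ?posrE ?expR_gt0//.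
  by rewrite (le_trans rd)// !ge_min lexx !orbT.
have : ((M (cball (y k) (r k)) `^ q * r k `^ t)%:E <= H%:E)%E.
  apply: le_trans h4; apply: esum_ge; exists [set k].
    by split; [exact: finite_set1 | move=> _ ->].
  by rewrite fsbig_set1.
rewrite lee_fin; apply/negP; rewrite -ltNge.
have H1 : H < expR (`|H| + 1).
  rewrite (le_lt_trans (ler_norm _))// (@lt_le_trans _ _ (1 + (`|H| + 1))) ?expR_ge1Dx//.
  by rewrite addrCA ltrDl.
apply: lt_le_trans H1 _; apply: powR_ge_expR => //.
apply: (@le_trans _ _ (- g / 2 * ln (r k))).
  have : 0 < 2 / g by rewrite divr_gt0.
  have -> : - g / 2 * ln (r k) = (- ln (r k)) * (g / 2) by ring.
  rewrite -ler_pdivrMr ?divr_gt0// invf_div mulrC; move: lk; lra.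
have l0 : ln (r k) <= 0.
  by apply: le_trans lk _; rewrite oppr_le0 mulr_ge0 ?divr_ge0 ?(ltW g0).
have : (`|q| * e) * ln (r k) >= g / 2 * ln (r k) by rewrite ler_wnM2r.
move: hM; rewrite /g; lra.
Qed.

Lemma olsen_upper q t : (fine_measure mu q t (supp mu) < +oo)%E ->
  (multifractal_spectrum mu alpha <= (q * alpha + t)%:E)%E.
Proof.
move=> fin; rewrite /multifractal_spectrum /hausdorff_dim -/X.
case: ifPn => [_|/set0P[x Xx]]; first exact: leNye.
have ge0 := olsen_exponent_ge0 fin Xx.
apply/lee_addgt0Pr => e e0; apply: ereal_inf_lbound.
exists (q * alpha + t + e) => //; split; first by rewrite addr_ge0// ltW.
by apply: (olsen_null fin); rewrite ?ltrDl// addr_ge0// ltW.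
Qed.

End olsen.

(** * Digit frequencies and the Ledrappier-Young formula *)

Section frequencies.
Variables (R : realType) (I : finType).
Implicit Types (w g x : I -> R) (o : nat -> I).

Definition mean w g := \sum_i w i * g i.

Definition cnt o k i : R := \sum_(l < k) (o l == i)%:R.

Definition freq_close w o k (e : R) := forall i, `|cnt o k i - k%:R * w i| <= e * k%:R.

Lemma bsum_cnt g o k : bsum g o k = \sum_i cnt o k i * g i.
Proof.
rewrite /bsum (eq_bigr (fun l : 'I_k => \sum_i (o l == i)%:R * g i)); last first.
  move=> l _; rewrite (bigD1 (o l))//= eqxx mul1r big1 ?addr0// => i.
  by rewrite eq_sym => /negbTE ->; rewrite mul0r.
by rewrite exchange_big; apply: eq_bigr => i _; rewrite mulr_suml.
Qed.

Lemma sum_cnt o k : \sum_i cnt o k i = k%:R.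
Proof.
have := bsum_cnt (fun=> 1) o k; rewrite /bsum sumr_const card_ord => ->.
by apply: eq_bigr => i _; rewrite mulr1.
Qed.

Lemma cnt_ge0 o k i : 0 <= cnt o k i.
Proof. by apply: sumr_ge0 => l _; rewrite ler0n. Qed.

Lemma bsum_ge (m : R) g o k : (forall i, m <= g i) -> k%:R * m <= bsum g o k.
Proof.
move=> h; rewrite mulrC mulr_natr -[k in m *+ k]card_ord -sumr_const.
exact: ler_sum.
Qed.

Lemma bsum_le (m : R) g o k : (forall i, g i <= m) -> bsum g o k <= k%:R * m.
Proof.
move=> h; rewrite mulrC mulr_natr -[k in m *+ k]card_ord -sumr_const.
exact: ler_sum.
Qed.

Lemma bsum_mean w g o k e : freq_close w o k e ->
  `|bsum g o k - k%:R * mean w g| <= e * k%:R * \sum_i `|g i|.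
Proof.
move=> h; rewrite bsum_cnt /mean mulr_sumr -sumrB mulr_sumr.
apply: le_trans (ler_norm_sum _ _ _) _; apply: ler_sum => i _.
by rewrite mulrA -mulrBl normrM ler_wpM2r.
Qed.

(** Measuring time by [bsum x] instead of [k] makes the two times of a square comparable: the
    Lyapunov sums at n and m agree up to a constant. *)
Lemma bsum_ratio w g x o k e : (forall i, 0 <= w i) -> 0 < mean w x ->
  freq_close w o k e ->
  `|bsum g o k - bsum x o k * (mean w g / mean w x)| <=
  e * k%:R * (\sum_i `|g i| + `|mean w g| / mean w x * \sum_i `|x i|).
Proof.
move=> w0 x0 h; have hg := bsum_mean g h; have hx := bsum_mean x h.
have -> : bsum g o k - bsum x o k * (mean w g / mean w x) =
  (bsum g o k - k%:R * mean w g) -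
  (bsum x o k - k%:R * mean w x) * (mean w g / mean w x).
  by field; rewrite gt_eqF.
rewrite (le_trans (ler_normB _ _))// mulrDr lerD// normrM mulrC.
rewrite normrM normfV (gtr0_norm x0) [leRHS]mulrCA.
by rewrite ler_wpM2l// divr_ge0// ltW.
Qed.

Lemma mean_gt0 w x : (forall i, 0 <= w i) -> \sum_i w i = 1 ->
  (forall i, 0 < x i) -> 0 < mean w x.
Proof.
move=> w0 w1 x0; have [m m0 hm] := fin_pos_lb x0.
rewrite (lt_le_trans m0)// -[m]mul1r -w1 mulr_suml.
by apply: ler_sum => i _; rewrite ler_wpM2l.
Qed.

End frequencies.

Section lyapunov.
Variables (R : realType) (I : finType) (T : diag_ifs R I).
Hypothesis hT : gatzouras_lalley T.

Definition lx1 i := - ln (contr1 T i).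
Definition lx2 i := - ln (contr2 T i).
(** Logarithm of the conditional weight of a letter in its column. Digits of weight 0 get the value
    ln 0 = 0 and drop out of the means. *)
Definition cond_log (v : I -> R) i := ln (v i / colw T v i).
Definition col_log (v : I -> R) i := ln (colw T v i).

(* [1 / chi2] weighs the information within columns, [1 / chi1] that of the
   columns themselves: this is the Ledrappier--Young formula. *)
Definition ly (w : I -> R) (a c : I -> R) :=
  mean w a / mean w lx2 + mean w c / mean w lx1.

Lemma lx1_gt0 i : 0 < lx1 i. Proof. exact: (lnb_gt0 (gl_contr1 hT)). Qed.
Lemma lx2_gt0 i : 0 < lx2 i. Proof. exact: (lnb_gt0 (gl_contr2 hT)). Qed.

Lemma bprod1_expR o m : bprod (contr1 T) o m = expR (- bsum lx1 o m).
Proof. exact: (bprod_expR (gl_contr1 hT)). Qed.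

Lemma bprod2_expR o m : bprod (contr2 T) o m = expR (- bsum lx2 o m).
Proof. exact: (bprod_expR (gl_contr2 hT)). Qed.

(** Minimality of [vlen]: the height overshoots the width by at most one contraction factor. *)
Lemma vlen_bsum : exists2 B, 0 < B & forall o m,
  bsum lx1 o m <= bsum lx2 o (vlen T o m) <= bsum lx1 o m + B.
Proof.
have [B B0 hB] := fin_ub lx2; exists B => // o m.
have [_ h1 h2] := vlenP hT o m.
move: h1; rewrite bprod1_expR bprod2_expR ler_expR lerN2 => -> /=.
move: h2; case: (vlen T o m) => [_|n /(_ n (ltnSn n))].
  rewrite {1}/bsum big_ord0 addr_ge0 ?(ltW B0)//.
  by apply: sumr_ge0 => i _; rewrite ltW// lx1_gt0.
rewrite bprod1_expR bprod2_expR ltr_expR ltrN2 bsumS => h.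
by apply: lerD => //; exact: ltW.
Qed.

Lemma vlen_ge : exists2 kap : R, 0 < kap & forall o m, kap * m%:R <= (vlen T o m)%:R :> R.
Proof.
have [m1 m10 h1] := fin_pos_lb lx1_gt0; have [m2 m20 h2] := fin_ub lx2.
exists (m1 / m2) => [|o m]; first exact: divr_gt0.
have [B _ hB] := vlen_bsum; have /andP[h _] := hB o m.
rewrite mulrAC ler_pdivrMr// mulrC.
by rewrite (le_trans (bsum_ge o m h1))// (le_trans h)// bsum_le.
Qed.

Lemma vlen_large K : exists m0, forall o m, (m0 <= m)%N -> (K <= vlen T o m)%N.
Proof.
have [kap k0 hk] := vlen_ge.
exists (Num.truncn (K%:R / kap)).+1 => o m hm.
rewrite -(ler_nat R) (le_trans _ (hk o m))// mulrC -ler_pdivrMr//.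
by rewrite ltW// (lt_le_trans (truncnS_gt _))// ler_nat.
Qed.

Lemma bsum_lx1_ge : exists2 m1 : R, 0 < m1 & forall o m, m1 * m%:R <= bsum lx1 o m.
Proof.
have [m1 m10 h1] := fin_pos_lb lx1_gt0; exists m1 => // o m.
by rewrite mulrC bsum_ge.
Qed.

Lemma ly_asymp (w a c : I -> R) eps : (forall i, 0 <= w i) -> \sum_i w i = 1 ->
  0 < eps -> exists2 e, 0 < e & exists m0, forall o m, (m0 <= m)%N ->
  freq_close w o (vlen T o m) e -> freq_close w o m e ->
  `|bsum a o (vlen T o m) + bsum c o m - bsum lx1 o m * ly w a c| <=
  eps * bsum lx1 o m.
Proof.
move=> w0 w1 eps0.
have chi1 := mean_gt0 w0 w1 lx1_gt0; have chi2 := mean_gt0 w0 w1 lx2_gt0.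
have [B B0 hB] := vlen_bsum; have [m1 m10 hm1] := bsum_lx1_ge.
pose K1 := 1 + (\sum_i `|a i| + `|mean w a| / mean w lx2 * \sum_i `|lx2 i|)
  + (\sum_i `|c i| + `|mean w c| / mean w lx1 * \sum_i `|lx1 i|).
pose K2 := B * (`|mean w a| / mean w lx2).
have K10 : 0 < K1.
  have n0 (g : I -> R) : 0 <= \sum_i `|g i| by apply: sumr_ge0.
  have d0 (x y : R) : 0 < y -> 0 <= `|x| / y by move=> /ltW y0; exact: divr_ge0.
  rewrite /K1 -addrA ltr_pwDl// !addr_ge0//;
  by apply: mulr_ge0 => //; exact: d0.
have K20 : 0 <= K2 by rewrite mulr_ge0 ?(ltW B0)// divr_ge0// ltW.
(* The frequency errors at both times take half of [eps]; the bounded mismatch of the two Lyapunov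
   sums takes the other half once [m] is large. *)
pose e := eps * m1 / (2 * K1).
have e0 : 0 < e by rewrite divr_gt0 ?mulr_gt0.
exists e => //; exists (Num.truncn (2 * K2 / (eps * m1))).+1 => o m hm fn fm.
have h1 := bsum_ratio a w0 chi2 fn; have h2 := bsum_ratio c w0 chi1 fm.
have /andP[hB1 hB2] := hB o m; have hm1' := hm1 o m.
have nm : (vlen T o m)%:R <= m%:R :> R by rewrite ler_nat; exact: vlen_le.
have mK2 : K2 <= eps * m1 * m%:R / 2.
  have : 2 * K2 / (eps * m1) <= m%:R.
    by rewrite ltW// (lt_le_trans (truncnS_gt _))// ler_nat.
  rewrite ler_pdivrMr ?mulr_gt0//; lra.
rewrite /ly; move: h1 h2 hB1 hB2 K20 mK2; rewrite /K2.
set qa := mean w a / _; set qc := mean w c / _.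
have -> : `|mean w a| / mean w lx2 = `|qa| by rewrite normrM normfV (gtr0_norm chi2).
have -> : `|mean w c| / mean w lx1 = `|qc| by rewrite normrM normfV (gtr0_norm chi1).
set S1 := \sum_i `|a i| + _; set S2 := \sum_i `|c i| + _.
have S10 : 0 <= S1 by rewrite addr_ge0 ?mulr_ge0 ?sumr_ge0.
have S20 : 0 <= S2 by rewrite addr_ge0 ?mulr_ge0 ?sumr_ge0.
have KE : K1 = 1 + S1 + S2.
  rewrite /K1 /S1 /S2 /qa /qc !normrM !normfV.
  by rewrite (gtr0_norm chi2) (gtr0_norm chi1).
set X1 := bsum lx1 o m; set X2 := bsum lx2 o _; set n := vlen T o m.
move=> h1 h2 hB1 hB2 K20 mK2.
have -> : bsum a o n + bsum c o m - X1 * (qa + qc) =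
  (bsum a o n - X2 * qa) + (X2 - X1) * qa + (bsum c o m - X1 * qc) by ring.
rewrite (le_trans (ler_normD _ _))// (le_trans (lerD (ler_normD _ _) (lexx _)))//.
have h3 : `|(X2 - X1) * qa| <= B * `|qa|.
  by rewrite normrM ler_wpM2r// ger0_norm ?subr_ge0//; lra.
have h1' : `|bsum a o n - X2 * qa| <= e * m%:R * S1.
  by rewrite (le_trans h1)// ler_wpM2r// ler_wpM2l// ltW.
have : e * m%:R * S1 + e * m%:R * S2 <= eps * m1 * m%:R / 2.
  rewrite -mulrDr; apply: (@le_trans _ _ (e * m%:R * K1)).
    by apply: ler_wpM2l; [rewrite mulr_ge0 ?(ltW e0)|rewrite KE; lra].
  by rewrite /e le_eqVlt; apply/orP; left; apply/eqP; field; rewrite gt_eqF.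
have : eps * m1 * m%:R <= eps * X1 by rewrite -mulrA ler_wpM2l// ltW.
lra.
Qed.

(** A prescribed rate of convergence makes [m0] common to all words, as the covering argument
    requires. *)
Lemma ly_asymp_uniform (w a c : I -> R) (ek : nat -> R) K0 eps :
  (forall i, 0 <= w i) -> \sum_i w i = 1 -> ek @ \oo --> (0 : R) -> 0 < eps ->
  exists m0, forall o, (forall k, (K0 <= k)%N -> freq_close w o k (ek k)) ->
  forall m, (m0 <= m)%N ->
  `|bsum a o (vlen T o m) + bsum c o m - bsum lx1 o m * ly w a c| <=
  eps * bsum lx1 o m.
Proof.
move=> w0 w1 ek0 eps0; have [e e0 [m0 hm0]] := ly_asymp a c w0 w1 eps0.
have /cvgrPdist_lt/(_ _ e0)[K1 _ hK1] := ek0.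
have [m1 hm1] := vlen_large (maxn K0 K1).
exists (maxn m0 m1) => o ho m; rewrite geq_max => /andP[mm0 mm1].
have fc k : (maxn K0 K1 <= k)%N -> freq_close w o k e.
  rewrite geq_max => /andP[k0 k1] i; rewrite (le_trans (ho k k0 i))//.
  rewrite ler_wpM2r//; have := hK1 k k1; rewrite /= sub0r normrN => /ltW.
  exact: le_trans (ler_norm _).
apply: hm0 => //; apply: fc; first exact: hm1.
exact: leq_trans (hm1 o m mm1) (vlen_le hT o m).
Qed.

Lemma colw_gew (v : I -> R) i : (forall j, 0 <= v j) -> v i <= colw T v i.
Proof.
by move=> v0; rewrite /colw (bigD1 i) ?same_col_refl//= lerDl sumr_ge0.
Qed.

Lemma colw_ge0 (v : I -> R) i : (forall j, 0 <= v j) -> 0 <= colw T v i.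
Proof. by move=> v0; rewrite sumr_ge0. Qed.

Lemma eq_colw (v : I -> R) i j : same_col T i j -> colw T v i = colw T v j.
Proof. by move=> /same_col_left h; apply: eq_bigl => k; rewrite h. Qed.

Lemma sqw_prod (w : I -> R) o m : (forall i, 0 <= w i) ->
  sqw T w o m = (\prod_(k < vlen T o m) (w (o k) / colw T w (o k))) *
    \prod_(k < m) colw T w (o k).
Proof.
move=> w0; rewrite /sqw; have nm := vlen_le hT o m.
move: nm; set n := vlen T o m => nm.
rewrite -(subnKC nm); move: (m - n)%N => d; rewrite !big_split_ord /= mulrA.
congr (_ * _); last first.
  by apply: eq_bigr => k _; rewrite ltnNge leq_addr.
rewrite -big_split; apply: eq_bigr => k _ /=; rewrite ltn_ord.
have [c0|c0] := eqVneq (colw T w (o k)) 0; last by rewrite divfK.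
rewrite c0 mulr0; apply/le_anti; rewrite w0 andbT -c0; exact: colw_gew.
Qed.

(** Only an inequality: at a vanishing weight, ln 0 = 0 makes the right factor 1. *)
Lemma sqw_expR_le (w : I -> R) o m : (forall i, 0 <= w i) ->
  sqw T w o m <= expR (bsum (cond_log w) o (vlen T o m) + bsum (col_log w) o m).
Proof.
have ex (x : R) : 0 <= x -> x <= expR (ln x).
  by rewrite le_eqVlt => /orP[/eqP <-|x0]; rewrite ?expR_ge0// lnK.
move=> w0; rewrite sqw_prod// expRD /bsum !expR_sum.
apply: ler_pM.
- by apply: prodr_ge0 => k _; rewrite divr_ge0// colw_ge0.
- by apply: prodr_ge0 => k _; rewrite colw_ge0.
- apply: ler_prod => k _; rewrite divr_ge0 ?colw_ge0//= ex// divr_ge0// colw_ge0//.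
- by apply: ler_prod => k _; rewrite colw_ge0//= ex// colw_ge0.
Qed.

Lemma sqw_expR (w : I -> R) o m : (forall i, 0 < w i) ->
  sqw T w o m = expR (bsum (cond_log w) o (vlen T o m) + bsum (col_log w) o m).
Proof.
move=> w0; have w0' i : 0 <= w i by rewrite ltW.
have c0 i : 0 < colw T w i by apply: lt_le_trans (w0 i) (colw_gew i w0').
rewrite sqw_prod// expRD /bsum !expR_sum; congr (_ * _); apply: eq_bigr => k _.
  by rewrite lnK// posrE divr_gt0.
by rewrite lnK// posrE.
Qed.

End lyapunov.

(** * Local dimensions from the weights of squares *)

Section local_dimension.
Variables (R : realType) (I : finType) (i0 : I) (T : diag_ifs R I).
Variables (L : set (R * R)) (p : I -> R).
Variable mu : probability (measurableTypeR R * measurableTypeR R)%type R.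
Hypothesis hT : gatzouras_lalley T.
Hypothesis hL : is_attractor T L.
Hypothesis hsep : separation_of_principal_projections T L.
Hypothesis hp : probability_vector p.
Hypothesis hp_pos : forall i, 0 < p i.
Hypothesis hmu : self_similar T p mu.
Local Notation M := (mass mu).
Local Notation b1 := (contr1 T).
Local Notation X1 := (bsum (lx1 T)).

Lemma scale_between (c : R) : 0 < c -> exists2 K, 0 < K & forall o r, 0 < r <= c ->
  exists m, [/\ r <= c * bprod b1 o m, c * bprod b1 o m.+1 < r,
    `|X1 o m + ln r| <= K & `|X1 o m.+1 + ln r| <= K].
Proof.
move=> c0; have [B B0 hB] := fin_ub (lx1 T).
exists (`|ln c| + B) => [|o r /andP[r0 rc]]; first by rewrite ltr_wpDl.
have ex : exists m, c * bprod b1 o m < r.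
  have rc2 : 0 < r / c / 2 by rewrite !divr_gt0.
  have [m hm] := bprod_small (gl_contr1 hT) rc2.
  exists m; rewrite mulrC -ltr_pdivlMr// (le_lt_trans (hm o m (leqnn m)))//.
  by rewrite gtr_pMr ?divr_gt0// invf_lt1// ltr1n.
(* The assumption r <= c excludes level 0, so the least level has a predecessor. *)
have [[|m] hm min] := find_ex_minn ex.
  by move: hm; rewrite bprod0 mulr1 ltNge rc.
have hm' : r <= c * bprod b1 o m.
  by rewrite leNgt; apply/negP => /min; rewrite ltnn.
have h1 : ln r <= ln c - X1 o m.
  rewrite -[leRHS]expRK ler_ln ?posrE ?expR_gt0//.
  by rewrite expRD lnK ?posrE// -(bprod1_expR hT).
have h2 : ln c - X1 o m.+1 <= ln r.
  rewrite -[leLHS]expRK ler_ln ?posrE ?expR_gt0// expRD lnK ?posrE//.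
  by rewrite -(bprod1_expR hT) ltW.
have h3 : X1 o m <= X1 o m.+1 <= X1 o m + B.
  by rewrite bsumS lerDl lerD2l hB ltW// lx1_gt0.
have := ler_norm (ln c); have := ler_norm (- ln c); rewrite normrN.
exists m; split => //; rewrite ler_norml; lra.
Qed.

Lemma local_dim_squares o x alpha : coded T o x ->
  (forall eps, 0 < eps -> exists m0, forall m, (m0 <= m)%N ->
    `|ln (sqw T p o m) + X1 o m * alpha| <= eps * X1 o m) ->
  has_local_dim mu x alpha.
Proof.
move=> ox hsq; apply/cvgrPdist_lt => e e0.
have [c c0 hc] := ball_upper i0 hT hp hmu hL hsep.
have [K1 K10 hK1] := scale_between c0.
have [K2 K20 hK2] := scale_between (ltr0n R 2).
pose eps := e / 4.
have eps0 : 0 < eps by rewrite divr_gt0.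
have [m0 hm0] := hsq _ eps0.
have [B B0 hB] := fin_ub (lx1 T).
pose K := K1 + K2.
(* Below exp (- Lam) the radius is less than 1, at most [c] and 2, its levels are at least [m0], and
   constant errors are absorbed in eps * |ln r|. *)
pose Lam := 1 + K + m0%:R * B + (`|alpha| + eps) * K / eps + `|ln c| + `|ln 2|.
have a1 : 0 <= m0%:R * B by rewrite mulr_ge0// ltW.
have a2 : 0 <= (`|alpha| + eps) * K / eps.
  apply: divr_ge0; last exact: ltW.
  by apply: mulr_ge0; apply: addr_ge0 => //; exact: ltW.
exists (expR (- Lam)) => /=; first exact: expR_gt0.
move=> r; rewrite /ball_/= sub0r normrN => rL r0.
rewrite gtr0_norm// in rL.
have lrL : ln r < - Lam by rewrite -[ltRHS]expRK ltr_ln ?posrE ?expR_gt0.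
have K0 : 0 < K by rewrite addr_gt0.
have r_le d : 0 < d -> - `|ln d| >= - Lam -> r <= d.
  move=> d0 hd; rewrite -ler_ln ?posrE//.
  by have := ler_norm (- ln d); rewrite normrN; lra.
have sq0 m : 0 < sqw T p o m by exact: sqw_gt0.
have Mr0 : 0 < M (cball x r).
  have := coded_supp i0 hT hp hp_pos hmu ox r0.
  by rewrite massE; [rewrite lte_fin|exact: measurable_cball].
have mge m d : (0 < d) -> `|X1 o m + ln r| <= d -> d <= K -> (m0 <= m)%N.
  move=> d0 hd dK; rewrite leqNgt; apply/negP => mm.
  have : X1 o m <= m0%:R * B.
    rewrite (le_trans (bsum_le o m hB))// ler_wpM2r ?(ltW B0)// ler_nat ltnW//.
  have := ler_norm (ln c); have := ler_norm (ln 2 : R).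
  have := normr_ge0 (ln c); have := normr_ge0 (ln 2 : R).
  move: hd lrL; rewrite ler_norml /Lam => /andP[h1 h2]; lra.
have fin X : `|X + ln r| <= K -> (`|alpha| + eps) * `|X + ln r| <= eps * (- ln r).
  move=> hX; apply: (@le_trans _ _ ((`|alpha| + eps) * K)).
    by rewrite ler_wpM2l// addr_ge0// ltW.
  rewrite -ler_pdivrMl// mulrC; move: lrL; rewrite /Lam.
  by have := normr_ge0 (ln c); have := normr_ge0 (ln 2 : R); lra.
have sp X : alpha * (X + ln r) <= `|alpha| * `|X + ln r| /\
    - (`|alpha| * `|X + ln r|) <= alpha * (X + ln r) /\ X + ln r <= `|X + ln r|.
  rewrite -normrM; split; first exact: ler_norm.
  by split; [rewrite lerNl -normrN ler_norm | exact: ler_norm].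
have upper : ln (M (cball x r)) <= alpha * ln r - 2 * eps * ln r.
  have rc : 0 < r <= c by rewrite r0 r_le// lerN2 /Lam; have := normr_ge0 (ln 2 : R); lra.
  have [m [h1 h2 h3 h4]] := hK1 o r rc.
  have mm : (m0 <= m)%N by apply: mge h3 _ => //; rewrite /K lerDl ltW.
  have hM : M (cball x r) <= sqw T p o m.
    apply: le_trans (hc o x m ox); apply: mass_le; try exact: measurable_cball.
    by move=> y /le_trans; exact.
  have : ln (M (cball x r)) <= ln (sqw T p o m) by rewrite ler_ln ?posrE.
  have := hm0 m mm; rewrite ler_norml => /andP[_].
  have h3' : `|X1 o m + ln r| <= K by rewrite (le_trans h3)// lerDl ltW.
  have := fin _ h3'; have [s1 [s2 s3]] := sp (X1 o m).
  have := ler_wpM2l (ltW eps0) s3; lra.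
have lower : alpha * ln r + 2 * eps * ln r <= ln (M (cball x r)).
  have rc : 0 < r <= 2 by rewrite r0 r_le// lerN2 /Lam; have := normr_ge0 (ln c); lra.
  have [m [h1 h2 h3 h4]] := hK2 o r rc.
  have mm : (m0 <= m.+1)%N by apply: mge h4 _ => //; rewrite /K lerDr ltW.
  have hM : sqw T p o m.+1 <= M (cball x r).
    apply: le_trans (ball_lower i0 hT hp hmu m.+1 ox) _.
    apply: mass_le; try exact: measurable_cball.
    by move=> y /le_trans; apply; exact: ltW.
  have : ln (sqw T p o m.+1) <= ln (M (cball x r)) by rewrite ler_ln ?posrE.
  have := hm0 _ mm; rewrite ler_norml => /andP[+ _].
  have h4' : `|X1 o m.+1 + ln r| <= K by rewrite (le_trans h4)// lerDr ltW.
  have := fin _ h4'; have [s1 [s2 s3]] := sp (X1 o m.+1).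
  have := ler_wpM2l (ltW eps0) s3; lra.
rewrite -[fine (mu _)]/(M _).
have lr0 : ln r < 0.
  by move: lrL; rewrite /Lam; have := normr_ge0 (ln c); have := normr_ge0 (ln 2 : R); lra.
have -> : alpha - ln (M (cball x r)) / ln r = (alpha * ln r - ln (M (cball x r))) / ln r.
  by rewrite mulrBl mulfK// lt_eqF.
rewrite normrM normfV (ltr0_norm lr0) ltr_pdivrMr ?oppr_gt0//.
rewrite (@le_lt_trans _ _ (2 * eps * - ln r))//.
  by rewrite ler_norml; apply/andP; split; lra.
by rewrite ltr_pM2r ?oppr_gt0// /eps; lra.
Qed.

End local_dimension.

(** * The lower bound on the spectrum *)

Section large_deviations.
Variables (R : realType) (I : finType) (i0 : I) (w : I -> R).
Hypothesis w0 : forall i, 0 <= w i.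
Hypothesis w1 : \sum_i w i = 1.

Lemma expR_le_quadratic (x : R) : `|x| <= 2^-1 -> expR x <= 1 + x + 2 * x ^+ 2.
Proof.
rewrite ler_norml => /andP[h1 h2].
have p1 : 0 < 1 - x by lra.
rewrite -[x in expR x]opprK expRN -[leRHS]invrK lef_pV2 ?posrE ?expR_gt0//; last first.
  by rewrite invr_gt0; nra.
rewrite (le_trans _ (expR_ge1Dx _))//.
have q : 0 < 1 + x + 2 * x ^+ 2 by nra.
rewrite -[leLHS]mul1r ler_pdivrMr//.
have : 0 <= x ^+ 2 * (1 - 2 * x) by rewrite mulr_ge0 ?sqr_ge0//; lra.
have -> : (1 - x) * (1 + x + 2 * x ^+ 2) = 1 + x ^+ 2 * (1 - 2 * x) by ring.
lra.
Qed.

Lemma weight_le1 i : w i <= 1.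
Proof. by rewrite -w1 (bigD1 i)//= lerDl sumr_ge0. Qed.

(** By independence the exponential moment is a product of [k] factors. Each letter's deviation is
    centred, so the linear term vanishes and the factor is at most 1 + 2 lam^2. *)
Lemma wsum_exp_cnt lam k J i : (k <= J)%N -> `|lam| <= 2^-1 ->
  wsum i0 w J (fun o => expR (lam * (cnt R o k i - k%:R * w i))) <=
  expR (2 * lam ^+ 2 * k%:R).
Proof.
move=> kJ hl.
pose g (l : nat) (j : I) := if (l < k)%N then expR (lam * ((j == i)%:R - w i)) else 1.
have e o : expR (lam * (cnt R o k i - k%:R * w i)) = \prod_(l < J) g l (o l).
  rewrite -(subnKC kJ) big_split_ord /= [X in _ = _ * X]big1 ?mulr1; last first.
    by move=> l _; rewrite /g ltnNge leq_addr.
  rewrite /cnt [k%:R * _]mulr_natl -[X in _ *+ X](card_ord k) -sumr_const -sumrB.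
  rewrite mulr_sumr expR_sum; apply: eq_bigr => l _.
  by rewrite /g ltn_ord.
rewrite (eq_wsum i0 w J e) wsum_prod -(subnKC kJ) big_split_ord /=.
rewrite [X in _ * X <= _]big1 ?mulr1; last first.
  move=> l _; rewrite -[RHS]w1; apply: eq_bigr => j _.
  by rewrite /g ltnNge leq_addr mulr1.
rewrite [_ * k%:R]mulr_natr -[X in _ *+ X](card_ord k) -sumr_const expR_sum.
apply: ler_prod => l _; rewrite sumr_ge0 => [|j _]; last first.
  by rewrite mulr_ge0// /g; case: ifP => // _; exact: expR_ge0.
rewrite /= (le_trans _ (expR_ge1Dx _))//.
have dev : \sum_j w j * ((j == i)%:R - w i) = 0.
  under eq_bigr do rewrite mulrBr.
  rewrite sumrB -mulr_suml w1 mul1r (bigD1 i)//= eqxx mulr1 big1 ?addr0 ?subrr//.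
  by move=> j /negbTE ->; rewrite mulr0.
apply: (@le_trans _ _ (\sum_j (w j * 1 + lam * (w j * ((j == i)%:R - w i)) +
    2 * lam ^+ 2 * w j))); last first.
  rewrite !big_split /= -mulr_sumr dev mulr0 addr0 -mulr_suml w1 mul1r.
  by rewrite -mulr_sumr w1 mulr1.
apply: ler_sum => j _; rewrite /g ltn_ord.
set y := (j == i)%:R - w i.
have y1 : `|y| <= 1.
  have := weight_le1 i; have := w0 i; rewrite /y ler_norml.
  by case: (j == i) => /=; lra.
have : `|lam * y| <= 2^-1 by rewrite normrM (le_trans _ hl)// ler_piMr.
move=> /expR_le_quadratic /(ler_wpM2l (w0 j)) h; apply: le_trans h _.
have -> : w j * (1 + lam * y + 2 * (lam * y) ^+ 2) =
  w j * 1 + lam * (w j * y) + 2 * lam ^+ 2 * w j * y ^+ 2 by ring.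
rewrite lerD2l ler_piMr//.
  by rewrite mulr_ge0// mulr_ge0// sqr_ge0.
by rewrite -real_normK ?num_real// exprn_ile1.
Qed.

(* The rate (k + 1)^(-1/4) is slow enough for the tails [exp (- ek k ^ 2 k / 8)]
   to be summable. *)
Definition ek (k : nat) : R := Num.sqrt (Num.sqrt k.+1%:R)^-1.

Lemma ek_gt0 k : 0 < ek k.
Proof. by rewrite sqrtr_gt0 invr_gt0 sqrtr_gt0. Qed.

Lemma ek_sqr k : ek k ^+ 2 = (Num.sqrt k.+1%:R)^-1.
Proof. by rewrite sqr_sqrtr// invr_ge0 sqrtr_ge0. Qed.

Lemma ek_le1 k : ek k <= 1.
Proof.
rewrite -[leRHS]sqrtr1 ler_wsqrtr// invf_le1 ?sqrtr_gt0//.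
by rewrite -[leLHS]sqrtr1 ler_wsqrtr// ler1n.
Qed.

Lemma ek_cvg0 : ek @ \oo --> (0 : R).
Proof.
apply/cvgrPdist_lt => e e0.
exists (Num.truncn (e ^- 4)) => // k /= hk.
rewrite sub0r normrN gtr0_norm ?ek_gt0//.
have e2 : ek k ^+ 4 < e ^+ 4.
  rewrite (exprM (ek k) 2 2) ek_sqr exprVn sqr_sqrtr// invf_plt ?posrE ?exprn_gt0//.
  by rewrite (lt_le_trans (truncnS_gt _))// ler_nat ltnS.
by move: e2; rewrite ltr_pXn2r// nnegrE ltW// ek_gt0.
Qed.

(** With s = sqrt (k + 1) the exponent is at least s / 16, since k >= (k + 1) / 2, and exp (s / 16)
    = exp (s / 64)^4 >= (s / 64)^4. *)
Lemma tail_bound k : (0 < k)%N -> expR (- (ek k ^+ 2 * k%:R / 8)) <= 64 ^+ 4 / k.+1%:R ^+ 2.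
Proof.
move=> k0; set s := Num.sqrt (k.+1%:R : R).
have s0 : 0 < s by rewrite sqrtr_gt0.
have s2 : s ^+ 2 = k.+1%:R by rewrite sqr_sqrtr.
have h1 : s / 16 <= ek k ^+ 2 * k%:R / 8.
  rewrite ek_sqr -/s.
  have k1 : (1 : R) <= k%:R by rewrite ler1n.
  have -> : s / 16 = s^-1 * (s ^+ 2 / 16) by rewrite expr2; field; rewrite gt_eqF.
  rewrite -mulrA ler_wpM2l ?invr_ge0 ?(ltW s0)// s2 -natr1; lra.
rewrite (@le_trans _ _ (expR (- (s / 16))))// ?ler_expR ?lerN2//.
rewrite -s2 -exprM expRN -[leRHS]invrK lef_pV2 ?posrE ?expR_gt0//; last first.
  by rewrite invr_gt0 divr_gt0// exprn_gt0.
rewrite invf_div -expr_div_n.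
have -> : s / 16 = (s / 64) * 4%:R by field.
rewrite expRM_natr lerXn2r ?nnegrE ?expR_ge0 ?divr_ge0 ?(ltW s0)//.
by rewrite (le_trans _ (expR_ge1Dx _))// lerDr.
Qed.

Lemma sum_inv_sqr K n : (0 < K)%N ->
  \sum_(K <= k < K + n) (k.+1%:R : R) ^- 2 <= K%:R^-1 - (K + n)%:R^-1.
Proof.
move=> K0; elim: n => [|n IH]; first by rewrite addn0 big_geq// subrr.
rewrite addnS big_nat_recr ?leq_addr//=; set m := (K + n)%N.
have m0 : (0 : R) < m%:R by rewrite ltr0n addn_gt0 K0.
have h : (m.+1%:R : R) ^- 2 <= m%:R^-1 - m.+1%:R^-1.
  rewrite -natr1; set x : R := m%:R.
  have x0 : 0 < x by [].
  have -> : x^-1 - (x + 1)^-1 = (x * (x + 1))^-1 by field; rewrite !gt_eqF// ltr_wpDl// ltW.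
  rewrite lef_pV2 ?posrE ?exprn_gt0 ?mulr_gt0 ?ltr_wpDl ?(ltW x0)//.
  by rewrite expr2 ler_wpM2r ?lerDl ?addr_ge0 ?(ltW x0).
by apply: le_trans (lerD IH h) _; rewrite addrA subrK.
Qed.

Definition typical K0 J (o : nat -> I) :=
  forall k, (K0 <= k <= J)%N -> freq_close w o k (ek k).

(** Exponential Markov inequality and a union bound over letters, signs and times; summability of
    the tails makes [K0] independent of [J]. *)
Lemma typical_weight : exists2 K0, (0 < K0)%N & forall J,
  2^-1 <= wsum i0 w J (fun o => (`[< typical K0 J o >])%:R).
Proof.
pose C : R := 2 * #|I|%:R * 64 ^+ 4.
have C0 : 0 <= C by rewrite !mulr_ge0// exprn_ge0.
pose K0 := (Num.truncn (2 * C)).+1.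
exists K0 => // J.
pose dev o k i : R := cnt R o k i - k%:R * w i.
(* At least 1 when the frequency of [i] at time [k] is off by more than [ek k]; the parameter ek / 4
   turns the mean into twice exp (- ek^2 k / 8) at most. *)
pose E k i o := expR (- (ek k / 4 * (ek k * k%:R))) *
  (expR (ek k / 4 * dev o k i) + expR (- (ek k / 4) * dev o k i)).
have E0 k i o : 0 <= E k i o by rewrite mulr_ge0 ?addr_ge0 ?expR_ge0.
have bad o : 1 - \sum_(K0 <= k < J.+1) \sum_i E k i o <= (`[< typical K0 J o >])%:R.
  have s0 : 0 <= \sum_(K0 <= k < J.+1) \sum_i E k i o.
    by apply: sumr_ge0 => k _; exact: sumr_ge0.
  case: asboolP => [_|ntyp]; first by rewrite lerBlDr lerDl.
  rewrite lerBlDr add0r.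
  move/existsNP: ntyp => [k /not_implyP[/andP[Kk kJ] /existsNP[i hi]]].
  rewrite (bigD1_seq k) ?iota_uniq ?mem_index_iota ?Kk//= (bigD1 i)//=.
  rewrite -addrA ler_wpDr//.
    rewrite addr_ge0//; first by apply: sumr_ge0.
    by apply: sumr_ge0 => ? _; apply: sumr_ge0.
  move/negP: hi; rewrite -ltNge lter_normr => hi.
  have e4 : 0 < ek k / 4 by rewrite divr_gt0// ek_gt0.
  rewrite /E mulrDr -!expRD; case/orP: hi => hi.
    rewrite ler_wpDr ?expR_ge0// (le_trans _ (expR_ge1Dx _))// lerDl.
    by rewrite addrC -mulrBr mulr_ge0 ?(ltW e4)// subr_ge0 ltW.
  rewrite ler_wpDl ?expR_ge0// (le_trans _ (expR_ge1Dx _))// lerDl.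
  by rewrite addrC mulNr -mulrN -mulrBr mulr_ge0 ?(ltW e4)// subr_ge0 ltW.
apply: le_trans (ler_wsum i0 J w0 bad).
under eq_wsum do rewrite -mulN1r.
rewrite wsumD wsum_const// wsumZ wsum_sum mulN1r.
suff : \sum_(K0 <= k < J.+1) wsum i0 w J (fun o => \sum_i E k i o) <= 2^-1 by lra.
have [JK|KJ] := leqP J.+1 K0; first by rewrite big_geq// invr_ge0.
apply: (@le_trans _ _ (\sum_(K0 <= k < J.+1) C * (k.+1%:R ^- 2))).
  rewrite !big_nat; apply: ler_sum => k /andP[Kk kJ].
  rewrite wsum_sum; apply: (@le_trans _ _ (\sum_(i : I) 2 * (64 ^+ 4 / k.+1%:R ^+ 2))).
    apply: ler_sum => i _; rewrite wsumZ wsumD.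
    have k0 : (0 < k)%N by exact: leq_trans Kk.
    have e4 : `|ek k / 4| <= 2^-1.
      by rewrite ger0_norm ?divr_ge0 ?ltW ?ek_gt0//; have := ek_le1 k; lra.
    have kJ' : (k <= J)%N by [].
    have h1 := wsum_exp_cnt i kJ' e4.
    have h2 : wsum i0 w J (fun o => expR (- (ek k / 4) * dev o k i)) <=
        expR (2 * (- (ek k / 4)) ^+ 2 * k%:R).
      by apply: wsum_exp_cnt; rewrite ?normrN.
    rewrite sqrrN in h2.
    apply: le_trans (ler_wpM2l (expR_ge0 _) (lerD h1 h2)) _.
    rewrite mulrDr -expRD -[leLHS]mulr2n -[leLHS]mulr_natl ler_wpM2l//.
    apply: le_trans (tail_bound k0); rewrite ler_expR le_eqVlt; apply/orP; left.
    by apply/eqP; field.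
  by rewrite sumr_const /C -mulr_natl le_eqVlt; apply/orP; left; apply/eqP; ring.
rewrite -mulr_sumr -(subnKC (ltnW KJ)).
apply: (@le_trans _ _ (C * K0%:R^-1)).
  by rewrite ler_wpM2l// (le_trans (sum_inv_sqr _ _))// lerBlDr lerDl.
rewrite ler_pdivrMr//; have : 2 * C < K0%:R by exact: truncnS_gt.
lra.
Qed.

End large_deviations.

(** * Points with prescribed digit frequencies *)

Section lower_bound.
Variables (R : realType) (I : finType) (i0 : I) (T : diag_ifs R I).
Variables (L : set (R * R)) (p : I -> R).
Variable mu : probability (measurableTypeR R * measurableTypeR R)%type R.
Hypothesis hT : gatzouras_lalley T.
Hypothesis hL : is_attractor T L.
Hypothesis hsep : separation_of_principal_projections T L.
Hypothesis hp : probability_vector p.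
Hypothesis hp_pos : forall i, 0 < p i.
Hypothesis hmu : self_similar T p mu.
Variable w : I -> R.
Hypothesis w0 : forall i, 0 <= w i.
Hypothesis w1 : \sum_i w i = 1.
Local Notation b1 := (contr1 T).
Local Notation X1 := (bsum (lx1 T)).

Definition ly_loc : R := - ly T w (cond_log T p) (col_log T p).
Definition ly_dim : R := - ly T w (cond_log T w) (col_log T w).

Definition typical_points K0 := [set x | exists2 o, coded T o x &
  forall J, typical w K0 J o].

Lemma typical_freq K0 o : (forall J, typical w K0 J o) ->
  forall k, (K0 <= k)%N -> freq_close w o k (ek R k).
Proof. by move=> h k Kk; apply: (h k); rewrite Kk/=. Qed.

Lemma typical_ext K0 J o o' : (forall k, (k < J)%N -> o k = o' k) ->
  typical w K0 J o -> typical w K0 J o'.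
Proof.
move=> e h k kJ i; have := h k kJ i; congr (_ <= _); congr `|_ - _|.
apply: eq_bigr => -[l lk] _ /=; rewrite e//.
by case/andP: kJ => _; exact: leq_trans.
Qed.

Lemma typical_dec K0 J o : typical w K0 J.+1 o -> typical w K0 J o.
Proof. by move=> h k /andP[h1 h2]; apply: h; rewrite h1 ltnW. Qed.

Lemma typical_local_dim K0 x : typical_points K0 x -> has_local_dim mu x ly_loc.
Proof.
move=> [om omx ho]; apply: (local_dim_squares i0 hT hL hsep hp hp_pos hmu omx).
move=> eps eps0.
have [m0 hm0] := ly_asymp_uniform hT (cond_log T p) (col_log T p) K0 w0 w1 (@ek_cvg0 R) eps0.
exists m0 => m mm; have := hm0 om (typical_freq ho) m mm.
by rewrite (sqw_expR hT)// expRK /ly_loc mulrN.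
Qed.

Lemma sqw_dim_bound K0 s : s < ly_dim -> exists m0, forall o,
  (forall J, typical w K0 J o) -> forall m, (m0 <= m)%N ->
  sqw T w o m <= expR (- s * X1 o m).
Proof.
move=> sD; have eps0 : 0 < ly_dim - s by rewrite subr_gt0.
have [m0 hm0] := ly_asymp_uniform hT (cond_log T w) (col_log T w) K0 w0 w1 (@ek_cvg0 R) eps0.
exists m0 => o ho m mm; have := hm0 o (typical_freq ho) m mm.
rewrite ler_norml => /andP[_ h]; rewrite (le_trans (sqw_expR_le hT o m w0))//.
rewrite ler_expR; move: h; rewrite /ly_dim; set l := ly _ _ _ _; lra.
Qed.

Lemma powR_add_le (a b s : R) : 0 <= a -> 0 <= b -> 0 < s ->
  (a + b) `^ s <= 2 `^ s * (a `^ s + b `^ s).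
Proof.
move=> a0 b0 s0; pose m := Num.max a b.
have m0 : 0 <= m by rewrite le_max a0.
apply: (@le_trans _ _ ((2 * m) `^ s)).
  apply: ge0_ler_powR; rewrite ?nnegrE ?addr_ge0 ?mulr_ge0 ?(ltW s0)//.
  by rewrite mulr2n mulrDl mul1r lerD// le_max lexx ?orbT.
rewrite powRM//; apply: ler_wpM2l; first exact: powR_ge0.
rewrite /m; have [_|_] := leP a b; first by rewrite lerDr powR_ge0.
by rewrite lerDl powR_ge0.
Qed.

Lemma powR_exp_le (a s s' : R) : 0 <= a -> a <= 1 -> 0 < s' -> s <= s' ->
  a `^ s' <= a `^ s.
Proof.
rewrite le_eqVlt => /orP[/eqP <- _ s0 _|a0 a1 _ ss].
  by rewrite powR0 ?gt_eqF// powR_ge0.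
by apply: ger_powR => //; rewrite a0.
Qed.

Lemma sum_half (eta : R) J : 0 <= eta -> \sum_(k < J) eta / (2 ^ k.+1)%:R <= eta.
Proof.
move=> e0; suff -> : \sum_(k < J) eta / (2 ^ k.+1)%:R = eta - eta / (2 ^ J)%:R.
  by rewrite lerBlDr lerDl divr_ge0.
elim: J => [|J IH]; first by rewrite big_ord0 expn0 divr1 subrr.
rewrite big_ord_recr /= IH expnS natrM; field.
by rewrite pnatr_eq0 expn_eq0.
Qed.

(* The mass distribution principle, with Konig's lemma replacing a Bernoulli
   measure on infinite words: a cover whose squares have too little total weight
   leaves a typical word of every length, hence an infinite one, uncovered. *)
Lemma typical_cover K0 s : (forall J, 2^-1 <=
    wsum i0 w J (fun o => (`[< typical w K0 J o >])%:R)) ->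
  0 <= s -> s < ly_dim -> hausdorff_measure s (typical_points K0) <> 0%E.
Proof.
move=> hw s0 sD /hausdorff_measure_eq0 hH.
(* As [s] may be 0, a positive exponent is interposed so that small radii have small powers. *)
pose s' := (s + ly_dim) / 2.
have ss' : s < s' by rewrite /s'; lra.
have s'D : s' < ly_dim by rewrite /s'; lra.
have s'0 : 0 < s' by exact: le_lt_trans ss'.
have [m0 hm0] := sqw_dim_bound K0 s'D.
have [c [Js c0 hc]] := square_sep hT hL hsep.
have [K K00 hK] := scale_between hT c0.
have [B B0 hB] := fin_ub (lx1 T).
pose Lam := 1 + `|ln c| + K + m0%:R * B.
pose A := expR (s' * K) * 2 `^ s'.
have A0 : 0 < A by rewrite mulr_gt0 ?expR_gt0 ?powR_gt0.
pose rho := expR (- Lam).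
have rho0 : 0 < rho by exact: expR_gt0.
(* The first bound keeps the squares' total weight at most 2 A eta <= 1/4, below the 1/2 of typical
   words; the second keeps [tiny k] at most rho / 2. *)
pose eta := Num.min (8 * A)^-1 ((rho / 2) `^ s').
have eta0 : 0 < eta by rewrite lt_min invr_gt0 mulr_gt0//= powR_gt0// divr_gt0.
pose delta := Num.min 1 (rho / 2).
have delta0 : 0 < delta by rewrite lt_min ltr01 divr_gt0.
have [U [U1 U2 U3]] := hH _ _ delta0 eta0.
pose v k := fine (diam_pow s (U k)).
have vE k : diam_pow s (U k) = (v k)%:E.
  rewrite /v /diam_pow; case: ifPn => // /set0P[x Ux].
  have e0 := ediam_ge0 Ux; have e1 := U1 k.
  rewrite -[ediam _]fineK; last by rewrite ge0_fin_numE// (le_lt_trans e1)// ltry.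
  by rewrite poweR_EFin.
have vsum J : \sum_(k < J) v k <= eta.
  rewrite -lee_fin -sumEFin -(big_mkord xpredT (fun k => (v k)%:E)).
  apply: le_trans U3; under eq_bigr do rewrite -vE.
  by apply: nneseries_lim_ge => k _ _; exact: diam_pow_ge0.
have v0 k : 0 <= v k by rewrite -lee_fin -vE diam_pow_ge0.
(* Covering sets may have diameter 0; this enlargement makes every radius positive, and its
   s'-powers sum to at most [eta]. *)
pose tiny k : R := (eta / (2 ^ k.+1)%:R) `^ s'^-1.
have tp k : 0 < eta / (2 ^ k.+1)%:R by rewrite divr_gt0// ltr0n expn_gt0.
have tiny0 k : 0 < tiny k by rewrite powR_gt0.
have tinyE k : tiny k `^ s' = eta / (2 ^ k.+1)%:R.
  by rewrite /tiny -powRrM mulVf ?gt_eqF// powRr1// ltW.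
have tiny_le k : tiny k <= rho / 2.
  have h : eta / (2 ^ k.+1)%:R <= (rho / 2) `^ s'.
    rewrite (@le_trans _ _ eta)//; last by rewrite ge_min lexx orbT.
    by rewrite ler_piMr ?(ltW eta0)// invf_le1 ?ltr0n ?expn_gt0// ler1n expn_gt0.
  have r2 : 0 <= rho / 2 by rewrite divr_ge0 ?ltW.
  have := @ge0_ler_powR _ s'^-1; rewrite invr_ge0 => /(_ (ltW s'0)) mono.
  have := mono _ _ _ _ h; rewrite !nnegrE (ltW (tp k)) powR_ge0 => /(_ isT isT).
  by rewrite -powRrM mulfV ?gt_eqF// powRr1.
have /choice[sq hsq] : forall k, exists om : (nat -> I) * nat,
    (exists2 x, U k x & typical_points K0 x) ->
    (forall o' x', coded T o' x' -> U k x' -> insq T om.1 om.2 o') /\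
    sqw T w om.1 om.2 <= A * (v k + eta / (2 ^ k.+1)%:R).
  move=> k; have [[x Ux [ om ox typ]]|nm] := pselect (exists2 x, U k x & typical_points K0 x);
    last by exists (fun=> i0, 0%N).
  have e0 := ediam_ge0 Ux; have e1 := U1 k.
  have fn : ediam (U k) \is a fin_num by rewrite ge0_fin_numE// (le_lt_trans e1)// ltry.
  pose d := fine (ediam (U k)).
  have d0 : 0 <= d by exact: fine_ge0.
  have dd : d <= delta by rewrite -lee_fin fineK.
  have d1 : d <= 1 by apply: le_trans dd _; rewrite ge_min lexx.
  have vd : v k = d `^ s.
    rewrite /v /diam_pow; case: ifPn => [/eqP e|_]; first by rewrite e in Ux.
    by rewrite -[ediam _]fineK// poweR_EFin.
  pose r := d + tiny k.
  have r0 : 0 < r by rewrite ltr_wpDl.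
  have rrho : r <= rho.
    have : d <= rho / 2 by apply: le_trans dd _; rewrite ge_min lexx orbT.
    by have := tiny_le k; rewrite /r; lra.
  have lr : ln r <= - Lam by rewrite -[leRHS]expRK ler_ln ?posrE ?expR_gt0.
  have mB : 0 <= m0%:R * B by rewrite mulr_ge0// ltW.
  have rc : 0 < r <= c.
    rewrite r0 -ler_ln ?posrE//; have := ler_norm (- ln c); rewrite normrN.
    by move: lr; rewrite /Lam; lra.
  have [m [h1 h2 h3 h4]] := hK om r rc.
  exists (om, m) => _ /=; split.
    move=> o' x' ox' Ux'; apply: (hc om o' x x') => //.
    - exact: (ox' _).1.
    - exact: (ox' _).2.
    - apply: le_trans h1; apply: (@le_trans _ _ d); last by rewrite lerDl ltW.
      rewrite -lee_fin fineK//; apply: ereal_sup_ubound.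
      by exists (x, x').
  move: h3; rewrite ler_norml => /andP[h3 _].
  have mm : (m0 <= m)%N.
    rewrite leqNgt; apply/negP => mm.
    have : X1 om m <= m0%:R * B.
      by rewrite (le_trans (bsum_le om m hB))// ler_wpM2r ?(ltW B0)// ler_nat ltnW.
    by have := normr_ge0 (ln c); move: lr; rewrite /Lam; lra.
  apply: le_trans (hm0 om typ m mm) _.
  apply: (@le_trans _ _ (expR (s' * K) * r `^ s')).
    rewrite powR_expR// -expRD ler_expR mulNr -mulrN -mulrDr ler_pM2l//; lra.
  rewrite /A -mulrA ler_pM2l ?expR_gt0//.
  apply: le_trans (powR_add_le d0 (ltW (tiny0 k)) s'0) _.
  rewrite ler_pM2l ?powR_gt0// tinyE lerD2r vd.
  exact: powR_exp_le (ltW ss').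
pose meets k := `[< exists2 x, U k x & typical_points K0 x >].
(* Only squares of level at most [J] are tested, so that [P J] reads the first [J] letters alone. *)
pose P J o := typical w K0 J o /\ forall k, (k < J)%N -> meets k ->
  ((sq k).2 <= J)%N -> ~ insq T (sq k).1 (sq k).2 o.
have [om omP] : exists o, forall J, P J o.
  apply: (konig i0).
  - move=> J o o' e [h1 h2]; split; first exact: typical_ext h1.
    move=> k kJ mk mJ /insqP[g1 g2]; apply: (h2 k kJ mk mJ); apply/insqP.
    split=> l lm; have lJ : (l < J)%N.
    - by rewrite (leq_trans lm)// (leq_trans (vlen_le hT _ _)).
    - by rewrite g1// e.
    - by rewrite (leq_trans lm).
    - by rewrite e//; exact: g2.
  - move=> J o [h1 h2]; split; first exact: typical_dec.
    by move=> k kJ mk mJ; apply: h2 => //; exact: ltnW.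
  move=> J; apply: contrapT => /forallNP nP.
  have : 2^-1 <= \sum_(k < J | meets k && ((sq k).2 <= J)%N) sqw T w (sq k).1 (sq k).2.
    apply: le_trans (hw J) _.
    rewrite (eq_bigr (fun k : 'I_J => wsum i0 w J (sqind T (sq k).1 (sq k).2 J))); last first.
      by move=> k /andP[_ kJ]; rewrite (wsum_sqind i0 hT).
    rewrite -wsum_sum; apply: ler_wsum => // o; case: asboolP => [typ|_]; last first.
      by apply: sumr_ge0 => k _; exact: sqind_ge0.
    have /not_andP[//|/existsNP[k /not_implyP[kJ /not_implyP[mk /not_implyP[mJ /contrapT h]]]]] := nP o.
    rewrite (bigD1 (Ordinal kJ)) ?mk//= sqind_insq// lerDl.
    by apply: sumr_ge0 => l _; exact: sqind_ge0.
  apply/negP; rewrite -ltNge; apply: (@le_lt_trans _ _ (A * (eta + eta))).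
    apply: (@le_trans _ _ (\sum_(k < J) A * (v k + eta / (2 ^ k.+1)%:R))).
      rewrite [leLHS]big_mkcond /=; apply: ler_sum => k _.
      case: ifPn => [/andP[/asboolP mk _]|_]; first by have [] := hsq k mk.
      by rewrite mulr_ge0 ?(ltW A0)// addr_ge0// ltW.
    rewrite -mulr_sumr big_split /= ler_pM2l//.
    by apply: lerD; [exact: vsum | exact: sum_half (ltW eta0)].
  have : A * eta <= 8^-1.
    rewrite mulrC -ler_pdivlMr// -invfM.
    by rewrite ge_min lexx.
  lra.
have [x ox] := coded_ex hT om.
have Ex : typical_points K0 x by exists om => // J; have [] := omP J.
have [k _ Ux] := U2 x Ex.
have mk : meets k by apply/asboolP; exists x.
have [_ /(_ k (leq_maxl _ _) mk (leq_maxr _ _))] := omP (maxn k.+1 (sq k).2).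
apply; have [h _] := hsq k (ex_intro2 _ _ x Ux Ex).
exact: h ox Ux.
Qed.

Lemma spectrum_ge : (ly_dim%:E <= multifractal_spectrum mu ly_loc)%E.
Proof.
have [K0 _ hw] := typical_weight i0 w0 w1.
have sub : typical_points K0 `<=` [set x | supp mu x /\ has_local_dim mu x ly_loc].
  move=> x tx; split; last exact: typical_local_dim tx.
  by have [om ox _] := tx; exact: (coded_supp i0 hT hp hp_pos hmu ox).
rewrite /multifractal_spectrum /hausdorff_dim; case: ifPn => [/eqP e0|_].
  (* The empty set has dimension -oo, so a typical point must be exhibited: weight 1/2 at each level
     provides typical words. *)
  have [om omP] : exists o, forall J, typical w K0 J o.
    apply: (konig i0); [exact: typical_ext | exact: typical_dec |].
    move=> J; apply: contrapT => /forallNP nP; have := hw J.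
    rewrite (@eq_wsum _ _ i0 w J _ (fun=> 0)) => [|o].
      by rewrite wsum0 leNgt invr_gt0 ltr0n.
    by case: asboolP => // /nP.
  have [x ox] := coded_ex hT om.
  by suff : (set0 : set (R * R)) x; [ | rewrite -e0; apply: sub; exists om].
apply: le_ereal_inf_tmp => _ [s [s0 hs] <-]; rewrite lee_fin leNgt; apply/negP => sD.
by apply: (typical_cover hw s0 sD); exact: hausdorff_null_sub hs.
Qed.

End lower_bound.

(** * The lower bound on the fine spectrum *)

Section pressure.
Variables (R : realType) (I : finType) (i0 : I) (T : diag_ifs R I) (p : I -> R).
Hypothesis hT : gatzouras_lalley T.
Hypothesis hp_pos : forall i, 0 < p i.
Local Notation b1 := (contr1 T).
Local Notation b2 := (contr2 T).
Local Notation X1 := (bsum (lx1 T)).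
Local Notation X2 := (bsum (lx2 T)).

Implicit Types (o : nat -> I) (w g : I -> R).

(** The quantity U of the overview; [col_pressure] is V. *)
Definition cond_pressure (q : R) (w : I -> R) :=
  (q * mean w (cond_log T p) - mean w (cond_log T w)) / mean w (lx2 T).
Definition col_pressure (q : R) (w : I -> R) :=
  (q * mean w (col_log T p) - mean w (col_log T w)) / mean w (lx1 T).

Definition simplex (w : I -> R) := (forall i, 0 <= w i) /\ \sum_i w i = 1.

Definition frq o k (i : I) : R := cnt R o k i / k%:R.

Lemma frq_simplex o k : (0 < k)%N -> simplex (frq o k).
Proof.
move=> k0; split; first by move=> i; rewrite divr_ge0// cnt_ge0.
by rewrite -mulr_suml sum_cnt mulfV// pnatr_eq0 -lt0n.
Qed.

Lemma mean_frq o k g : (0 < k)%N -> k%:R * mean (frq o k) g = bsum g o k.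
Proof.
move=> k0; rewrite bsum_cnt mulr_sumr; apply: eq_bigr => i _.
by rewrite /frq; field; rewrite pnatr_eq0 -lt0n.
Qed.

Lemma eq_cnt o o' k : (forall l, (l < k)%N -> o l = o' l) -> cnt R o k = cnt R o' k.
Proof. by move=> e; apply/funext => i; apply: eq_bigr => -[l lk] _ /=; rewrite e. Qed.

Lemma colw_cnt o k i : colw T (cnt R o k) i = \sum_(l < k) (same_col T i (o l))%:R.
Proof.
rewrite /colw exchange_big; apply: eq_bigr => l _ /=.
have [h|h] := boolP (same_col T i (o l)).
  rewrite (bigD1 (o l))//= eqxx big1 ?addr0// => j /andP[_].
  by rewrite eq_sym => /negbTE ->.
rewrite big1// => j ij; case: eqVneq => // e; move: h.
by rewrite e ij.
Qed.

Lemma colw_frq o o' m : (forall k, (k < m)%N -> same_col T (o k) (o' k)) ->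
  colw T (frq o m) = colw T (frq o' m).
Proof.
move=> h; apply/funext => i.
have e z : colw T (frq z m) i = colw T (cnt R z m) i / m%:R by rewrite /colw -mulr_suml.
rewrite !e !colw_cnt; congr (_ / _); apply: eq_bigr => -[l lm] _ /=.
have hl := h l lm; rewrite [same_col _ i _]same_colC (same_col_left hl).
by rewrite same_colC.
Qed.

Lemma col_pressure_frq q o o' m : (0 < m)%N ->
  (forall k, (k < m)%N -> same_col T (o k) (o' k)) ->
  col_pressure q (frq o m) = col_pressure q (frq o' m).
Proof.
move=> m0 h.
have e g : (forall i j, same_col T i j -> g i = g j) ->
    mean (frq o m) g = mean (frq o' m) g.
  move=> hg; apply: (@mulfI _ m%:R); first by rewrite pnatr_eq0 -lt0n.
  by rewrite !mean_frq//; apply: eq_bsum => l /h; exact: hg.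
rewrite /col_pressure /col_log (colw_frq h) !e//.
- by move=> i j /andP[/eqP hij _]; rewrite /lx1 hij.
- by move=> i j /eq_colw ->.
- by move=> i j /eq_colw ->.
Qed.

Lemma pressure_dim q w : cond_pressure q w + col_pressure q w =
  ly_dim T w - q * ly_loc T p w.
Proof.
rewrite /cond_pressure /col_pressure /ly_dim /ly_loc /ly.
by rewrite mulrN opprK !mulrBl mulrDr !mulrA; ring.
Qed.

(* Otherwise the bounded quantity [cond_pressure q (frq o m)] would decrease by
   [eps] at each step of the chain [m -> vlen T o m -> ...] *)
Lemma pressure_descent q o eps Bd m0 : 0 < eps ->
  (forall w, simplex w -> `|cond_pressure q w| <= Bd) ->
  exists2 m, (m0 <= m)%N & (0 < vlen T o m)%N /\
    cond_pressure q (frq o (vlen T o m)) <= cond_pressure q (frq o m) + eps.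
Proof.
move=> eps0 hBd; apply: contrapT => hn.
have [m1 hm1] := vlen_large hT 1.
pose f m := cond_pressure q (frq o m).
have step m : (m0 <= m)%N -> (m1 <= m)%N -> f m < f (vlen T o m) - eps.
  move=> h0 h1; rewrite ltrBrDr ltNge; apply/negP => h; apply: hn.
  by exists m => //; split => //; exact: hm1.
have chain j : exists mj, forall m, (mj <= m)%N -> f m <= Bd - j%:R * eps.
  elim: j => [|j [mj IH]].
    exists 1%N => m m1'; rewrite mul0r subr0; apply: le_trans (ler_norm _) _.
    exact/hBd/frq_simplex.
  have [m2 hm2] := vlen_large hT mj.
  exists (maxn m2 (maxn m0 m1)) => m; rewrite !geq_max => /andP[h2 /andP[h0 h1]].
  have := step m h0 h1; have := IH _ (hm2 o m h2).
  rewrite -natr1 mulrDl mul1r => h3 /ltW h4; apply: le_trans h4 _.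
  by rewrite opprD addrA lerD2r.
have Bd0 : 0 <= Bd.
  by apply: le_trans (normr_ge0 _) (hBd _ (frq_simplex o (ltn0Sn 0))).
have [mj hmj] := chain (Num.truncn (2 * Bd / eps)).+1.
have h1 := hmj (maxn 1 mj) (leq_maxr _ _).
have hN : 2 * Bd < (Num.truncn (2 * Bd / eps)).+1%:R * eps.
  by rewrite -ltr_pdivrMr//; exact: truncnS_gt.
have h2 : - Bd <= f (maxn 1 mj).
  have : simplex (frq o (maxn 1 mj)) by apply: frq_simplex; rewrite leq_max.
  by move=> /hBd; rewrite ler_norml => /andP[].
have := le_trans h2 h1; move: hN; move: (_ * eps) => y hN h; move: hN.
by apply/negP; rewrite -leNgt; lra.
Qed.

Definition col_rep i : I := odflt i [pick j | same_col T i j].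

Lemma col_repP i : same_col T i (col_rep i).
Proof.
rewrite /col_rep; case: pickP => //= h.
by have := h i; rewrite same_col_refl.
Qed.

Lemma col_rep_eq i j : same_col T i j -> col_rep i = col_rep j.
Proof.
move=> ij; rewrite /col_rep (eq_pick (same_col_left ij)); case: pickP => //= h.
by have := h j; rewrite same_col_refl.
Qed.

Lemma sum_colw_rep (w : I -> R) :
  \sum_i (col_rep i == i)%:R * colw T w i = \sum_i w i.
Proof.
rewrite /colw; under eq_bigr do rewrite mulr_sumr.
rewrite (exchange_big_dep predT)//=; apply: eq_bigr => j _.
rewrite (bigD1 (col_rep j)) /=; last by rewrite same_colC col_repP.
rewrite -(col_rep_eq (col_repP j)) eqxx mul1r big1 ?addr0// => i /andP[ij ni].
case: eqVneq => e; last by rewrite mul0r.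
by move: ni; rewrite -e (col_rep_eq ij) eqxx.
Qed.

(** Conditional weights of [v] redistribute the column weights of [w]; columns where [v] vanishes
    lose theirs, whence only an inequality. *)
Lemma sum_cond_colw (v w : I -> R) : (forall i, 0 <= v i) -> (forall i, 0 <= w i) ->
  \sum_i (v i / colw T v i) * colw T w i <= \sum_i w i.
Proof.
move=> v0 w0; rewrite {2}/colw; under eq_bigr do rewrite mulr_sumr.
rewrite (exchange_big_dep predT)//=; apply: ler_sum => j _.
under eq_bigr => i ij do rewrite (eq_colw v ij).
have -> : \sum_(i | same_col T i j) v i / colw T v j * w j =
    colw T v j / colw T v j * w j.
  by rewrite -!mulr_suml; congr (_ / _ * _); apply: eq_bigl => i; rewrite same_colC.
rewrite ler_piMl//; have [->|c0] := eqVneq (colw T v j) 0; first by rewrite mul0r.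
by rewrite mulfV.
Qed.

(* One word per approximate square. *)
Definition norm_word o m k : I :=
  if (k < vlen T o m)%N then o k else col_rep (o k).

Lemma insq_norm o m : insq T o m (norm_word o m).
Proof.
apply/insqP; split=> k; rewrite /norm_word; first by move=> ->.
by case: ifP => _ _; [exact: same_col_refl | exact: col_repP].
Qed.

Lemma insq_sqw w o m o' : insq T o m o' -> sqw T w o' m = sqw T w o m.
Proof.
move=> h; have e := insq_vlen hT h; have /insqP[h1 h2] := h.
apply: eq_bigr => -[k km] _ /=; rewrite e; case: ifPn => [/h1 ->//|_].
by rewrite (eq_colw w (h2 k km)).
Qed.

(** The normalised word determines its square: [vlen] is the same for a word and its normalisation,
    and then letters and columns can be read back. *)
Lemma eq_norm_insq o o' m :
  (forall k, (k < m)%N -> norm_word o m k = norm_word o' m k) -> insq T o m o'.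
Proof.
move=> h.
have e : vlen T o' m = vlen T o m.
  have e1 := insq_vlen hT (insq_norm o m); have e2 := insq_vlen hT (insq_norm o' m).
  rewrite -e2 -e1; apply: (eq_vlen hT (o := norm_word o m)) => //.
  - exact: vlen_le.
  - by move=> k kn; apply/h/(leq_trans kn); exact: vlen_le.
  - by move=> k km; rewrite h// same_col_refl.
apply/insqP; split=> k km; last first.
  have := h k km; have s1 z : same_col T (z k) (norm_word z m k).
    by rewrite /norm_word; case: ifP => _; [exact: same_col_refl|exact: col_repP].
  move=> hk; apply: (@same_col_trans _ _ _ (norm_word o m k)) => //.
  by rewrite hk same_colC.
have := h k (leq_trans km (vlen_le hT o m)).
by rewrite /norm_word e km.
Qed.

End pressure.

(** * Sums over squares by the method of types *)

Section level_sums.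
Variables (R : realType) (I : finType) (i0 : I) (T : diag_ifs R I) (p : I -> R).
Hypothesis hT : gatzouras_lalley T.
Hypothesis hp_pos : forall i, 0 < p i.
Local Notation b1 := (contr1 T).
Local Notation X1 := (bsum (lx1 T)).
Local Notation X2 := (bsum (lx2 T)).
Implicit Types (o : nat -> I) (w : I -> R).

Lemma expn_le_expR N (a : R) : 0 < a -> exists2 C, 0 < C & forall m : nat,
  (m.+1%:R : R) ^+ N <= C * expR (a * m%:R).
Proof.
move=> a0; case: N => [|N].
  exists 1 => // m; rewrite expr0 mul1r -expR0 ler_expR mulr_ge0// ltW//.
pose b := Num.min 1 (a / N.+1%:R).
have b0 : 0 < b by rewrite lt_min ltr01 divr_gt0.
exists (b ^- N.+1) => [|m]; first by rewrite invr_gt0 exprn_gt0.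
rewrite mulrC ler_pdivlMr ?exprn_gt0// -exprMn.
have -> : a * m%:R = (a / N.+1%:R * m%:R) * N.+1%:R.
  by rewrite mulrAC divfK// pnatr_eq0.
rewrite expRM_natr lerXn2r ?nnegrE ?expR_ge0 ?mulr_ge0 ?(ltW b0)//.
rewrite (le_trans _ (expR_ge1Dx _))// -natr1 mulrDl mul1r addrC lerD//.
  by rewrite ge_min lexx.
by rewrite mulrC ler_wpM2r// ge_min lexx orbT.
Qed.

(* The method of types: a product of these factors, with the frequencies of the
   word itself as weights, is its likelihood under the best-fitting weights, and
   for fixed weights the likelihoods of all normalised words sum to at most 1. *)
Definition type_factor (n : nat) (w1 w2 : I -> R) (k : nat) (i : I) : R :=
  if (k < n)%N then w1 i / colw T w1 i * colw T w2 i
  else (col_rep T i == i)%:R * colw T w2 i.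

Lemma type_factor_ge0 n w1 w2 k i : (forall i, 0 <= w1 i) -> (forall i, 0 <= w2 i) ->
  0 <= type_factor n w1 w2 k i.
Proof.
move=> h1 h2; rewrite /type_factor; case: ifP => _; apply: mulr_ge0 => //;
by rewrite ?divr_ge0 ?colw_ge0.
Qed.

Lemma wsum_type_factor n w1 w2 m : (forall i, 0 <= w1 i) -> simplex w2 ->
  wsum i0 (fun=> 1) m (fun u => \prod_(k < m) type_factor n w1 w2 k (u k)) <= 1.
Proof.
move=> h1 [h2 s2]; rewrite (wsum_prod i0 (fun=> 1) m (type_factor n w1 w2)).
apply: Num.Theory.prodr_ile1 => k _; apply/andP; split.
  by apply: sumr_ge0 => i _; rewrite mul1r type_factor_ge0.
under eq_bigr do rewrite mul1r.
rewrite -[leRHS]s2 /type_factor; case: (k < n)%N; first exact: sum_cond_colw.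
by rewrite sum_colw_rep.
Qed.

Definition good_word q (P : R) m o : bool :=
  [&& (0 < vlen T o m)%N,
      cond_pressure T p q (frq R o (vlen T o m)) + col_pressure T p q (frq R o m) <= P &
      [forall k : 'I_m, (vlen T o m <= k)%N ==> (col_rep T (o k) == o k)]].

Lemma frq_gt0 o n k : (k < n)%N -> 0 < frq R o n (o k).
Proof.
move=> kn; rewrite divr_gt0 ?ltr0n ?(leq_ltn_trans _ kn)//.
rewrite /cnt (bigD1 (Ordinal kn))//= eqxx ltr_pwDl// sumr_ge0//.
Qed.

(** With the word's own frequencies as weights, the q-th power of the weight of its square is
    exactly exp (X2 U + X1 V) times the likelihood of the word; replacing X2 at time n by X1 at time
    m costs a constant because U is bounded. *)
Lemma good_word_value q t P Bd : 
  (forall w, simplex w -> `|cond_pressure T p q w| <= Bd) ->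
  exists2 C, 0 < C & forall m o, good_word q P m o ->
  sqw T p o m `^ q * bprod b1 o m `^ t <= C * expR (- (t - P) * X1 o m) *
    \prod_(k < m) type_factor (vlen T o m) (frq R o (vlen T o m)) (frq R o m) k (o k).
Proof.
move=> hBd; have [B B0 hB] := vlen_bsum hT.
exists (expR (B * Bd)); first exact: expR_gt0.
move=> m o /and3P[n0 hP /forallP hn].
have nm := vlen_le hT o m; have m0 := leq_trans n0 nm.
have /andP[X12 X21] := hB o m.
set n := vlen T o m in n0 hP hn nm X12 X21 *.
pose w1 := frq R o n; pose w2 := frq R o m.
have s1 : simplex w1 by exact: frq_simplex.
have s2 : simplex w2 by exact: frq_simplex.
have c1 k : (k < n)%N -> 0 < w1 (o k) / colw T w1 (o k).
  move=> kn; have h := frq_gt0 o kn; rewrite divr_gt0// (lt_le_trans h)//.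
  by apply: colw_gew; case: s1.
have c2 k : (k < m)%N -> 0 < colw T w2 (o k).
  move=> km; apply: lt_le_trans (frq_gt0 o km) _.
  by apply: colw_gew; case: s2.
have prodE : \prod_(k < m) type_factor n w1 w2 k (o k) =
    expR (bsum (cond_log T w1) o n + bsum (col_log T w2) o m).
  rewrite expRD /bsum !expR_sum.
  have -> : \prod_(k < n) expR (cond_log T w1 (o k)) =
      \prod_(k < m) (if (k < n)%N then w1 (o k) / colw T w1 (o k) else 1).
    rewrite -[in RHS](subnKC nm) big_split_ord /= [X in _ = _ * X]big1 ?mulr1.
      by apply: eq_bigr => k _; rewrite ltn_ord lnK// posrE c1.
    by move=> k _; rewrite ltnNge leq_addr.
  rewrite -big_split; apply: eq_bigr => k _ /=.
  rewrite /col_log lnK ?posrE ?c2// /type_factor; case: ltnP => // nk.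
  by have := hn k; rewrite nk /= => /eqP ->; rewrite eqxx.
have chi2 : 0 < mean w1 (lx2 T) by apply: mean_gt0 (lx2_gt0 hT); case: s1.
have chi1 : 0 < mean w2 (lx1 T) by apply: mean_gt0 (lx1_gt0 hT); case: s2.
have e1 : q * bsum (cond_log T p) o n =
    X2 o n * cond_pressure T p q w1 + bsum (cond_log T w1) o n.
  rewrite -!(mean_frq o _ n0) -/w1 /cond_pressure; field.
  by rewrite gt_eqF.
have e2 : q * bsum (col_log T p) o m =
    X1 o m * col_pressure T p q w2 + bsum (col_log T w2) o m.
  rewrite -!(mean_frq o _ m0) -/w2 /col_pressure; field.
  by rewrite gt_eqF.
rewrite -/w1 -/w2 prodE (sqw_expR hT)// bprod1_expR// -/n.
rewrite !powR_expR ?expR_gt0// !expRK -!expRD ler_expR.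
rewrite mulrDr e1 e2.
have hc : (X2 o n - X1 o m) * cond_pressure T p q w1 <= B * Bd.
  apply: (@le_trans _ _ ((X2 o n - X1 o m) * Bd)).
    by rewrite ler_wpM2l ?subr_ge0// (le_trans (ler_norm _))// hBd.
  rewrite ler_wpM2r ?lerBlDl// (le_trans _ (hBd _ s1))//.
have hx : X1 o m * (cond_pressure T p q w1 + col_pressure T p q w2) <= X1 o m * P.
  rewrite ler_wpM2l//; apply: sumr_ge0 => k _; exact/ltW/lx1_gt0.
move: hc hx; rewrite mulrBl !mulrDr; lra.
Qed.

Lemma cnt_nat o k i : cnt R o k i = (\sum_(l < k) (o l == i))%N%:R.
Proof. by rewrite natr_sum. Qed.

Lemma good_word_sum q t P Bd : P < t ->
  (forall w, simplex w -> `|cond_pressure T p q w| <= Bd) ->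
  exists2 C, 0 < C & forall m, wsum i0 (fun=> 1) m (fun o =>
    (good_word q P m o)%:R * (sqw T p o m `^ q * bprod b1 o m `^ t)) <=
    C * m.+1%:R ^- 2.
Proof.
move=> Pt hBd; have [C C0 hC] := good_word_value t P hBd.
have [m1 m10 hm1] := bsum_lx1_ge hT.
pose a := (t - P) * m1.
have a0 : 0 < a by rewrite mulr_gt0// subr_gt0.
(* A type is a value of [vlen] with two count vectors, at most (m + 1)^(1 + 2 #|I|) choices; the
   extra 2 leaves a factor summable over levels. *)
have [C' C'0 hC'] := expn_le_expR (1 + (#|I| + #|I|) + 2) a0.
exists (C * C'); first exact: mulr_gt0.
move=> m.
pose Z := ('I_m.+1 * ({ffun I -> 'I_m.+1} * {ffun I -> 'I_m.+1}))%type.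
pose wt (n : nat) (c : {ffun I -> 'I_m.+1}) i : R := (c i : nat)%:R / n%:R.
(* The counts at time m must give a probability vector; for those at time n nonnegativity suffices,
   by [sum_cond_colw]. *)
pose okZ (z : Z) := (0 < m)%N && ((\sum_i z.2.2 i)%N == m).
pose G (z : Z) (u : nat -> I) :=
  \prod_(k < m) type_factor z.1 (wt z.1 z.2.1) (wt m z.2.2) k (u k).
have G0 z u : 0 <= G z u.
  by apply: prodr_ge0 => k _; apply: type_factor_ge0 => i; rewrite divr_ge0.
apply: (@le_trans _ _ (wsum i0 (fun=> 1) m (fun u =>
    C * expR (- (a * m%:R)) * \sum_(z : Z | okZ z) G z u))).
  apply: ler_wsum => // u.
  have cz0 : 0 <= C * expR (- (a * m%:R)) by rewrite mulr_ge0 ?expR_ge0 ?ltW.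
  have [good|_] := boolP (good_word q P m u); last first.
    by rewrite mul0r mulr_ge0//; apply: sumr_ge0.
  rewrite mul1r; apply: le_trans (hC m u good) _.
  have [n0 _ _] := and3P good; have nm := vlen_le hT u m.
  have m0 := leq_trans n0 nm.
  set n := vlen T u m in n0 nm *.
  pose cN k i := (\sum_(l < k) (u l == i))%N.
  have cNle k i : (k <= m)%N -> (cN k i < m.+1)%N.
    move=> km; rewrite ltnS (leq_trans _ km)// -[X in (_ <= X)%N](card_ord k) -sum1_card.
    by apply: leq_sum => l _; exact: leq_b1.
  pose z : Z := (inord n, ([ffun i => inord (cN n i)], [ffun i => inord (cN m i)])).
  have w1E : wt z.1 z.2.1 = frq R u n.
    apply/funext => i; rewrite /wt /= ffunE !inordK ?cNle ?ltnS//.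
    by rewrite /frq cnt_nat.
  have w2E : wt m z.2.2 = frq R u m.
    by apply/funext => i; rewrite /wt /= ffunE inordK ?cNle// /frq cnt_nat.
  have okz : okZ z.
    rewrite /okZ m0 /=; apply/eqP.
    under eq_bigr do rewrite ffunE inordK ?cNle//.
    apply/eqP; rewrite -(eqr_nat R) natr_sum; under eq_bigr do rewrite -cnt_nat.
    by rewrite sum_cnt.
  apply: ler_pM.
  - by rewrite mulr_ge0 ?expR_ge0 ?ltW.
  - apply: prodr_ge0 => k _; apply: type_factor_ge0 => i;
    by rewrite divr_ge0 ?cnt_ge0.
  - rewrite ler_wpM2l ?(ltW C0)// ler_expR mulNr lerN2 /a -mulrA ler_wpM2l//.
    by rewrite subr_ge0 ltW.
  rewrite (bigD1 z okz)/= /G w1E w2E /= inordK ?ltnS// lerDl.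
  by apply: sumr_ge0 => z' _; exact: G0.
rewrite wsumZ wsum_sum.
apply: (@le_trans _ _ (C * expR (- (a * m%:R)) * m.+1%:R ^+ (1 + (#|I| + #|I|)))).
  rewrite ler_wpM2l ?mulr_ge0 ?expR_ge0 ?(ltW C0)//.
  apply: (@le_trans _ _ (\sum_(z : Z) 1)).
    rewrite [leLHS]big_mkcond /=; apply: ler_sum => z _; case: ifPn => [/andP[m0 /eqP hz]|_//].
    apply: wsum_type_factor; first by move=> i; rewrite divr_ge0.
    split; first by move=> i; rewrite divr_ge0.
    rewrite /wt -mulr_suml -natr_sum hz mulfV// pnatr_eq0 -lt0n//.
  rewrite sumr_const !card_prod !card_ffun !card_ord !natrM !natrX.
  by rewrite !exprD expr1.
set K := (1 + _)%N; set E := expR _.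
have E0 : 0 < E by exact: expR_gt0.
have S0 : m.+1%:R != 0 :> R by rewrite pnatr_eq0.
have -> : C * E * m.+1%:R ^+ K = m.+1%:R ^+ (K + 2) * (m.+1%:R ^- 2 * (C * E)).
  by rewrite exprD; move: S0; set S := m.+1%:R => S0; field.
have hpos : 0 <= m.+1%:R ^- 2 * (C * E).
  by rewrite mulr_ge0 ?mulr_ge0 ?(ltW C0) ?(ltW E0)// invr_ge0 exprn_ge0.
apply: le_trans (ler_wpM2r hpos (hC' m)) _.
have -> : expR (a * m%:R) = E^-1 by rewrite /E expRN invrK.
rewrite le_eqVlt; apply/orP; left; apply/eqP.
by move: S0; set S := m.+1%:R => S0; field; rewrite ?S0 ?gt_eqF.
Qed.

End level_sums.

(** * Covers by balls around approximate squares *)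

Section fine_measure_bound.
Variables (R : realType) (I : finType) (i0 : I) (T : diag_ifs R I).
Variables (L : set (R * R)) (p : I -> R).
Variable mu : probability (measurableTypeR R * measurableTypeR R)%type R.
Hypothesis hT : gatzouras_lalley T.
Hypothesis hL : is_attractor T L.
Hypothesis hsep : separation_of_principal_projections T L.
Hypothesis hp : probability_vector p.
Hypothesis hp_pos : forall i, 0 < p i.
Hypothesis hmu : self_similar T p mu.
Local Notation M := (mass mu).
Local Notation b1 := (contr1 T).
Local Notation X1 := (bsum (lx1 T)).
Local Notation X2 := (bsum (lx2 T)).
Implicit Types (o : nat -> I) (w : I -> R).

Lemma bsum_lip (g : I -> R) G o j k : (forall i, `|g i| <= G) -> (j <= k)%N ->
  `|bsum g o k - bsum g o j| <= (k - j)%:R * G.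
Proof.
move=> hG /subnKC <-; rewrite addKn; elim: (k - j)%N => [|n IH].
  by rewrite addn0 subrr normr0 mul0r.
rewrite addnS bsumS addrAC (le_trans (ler_normD _ _))//.
by rewrite -natr1 mulrDl mul1r lerD.
Qed.

Lemma vlen_mono o m m' : (m' <= m)%N -> (vlen T o m' <= vlen T o m)%N.
Proof.
move=> mm; have [_ h _] := vlenP hT o m; have [_ _ h'] := vlenP hT o m'.
rewrite leqNgt; apply/negP => /h'; rewrite ltNge => /negP; apply.
exact: le_trans h (bprod_dec (gl_contr1 hT) o mm).
Qed.

(** Going back [h] letters makes [ball_upper] applicable to this larger ball. Then [vlen] changes by
    at most [d], so the weights of the two squares are comparable; levels below [h] are covered by
    the same constant. *)
Lemma ball_doubling : exists2 K, 0 < K & forall o x m, coded T o x ->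
  M (cball x (2 * bprod b1 o m)) <= K * sqw T p o m.
Proof.
have [c c0 hc] := ball_upper i0 hT hp hmu hL hsep.
have c2 : 0 < c / 2 by rewrite divr_gt0.
have [h hh] := bprod_small (gl_contr1 hT) c2.
have [B B0 hB] := vlen_bsum hT.
have [x2 x20 hx2] := fin_pos_lb (lx2_gt0 hT); have [x1 x10 hx1] := fin_ub (lx1 T).
have [Ga Ga0 hGa] := fin_ub (fun i => `|cond_log T p i|).
have [Gc Gc0 hGc] := fin_ub (fun i => `|col_log T p i|).
pose d := (B + h%:R * x1) / x2.
have d0 : 0 <= d by rewrite divr_ge0 ?(ltW x20)// addr_ge0 ?(ltW B0)// mulr_ge0 ?(ltW x10).
exists (expR ((d + h%:R) * Ga + h%:R * Gc)) => [|o x m ox]; first exact: expR_gt0.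
have [mh|hm] := ltnP m h.
  apply: le_trans (mass_le1 mu (measurable_cball _ _)) _.
  rewrite (sqw_expR hT)// -expRD -[leLHS]expR0 ler_expR.
  have := bsum_lip o hGa (leq0n (vlen T o m)); have := bsum_lip o hGc (leq0n m).
  rewrite ![bsum _ _ 0]big_ord0 !subr0 !subn0 !ler_norml => /andP[h1 _] /andP[h2 _].
  have nm : (vlen T o m)%:R <= h%:R :> R by rewrite ler_nat (leq_trans (vlen_le hT o m))// ltnW.
  have mh' : m%:R <= h%:R :> R by rewrite ler_nat ltnW.
  have := ler_wpM2r (ltW Ga0) nm; have := ler_wpM2r (ltW Gc0) mh'.
  have : 0 <= d * Ga by rewrite mulr_ge0// ltW.
  rewrite mulrDl; lra.
pose m' := (m - h)%N; have mm : (m' <= m)%N by exact: leq_subr.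
have hmm : (m - m')%N = h by rewrite subKn.
apply: (@le_trans _ _ (sqw T p o m')).
  apply: le_trans (hc o x m' ox); apply: mass_le; try exact: measurable_cball.
  move=> y /le_trans; apply.
  rewrite -(subnK hm) -/m' bprodD mulrCA [leRHS]mulrC; apply: ler_wpM2l.
    exact/ltW/bprod_gt0/gl_contr1.
  by rewrite mulrC -ler_pdivlMr//; exact: hh.
rewrite !(sqw_expR hT)// -expRD ler_expR.
have nn := vlen_mono o mm; set n := vlen T o m in nn *; set n' := vlen T o m' in nn *.
have h1 := bsum_lip o hGa nn; have h2 := bsum_lip o hGc mm.
rewrite hmm in h2.
have dn : (n - n')%:R <= d.
  rewrite /d ler_pdivlMr//.
  have /andP[_ u1] := hB o m; have /andP[u2 _] := hB o m'.
  have : X1 o m - X1 o m' <= h%:R * x1.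
    rewrite -hmm -{1}(subnKC mm); elim: (m - m')%N => [|j IH].
      by rewrite addn0 subrr mul0r.
    by rewrite addnS bsumS addrAC -natr1 mulrDl mul1r lerD.
  have : (n - n')%:R * x2 <= X2 o n - X2 o n'.
    rewrite -{2}(subnKC nn); elim: (n - n')%N => [|j IH].
      by rewrite addn0 subrr mul0r.
    by rewrite addnS bsumS addrAC -natr1 mulrDl mul1r lerD.
  rewrite -/n in u1; rewrite -/n' in u2; lra.
have := ler_wpM2r (ltW Ga0) dn.
move: h1 h2; rewrite !ler_norml => /andP[h1 _] /andP[h2 _].
have : 0 <= h%:R * Ga by rewrite mulr_ge0// ltW.
rewrite mulrDl; lra.
Qed.

(** For q >= 0 this needs the upper bound on the mass of the ball, for q < 0 the lower one. *)
Lemma ball_mass_pow q : exists2 K, 0 < K & forall o x m, coded T o x ->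
  M (cball x (2 * bprod b1 o m)) `^ q <= K * sqw T p o m `^ q.
Proof.
have [K K0 hK] := ball_doubling.
have s0 o m : 0 < sqw T p o m by exact: sqw_gt0.
have [q0|q0] := lerP 0 q.
  exists (K `^ q) => [|o x m ox]; first by rewrite powR_gt0.
  rewrite -powRM ?(ltW K0) ?(ltW (s0 _ _))//; apply: ge0_ler_powR => //.
  - by rewrite nnegrE mass_ge0.
  - by rewrite nnegrE mulr_ge0// ltW.
  - exact: hK.
exists 1 => // o x m ox; rewrite mul1r.
have h := ball_lower i0 hT hp hmu m ox.
have M0 := lt_le_trans (s0 o m) h.
rewrite !powR_expR// ler_expR ler_wnM2l ?(ltW q0)//.
by rewrite ler_ln ?posrE.
Qed.

Lemma good_word_norm q P o m u : (0 < vlen T o m)%N ->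
  cond_pressure T p q (frq R o (vlen T o m)) + col_pressure T p q (frq R o m) <= P ->
  (forall k, (k < m)%N -> u k = norm_word T o m k) ->
  insq T o m u /\ good_word T p q P m u.
Proof.
move=> n0 hP hu; have nm := vlen_le hT o m.
have ins : insq T o m u.
  have /insqP[h1 h2] := insq_norm T o m; apply/insqP; split=> k km.
    by rewrite hu ?h1// (leq_trans km).
  by rewrite hu// h2.
split=> //; have /insqP[h1 h2] := ins; have e := insq_vlen hT ins.
rewrite /good_word e n0 /=; apply/andP; split.
  rewrite (_ : frq R u (vlen T o m) = frq R o (vlen T o m)).
    by rewrite -(@col_pressure_frq _ _ T p q o u m) ?(leq_trans n0).
  by apply/funext => i; rewrite /frq (eq_cnt R (fun l lm => esym (h1 l lm))).
apply/forallP => k; apply/implyP => nk; rewrite hu ?ltn_ord// /norm_word ltnNge nk /=.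
by rewrite -(col_rep_eq (col_repP T (o k))).
Qed.

Lemma ler_sum_subset (U : eqType) (s1 s2 : seq U) (b : U -> R) :
  uniq s1 -> {subset s1 <= s2} -> (forall u, 0 <= b u) ->
  \sum_(u <- s1) b u <= \sum_(u <- s2) b u.
Proof.
move=> + + b0; elim: s1 s2 => [|x s1 IH] s2 /=.
  by rewrite big_nil sumr_ge0.
move=> /andP[xs us] sub; rewrite big_cons.
have xs2 : x \in s2 by apply: sub; rewrite mem_head.
rewrite (perm_big _ (perm_to_rem xs2)) big_cons lerD2l; apply: IH => // y ys.
apply: rem_mem; last by rewrite sub// in_cons ys orbT.
by apply/eqP => e; move: xs; rewrite -e ys.
Qed.

(** Distinct words are grouped by length, and the sum of (m + 1)^-2 over m >= 1 is at most 1. *)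
Lemma sum_words_le (F : nat -> (nat -> I) -> R) C (s : seq (seq I)) :
  (forall m o, 0 <= F m o) -> 0 <= C ->
  (forall m, wsum i0 (fun=> 1) m (F m) <= C * m.+1%:R ^- 2) ->
  uniq s -> (forall u, u \in s -> (0 < size u)%N) ->
  \sum_(u <- s) F (size u) (nth i0 u) <= C.
Proof.
move=> F0 C0 hF us s0.
pose N := (\max_(u <- s) size u).+1.
have sN u : u \in s -> (size u < N)%N.
  by move=> us'; rewrite ltnS; apply: (@leq_bigmax_seq _ s xpredT size).
apply: (@le_trans _ _ (\sum_(1 <= m < 1 + N) wsum i0 (fun=> 1) m (F m))); last first.
  apply: (@le_trans _ _ (\sum_(1 <= m < 1 + N) C * m.+1%:R ^- 2)).
    by apply: ler_sum => m _; exact: hF.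
  rewrite -mulr_sumr -[leRHS]mulr1 ler_wpM2l//.
  apply: le_trans (@sum_inv_sqr R 1 N isT) _.
  by rewrite invr1 lerBlDr lerDl.
pose s2 := flatten [seq [seq val t | t : m.-tuple I] | m <- index_iota 1 (1 + N)].
apply: (@le_trans _ _ (\sum_(u <- s2) F (size u) (nth i0 u))).
  apply: ler_sum_subset => // u us'.
  apply/flatten_mapP; exists (size u).
    by rewrite mem_index_iota s0//= add1n ltnW// ltnS sN.
  by apply/mapP; exists (in_tuple u); rewrite ?mem_enum.
rewrite /s2 big_flatten big_map le_eqVlt; apply/orP; left; apply/eqP.
apply: eq_bigr => m _; rewrite wsum_tuple big_image /=.
by apply: eq_bigr => t _; rewrite size_tuple.
Qed.

Lemma fine_measure_finite q P Bd t : P < t ->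
  (forall w, simplex w -> `|cond_pressure T p q w| <= Bd) ->
  (forall w, simplex w -> cond_pressure T p q w + col_pressure T p q w <= P) ->
  (fine_measure mu q t (supp mu) < +oo)%E.
Proof.
move=> Pt hBd hP.
pose eps := (t - P) / 2.
have eps0 : 0 < eps by rewrite divr_gt0// subr_gt0.
have Pet : P + eps < t by rewrite /eps; lra.
have [C C0 hC] := good_word_sum i0 hT hp_pos Pet hBd.
have [K K0 hK] := ball_mass_pow q.
pose H := K * 2 `^ t * C.
suff : (fine_measure mu q t (supp mu) <= H%:E)%E by move=> /le_lt_trans; apply; rewrite ltry.
apply: ge_ereal_sup => _ [F [delta [Fs d0 ->]]].
have d2 : 0 < delta / 2 by rewrite divr_gt0.
have [M0 hM0] := bprod_small (gl_contr1 hT) d2.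
pose cand (u : seq I) (z : (nat -> I) * (R * R)) :=
  [/\ F z.2, coded T z.1 z.2, (maxn 1 M0 <= size u)%N,
   (forall k, (k < size u)%N -> nth i0 u k = norm_word T z.1 (size u) k) &
     insq T z.1 (size u) (nth i0 u) /\ good_word T p q (P + eps) (size u) (nth i0 u)].
have /choice[z hz] : forall u, exists z, (exists z', cand u z') -> cand u z.
  move=> u; have [[z hz]|nz] := pselect (exists z', cand u z'); first by exists z.
  by exists (fun=> i0, (0, 0)).
(* Indices are codes of normalised words: one ball per square, centred at a point of [F] in it,
   however many points select that square. *)
pose D := [set k | exists u : seq I, k = pickle u /\ exists z', cand u z'].
pose wd k : seq I := odflt [::] (unpickle k).
have wdD k : D k -> cand (wd k) (z (wd k)).
  by move=> [u [-> cu]]; rewrite /wd pickleK; exact: hz.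
pose x k := (z (wd k)).2.
pose r k := 2 * bprod b1 (z (wd k)).1 (size (wd k)).
have r0 k : 0 < r k by rewrite mulr_gt0// bprod_gt0// => i; case: hT.
apply: (@le_trans _ _ (\esum_(k in D)
    ((M (cball (x k) (r k)) `^ q * r k `^ t)%:E))%E).
  apply: ereal_inf_lbound; exists D, x, r; split => //.
  - by move=> k /wdD[].
  - move=> k /wdD[_ _ sz _ _]; rewrite r0 /= /r mulrC -ler_pdivlMr//.
    by apply: hM0; move: sz; rewrite geq_max => /andP[].
  move=> y Fy; have [om oy] := supp_coded i0 hT hp hmu (Fs y Fy).
  have [m mM [n0 hm]] := pressure_descent hT om (maxn 1 M0) eps0 hBd.
  have m0 : (0 < m)%N by apply: leq_trans mM; rewrite leq_max.
  (* The descent replaces the frequencies at time n by those at time m in U, up to [eps]; then U + V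
     is taken at a single vector. *)
  have hPm : cond_pressure T p q (frq R om (vlen T om m)) +
      col_pressure T p q (frq R om m) <= P + eps.
    by have := hP _ (frq_simplex R om m0); lra.
  pose u := mkseq (norm_word T om m) m.
  have su : size u = m by rewrite size_mkseq.
  have uE k : (k < m)%N -> nth i0 u k = norm_word T om m k.
    by move=> km; rewrite nth_mkseq.
  have [iu gu] := good_word_norm n0 hPm uE.
  have cu : exists z', cand u z' by exists (om, y); split; rewrite ?su.
  exists (pickle u); first by exists u.
  have wu : wd (pickle u) = u by rewrite /wd pickleK.
  rewrite /x /r wu; have [_ cz _ hzu _] := hz u cu.
  rewrite su in hzu *; apply: (insq_dist hT cz _ (oy m).1 (oy m).2).
  by apply: (eq_norm_insq hT) => k km; rewrite -hzu// uE.
apply: ge_ereal_sup => _ [A [finA AD] <-].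
rewrite fsbig_finite//= sumEFin lee_fin.
pose G m o := (good_word T p q (P + eps) m o)%:R * (sqw T p o m `^ q * bprod b1 o m `^ t).
have G0 m o : 0 <= G m o by rewrite mulr_ge0// mulr_ge0 ?powR_ge0.
have AinD k : k \in finmap.enum_fset (fset_set A) -> D k.
  by move=> kA; apply: AD; rewrite -in_setE -in_fset_set.
apply: (@le_trans _ _ (\sum_(k <- finmap.enum_fset (fset_set A)) K * 2 `^ t * G (size (wd k)) (nth i0 (wd k)))).
  rewrite big_seq [leRHS]big_seq; apply: ler_sum => k /AinD /wdD[_ cz _ _ [iz gz]].
  rewrite /G gz mul1r /r (insq_sqw hT p iz) (insq_bprod iz).
  rewrite powRM ?(ltW (bprod_gt0 _ _ _))//; last by move=> i; case: hT.
  rewrite [leRHS](_ : _ = (K * sqw T p (z (wd k)).1 (size (wd k)) `^ q) *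
    (2 `^ t * bprod b1 (z (wd k)).1 (size (wd k)) `^ t)); last by ring.
  by rewrite ler_wpM2r ?mulr_ge0 ?powR_ge0// hK.
rewrite -mulr_sumr ler_wpM2l ?mulr_ge0 ?powR_ge0 ?(ltW K0)//.
rewrite -(big_map wd xpredT (fun u => G (size u) (nth i0 u))).
apply: sum_words_le (ltW C0) hC _ _ => //.
  rewrite map_inj_in_uniq ?finmap.fset_uniq// => k k' /AinD[u [ku _]] /AinD[u' [ku' _]].
  by rewrite ku ku' /wd !pickleK /= => ->.
move=> u /mapP[k /AinD/wdD[_ _ sz _ _] ->].
by move: sz; rewrite geq_max => /andP[].
Qed.

End fine_measure_bound.

(** * Maximising the pressure *)

Section entropy.
Variable R : realType.

Definition xlnx (x : R) := x * ln x.

(** With s = sqrt x this is ln (1 / s) <= 1 / s - 1; it gives continuity of x ln x at 0. *)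
Lemma xlnx_bound (x : R) : 0 < x -> x < 1 -> `|xlnx x| <= 2 * Num.sqrt x.
Proof.
move=> x0 x1; have lx : ln x < 0 by rewrite ln_lt0// x0.
set s := Num.sqrt x; have s0 : 0 < s by rewrite sqrtr_gt0.
have xE : x = s ^+ 2 by rewrite sqr_sqrtr// ltW.
rewrite /xlnx normrM gtr0_norm// ltr0_norm//.
have lE : - ln x = 2 * ln s^-1 by rewrite lnV ?posrE// xE lnXn// mulrN mulr_natl.
have : ln s^-1 <= s^-1 - 1.
  have := @expR_ge1Dx R (ln s^-1); rewrite lnK ?posrE ?invr_gt0//; lra.
have : s * s^-1 = 1 by rewrite divff// gt_eqF.
have sv0 : 0 < s^-1 by rewrite invr_gt0.
rewrite lE {1}xE expr2 => h1 h2.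
have : s * ln s^-1 <= 1 by have := ler_wpM2l (ltW s0) h2; rewrite mulrBr mulr1 h1; lra.
by move=> h3; rewrite -mulrA mulrCA mulrA mulrC; nra.
Qed.

Lemma continuous_xlnx (x : R) : 0 <= x -> {for x, continuous xlnx}.
Proof.
rewrite le_eqVlt => /orP[/eqP <-|x0]; last first.
  by apply: cvgM; [exact: cvg_id | exact: continuous_ln].
apply/cvgrPdist_lt => e e0.
pose d := Num.min 1 ((e / 2) ^+ 2).
have d0 : 0 < d by rewrite lt_min ltr01 exprn_gt0// divr_gt0.
exists d => //= y; rewrite /ball_/= [xlnx 0]mul0r !sub0r !normrN => yd.
have [y0|y0] := lerP y 0; first by rewrite /xlnx ln0// mulr0 normr0.
rewrite gtr0_norm// in yd.
apply: le_lt_trans (xlnx_bound y0 (lt_le_trans yd _)) _; first by rewrite ge_min lexx.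
rewrite mulrC -ltr_pdivlMr//.
have : y < (e / 2) ^+ 2 by apply: lt_le_trans yd _; rewrite ge_min lexx orbT.
by rewrite -ltr_sqrt ?exprn_gt0 ?divr_gt0// sqrtr_sqr gtr0_norm// divr_gt0.
Qed.

End entropy.

Lemma continuous_at_sum (R : realType) (X : topologicalType) (J : finType)
    (P : pred J) (f : J -> X -> R) (x : X) :
  (forall j, {for x, continuous (f j)}) ->
  {for x, continuous (fun y => \sum_(j | P j) f j y)}.
Proof. by move=> h; apply: (cvg_big add_continuous) => j _; exact: h. Qed.

Lemma continuous_at_norm (R : realType) (X : topologicalType) (f : X -> R) (x : X) :
  {for x, continuous f} -> {for x, continuous (fun y => `|f y|)}.
Proof. exact: cvg_norm. Qed.

Section pressure_maximum.
Variables (R : realType) (I : finType) (T : diag_ifs R I) (p : I -> R).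
Hypothesis hT : gatzouras_lalley T.
Implicit Types w g : I -> R.

Definition col_size (i : I) : R := \sum_(j | same_col T i j) 1.

(** Minus the entropy of the column weights. Summing over letters and dividing by the column size
    counts each column once; through [xlnx] continuity at vanishing weights is visible. *)
Definition col_entropy w := \sum_i (col_size i)^-1 * xlnx (colw T w i).

Lemma mean_col_log w : simplex w -> mean w (col_log T w) = col_entropy w.
Proof.
move=> [w0 _]; rewrite /col_entropy /xlnx.
rewrite (eq_bigr (fun i => \sum_(j | same_col T i j) (col_size i)^-1 * (w j * ln (colw T w i)))).
  rewrite (exchange_big_dep predT)//=; apply: eq_bigr => j _.
  rewrite (eq_bigr (fun i => 1 * ((col_size j)^-1 * (w j * ln (colw T w j))))).
    rewrite -mulr_suml (eq_bigl (same_col T j)); last by move=> i; rewrite same_colC.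
    rewrite -/(col_size j) mulrA mulfV ?mul1r//.
    by rewrite /col_size (bigD1 j) ?same_col_refl//= gt_eqF// ltr_pwDl// sumr_ge0.
  move=> i ij; rewrite mul1r (eq_colw w ij); congr (_^-1 * _).
  by apply: eq_bigl => k; rewrite (same_col_left ij).
by move=> i _; rewrite -mulr_sumr -mulr_suml.
Qed.

Lemma mean_cond_log w : simplex w ->
  mean w (cond_log T w) = \sum_i xlnx (w i) - col_entropy w.
Proof.
move=> sw; rewrite -mean_col_log// /mean -sumrB; apply: eq_bigr => i _.
have [w0 _] := sw; have := w0 i; rewrite le_eqVlt => /orP[/eqP <-|wi].
  by rewrite /xlnx !mul0r subrr.
have ci : 0 < colw T w i by apply: lt_le_trans wi (colw_gew T i w0).
by rewrite /cond_log /col_log ln_div ?posrE// mulrBr.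
Qed.

Section continuity.
Variables (X : topologicalType) (W : X -> I -> R).
Hypothesis cW : forall i x, {for x, continuous (fun y => W y i)}.

Lemma continuous_mean g (v : X) : {for v, continuous (fun u => mean (W u) g)}.
Proof.
apply: continuous_at_sum => i; apply: cvgM; last exact: cvg_cst.
exact: cW.
Qed.

Lemma continuous_col_entropy (v : X) : simplex (W v) ->
  {for v, continuous (fun u => col_entropy (W u))}.
Proof.
move=> [w0 _]; apply: continuous_at_sum => i; apply: cvgM; first exact: cvg_cst.
apply: (@continuous_comp _ _ _ (fun u => colw T (W u) i) (@xlnx R)).
  by apply: continuous_at_sum => j; exact: cW.
exact/continuous_xlnx/colw_ge0.
Qed.

Lemma continuous_entropy (v : X) : simplex (W v) ->
  {for v, continuous (fun u => \sum_i xlnx (W u i))}.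
Proof.
move=> [w0 _]; apply: continuous_at_sum => i.
apply: (@continuous_comp _ _ _ (fun u => W u i) (@xlnx R)).
  exact: cW.
exact: continuous_xlnx.
Qed.

(** Agrees with [cond_pressure] on the simplex, but has no logarithm of a quotient that could
    vanish. The parametrisation [W] is later by row vectors, where the simplex is compact. *)
Definition cond_cont q (v : X) := (q * mean (W v) (cond_log T p) -
  (\sum_i xlnx (W v i) - col_entropy (W v))) / mean (W v) (lx2 T).
Definition col_cont q (v : X) := (q * mean (W v) (col_log T p) - col_entropy (W v)) /
  mean (W v) (lx1 T).

Lemma continuous_cond q v : simplex (W v) -> {for v, continuous (cond_cont q)}.
Proof.
move=> Sv; have [w0 w1] := Sv; apply: cvgM.
  apply: cvgB; first by apply: cvgM; [exact: cvg_cst | exact: continuous_mean].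
  by apply: cvgB; [exact: continuous_entropy | exact: continuous_col_entropy].
by apply: cvgV; [rewrite gt_eqF// mean_gt0//; exact: lx2_gt0 | exact: continuous_mean].
Qed.

Lemma continuous_col q v : simplex (W v) -> {for v, continuous (col_cont q)}.
Proof.
move=> Sv; have [w0 w1] := Sv; apply: cvgM.
  apply: cvgB; first by apply: cvgM; [exact: cvg_cst | exact: continuous_mean].
  exact: continuous_col_entropy.
by apply: cvgV; [rewrite gt_eqF// mean_gt0//; exact: lx1_gt0 | exact: continuous_mean].
Qed.

End continuity.

Let V := 'rV[R]_#|I|.
Let wv (v : V) : I -> R := fun i => v ord0 (enum_rank i).

Lemma continuous_wv i (v : V) : {for v, continuous (fun u => wv u i)}.
Proof. exact: coord_continuous. Qed.

Let S : set V := [set v | simplex (wv v)].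

Lemma compact_simplex : compact S.
Proof.
have -> : S = [set v : V | forall i, `[0, 1]%classic (v ord0 i)] `&`
    (fun v : V => \sum_i wv v i) @^-1` [set 1].
  apply/seteqP; split=> v.
    move=> [v0 v1]; split=> //= i; rewrite in_itv /= -(enum_valK i) v0 /=.
    by rewrite -v1 (bigD1 (enum_val i))//= lerDl sumr_ge0.
  move=> [/= h h1]; split=> // i; have := h (enum_rank i).
  by rewrite in_itv => /andP[].
apply: compact_closedI.
  exact: (@rV_compact _ _ (fun=> `[0, 1]%classic : set R) (fun=> @segment_compact R 0 1)).
have cs : continuous (fun v : V => \sum_i wv v i).
  by move=> v; apply: continuous_at_sum => i; exact: continuous_wv.
by apply: (closed_comp (fun v _ => cs v)); exact: closed_eq.
Qed.

Lemma simplex_nonempty : S !=set0.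
Proof.
have I0 : (0 < #|I|)%N by apply: leq_trans (gl_card hT).
exists (const_mx (#|I|%:R^-1)); split=> [i|].
  by rewrite /wv mxE invr_ge0.
rewrite (eq_bigr (fun=> #|I|%:R^-1)) => [|i _]; last by rewrite /wv mxE.
by rewrite sumr_const -[LHS]mulr_natl mulfV// pnatr_eq0 -lt0n.
Qed.

Lemma wv_surj w : exists v, wv v = w.
Proof.
exists (\row_k w (enum_val k)); apply/funext => i.
by rewrite /wv mxE enum_rankK.
Qed.

Let FE q v : S v -> cond_pressure T p q (wv v) = cond_cont wv q v.
Proof. by move=> Sv; rewrite /cond_pressure mean_cond_log. Qed.

Let GE q v : S v -> col_pressure T p q (wv v) = col_cont wv q v.
Proof. by move=> Sv; rewrite /col_pressure mean_col_log. Qed.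

Lemma cond_pressure_bounded q : exists Bd, forall w, simplex w ->
  `|cond_pressure T p q w| <= Bd.
Proof.
have cF' : {within S, continuous (fun v => `|cond_cont wv q v|)}.
  apply: continuous_in_subspaceT => v; rewrite inE => Sv.
  exact: (continuous_at_norm (continuous_cond continuous_wv Sv)).
have [c _ hc] := compact_EVT_max simplex_nonempty compact_simplex cF'.
exists `|cond_cont wv q c| => w sw; have [v e] := wv_surj w.
have Sv : S v by rewrite /S /= e.
by rewrite -e FE//; apply: hc; rewrite inE.
Qed.

Lemma pressure_max q : exists2 w, simplex w & forall w', simplex w' ->
  cond_pressure T p q w' + col_pressure T p q w' <=
  cond_pressure T p q w + col_pressure T p q w.
Proof.
have cFG : {within S, continuous (fun v => cond_cont wv q v + col_cont wv q v)}.
  apply: continuous_in_subspaceT => v; rewrite inE => Sv.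
  exact: (continuousD (continuous_cond continuous_wv Sv)
    (continuous_col continuous_wv Sv)).
have [c cS hc] := compact_EVT_max simplex_nonempty compact_simplex cFG.
rewrite inE in cS; exists (wv c) => // w' sw'; have [v e] := wv_surj w'.
have Sv : S v by rewrite /S /= e.
by rewrite -e !FE// !GE//; apply: hc; rewrite inE.
Qed.

End pressure_maximum.

Section touching.
Variable R : realType.

(** Below the touching line, difference quotients are at most [a] on the right and at least [a] on
    the left. *)
Lemma derive_touching (g : R -> R) (q a d : R) : derivable g q 1 ->
  (forall u, g u <= u * a - d) -> g q = q * a - d -> derive1 g q = a.
Proof.
move=> dg ub eq; rewrite derive1E.
have /cvgrPdist_lt lim : h^-1 *: (g (h *: 1 + q) - g q) @[h --> 0^'] --> 'D_1 g q by [].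
have [//|Da] := eqVneq ('D_1 g q) a.
have e0 : 0 < `|'D_1 g q - a| by rewrite normr_gt0 subr_eq0.
have [dl /= dl0 hdl] := lim _ e0.
have quot h : h != 0 -> `|h| < dl ->
    `|'D_1 g q - h^-1 * (g (h + q) - g q)| < `|'D_1 g q - a|.
  move=> h0 hd; have := hdl h; rewrite /ball_/= sub0r normrN => /(_ hd h0).
  by rewrite [h *: 1]mulr1.
have inc h : g (h + q) - g q <= h * a.
  by rewrite eq; have := ub (h + q); rewrite mulrDl; lra.
have d2 : 0 < dl / 2 by rewrite divr_gt0.
have d2' : dl / 2 < dl by lra.
have [aD|Da'] := ltP a ('D_1 g q).
  have h1 : (dl / 2)^-1 * (g (dl / 2 + q) - g q) <= a by rewrite ler_pdivrMl.
  have := quot (dl / 2) (lt0r_neq0 d2).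
  rewrite gtr0_norm// => /(_ d2').
  rewrite [`|'D_1 g q - a|]ger0_norm ?subr_ge0 ?(ltW aD)// ltr_norml => /andP[_]; lra.
have h1 : a <= (- (dl / 2))^-1 * (g (- (dl / 2) + q) - g q).
  rewrite invrN mulNr lerNr ler_pdivrMl// mulrN -mulNr; exact: inc.
have := quot (- (dl / 2)).
rewrite oppr_eq0 (gt_eqF d2) normrN gtr0_norm// => /(_ isT d2').
rewrite [`|'D_1 g q - a|]ler0_norm ?subr_le0// ltr_norml => /andP[]; lra.
Qed.

End touching.

(** * The fine spectrum as an attained minimum *)

Section fine_spectrum.
Variables (R : realType) (I : finType) (i0 : I) (T : diag_ifs R I).
Variables (L : set (R * R)) (p : I -> R).
Variable mu : probability (measurableTypeR R * measurableTypeR R)%type R.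
Hypothesis hT : gatzouras_lalley T.
Hypothesis hL : is_attractor T L.
Hypothesis hsep : separation_of_principal_projections T L.
Hypothesis hp : probability_vector p.
Hypothesis hp_pos : forall i, 0 < p i.
Hypothesis hmu : self_similar T p mu.

(** The dimension is squeezed: D(w) <= f(alpha(w)) <= q alpha(w) + t. *)
Lemma fine_measure_finite_ge q t w : simplex w ->
  (fine_measure mu q t (supp mu) < +oo)%E -> ly_dim T w - q * ly_loc T p w <= t.
Proof.
move=> [w0 w1] fin.
have := le_trans (spectrum_ge i0 hT hL hsep hp hp_pos hmu w0 w1) (olsen_upper _ fin).
by rewrite lee_fin lerBlDl.
Qed.

(** The value is finite, so [fine] in the derivative loses nothing. Finiteness of the measures is
    recorded because Olsen's inequality takes it as input. *)
Lemma fine_Lq_spectrumE q : exists2 w, simplex w &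
  fine_Lq_spectrum mu q = (q * ly_loc T p w - ly_dim T w)%:E /\
  forall t, ly_dim T w - q * ly_loc T p w < t ->
    (fine_measure mu q t (supp mu) < +oo)%E.
Proof.
have [w sw hw] := pressure_max p hT q.
have [Bd hBd] := cond_pressure_bounded p hT q.
have fin t : ly_dim T w - q * ly_loc T p w < t ->
    (fine_measure mu q t (supp mu) < +oo)%E.
  rewrite -pressure_dim => ht.
  exact: (fine_measure_finite i0 hT hL hsep hp hp_pos hmu ht hBd hw).
exists w => //; split=> //; rewrite /fine_Lq_spectrum -opprB EFinN; congr (- _)%E.
apply/eqP; rewrite eq_le; apply/andP; split.
  apply/lee_addgt0Pr => e e0; rewrite -EFinD; apply: ereal_inf_lbound.
  by exists (ly_dim T w - q * ly_loc T p w + e) => //=; apply: fin; rewrite ltrDl.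
apply: le_ereal_inf_tmp => _ [t ht <-]; rewrite lee_fin.
exact: fine_measure_finite_ge ht.
Qed.

Lemma fine_Lq_spectrum_le q w : simplex w ->
  fine (fine_Lq_spectrum mu q) <= q * ly_loc T p w - ly_dim T w.
Proof.
move=> sw; have [w' _ [-> fin]] := fine_Lq_spectrumE q.
rewrite /= -[leRHS]opprB lerNr opprB; apply/ler_addgt0Pr => e e0.
apply: (fine_measure_finite_ge sw); apply: fin; by rewrite ltrDl.
Qed.

End fine_spectrum.

Theorem corollaryB (R : realType) (I : finType) (T : diag_ifs R I)
    (L : set (R * R)) (p : I -> R)
    (mu : probability (measurableTypeR R * measurableTypeR R)%type R)
    (hT : gatzouras_lalley T)
    (hL : is_attractor T L)
    (hsep : separation_of_principal_projections T L)
    (hp : probability_vector p)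
    (hp_pos : forall i, 0 < p i)
    (hmu : self_similar T p mu)
    (q alpha : R)
    (hq : derivable (fun u : R => fine (fine_Lq_spectrum mu u)) q 1)
    (halpha : alpha = derive1 (fun u : R => fine (fine_Lq_spectrum mu u)) q) :
  multifractal_spectrum mu alpha =
  concave_conjugate (fine_Lq_spectrum mu) alpha.
Proof.
have i0 : I by have := gl_card hT; case: (pickP (@predT I)) => // /eq_card0 ->.
apply/eqP; rewrite eq_le; apply/andP; split.
  apply: le_ereal_inf_tmp => _ [u _ <-].
  have [w sw [-> fin]] := fine_Lq_spectrumE i0 hT hL hsep hp hp_pos hmu u.
  rewrite -EFinB opprB; apply/lee_addgt0Pr => e e0; rewrite -EFinD -addrA.
  by apply: olsen_upper; apply: fin; rewrite ltrDl.
have [w sw [gq fin]] := fine_Lq_spectrumE i0 hT hL hsep hp hp_pos hmu q.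
have alphaE : alpha = ly_loc T p w.
  rewrite halpha; apply: (derive_touching hq (d := ly_dim T w)); last by rewrite gq.
  by move=> u; exact: (fine_Lq_spectrum_le i0 hT hL hsep hp hp_pos hmu _ sw).
have [w0 w1] := sw.
have ge := spectrum_ge i0 hT hL hsep hp hp_pos hmu w0 w1; rewrite -alphaE in ge.
apply: (@le_trans _ _ (ly_dim T w)%:E) ge.
have -> : (ly_dim T w)%:E = ((q * alpha)%:E - fine_Lq_spectrum mu q)%E.
  by rewrite gq -alphaE -EFinB opprB addrC subrK.
by apply: ereal_inf_lbound; exists q.
Qed.
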